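(* Let $d\ge 1$ and let $E\subset\mathbb{R}^d$ be a measurable set satisfying the $1$-GCC. Then for any $\beta>0$ and $\delta>0$ there exists a constant $C>0$ such that for every $R>0$, $$\|f\|_{L^2(\mathbb{R}^d)}\le C\,\|f\|_{L^2(\mathcal{U}_\delta(E))}$$ whenever $f\in L^2(\mathbb{R}^d)$ satisfies $\operatorname{spec}(f)\subset\{\xi\in\mathbb{R}^d:\ R-\beta\le|\xi|\le R+\beta\}$. In particular, $C$ does not depend on $R$.
   Context: For $k\in\{1,\dots,d\}$, $\ell>0$, $\gamma>0$, a set $E\subset\mathbb{R}^d$ satisfies the $k$-dimensional $(\ell,\gamma)$-geometric control condition (GCC) if for every $k$-dimensional cube $Q\subset\mathbb{R}^d$ (a cube lying in some $k$-dimensional affine plane, of arbitrary position and orientation) of side-length at least $\ell$, one has $\mathcal{H}^k(Q\cap E)\ge\gamma\ell^k$, where $\mathcal{H}^k$ is $k$-dimensional Hausdorff measure. $E$ satisfies the $k$-GCC if it satisfies the $k$-dimensional $(\ell,\gamma)$-GCC for some $\ell>0,\gamma>0$. For $A\subset\mathbb{R}^d$ and $\delta>0$, $\mathcal{U}_\delta(A)$ denotes the open $\delta$-neighborhood of $A$. For $f\in L^2(\mathbb{R}^d)$, $\operatorname{spec}(f)$ denotes the support of the Fourier transform $\widehat f$. *)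

(* Defs.v *)
(* R^d is modelled as d.-tuple R
   (equipped by the library with its product Borel sigma-algebra). *)
From HB Require Import structures.
From mathcomp Require Import all_boot all_order all_algebra.
From mathcomp Require Import all_classical all_reals all_analysis.
Set Implicit Arguments. Unset Strict Implicit. Unset Printing Implicit Defensive.
Import Order.TTheory GRing.Theory Num.Theory.
Import numFieldNormedType.Exports.
Local Open Scope classical_set_scope.
Local Open Scope ring_scope.

Section Defs.
Variable R : realType.

Definition dotp (d : nat) (x y : d.-tuple R) : R :=
  \sum_(i < d) tnth x i * tnth y i.
Definition enorm (d : nat) (x : d.-tuple R) : R := Num.sqrt (dotp x x).
Definition edist (d : nat) (x y : d.-tuple R) : R :=
  Num.sqrt (\sum_(i < d) (tnth x i - tnth y i) ^+ 2).

Definition Unbhd (d : nat) (delta : R) (A : set (d.-tuple R)) : set (d.-tuple R) :=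
  [set x | exists2 y, A y & edist x y < delta].

Definition box (d : nat) (a b : d.-tuple R) : set (d.-tuple R) :=
  [set x | forall i : 'I_d, tnth a i <= tnth x i <= tnth b i].
Definition boxvol (d : nat) (a b : d.-tuple R) : R :=
  \prod_(i < d) (tnth b i - tnth a i).
Definition leb_outer (d : nat) (A : set (d.-tuple R)) : \bar R :=
  ereal_inf [set s | exists (a b : nat -> d.-tuple R),
     [/\ (forall n (i : 'I_d), tnth (a n) i <= tnth (b n) i),
         A `<=` \bigcup_n box (a n) (b n) &
         s = (\sum_(0 <= n <oo) (boxvol (a n) (b n))%:E)%E]].
Definition leb_measurable (d : nat) (E : set (d.-tuple R)) : Prop :=
  forall A : set (d.-tuple R),
    leb_outer A = (leb_outer (A `&` E) + leb_outer (A `&` ~` E))%E.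

Definition ediam (d : nat) (C : set (d.-tuple R)) : \bar R :=
  ereal_sup ([set 0%E] `|` [set r | exists x y, [/\ C x, C y & r = (edist x y)%:E]]).
Definition hausdorff1_eps (d : nat) (eps : R) (A : set (d.-tuple R)) : \bar R :=
  ereal_inf [set s | exists C : nat -> set (d.-tuple R),
     [/\ A `<=` \bigcup_n C n, (forall n, (ediam (C n) <= eps%:E)%E) &
         s = (\sum_(0 <= n <oo) ediam (C n))%E]].
Definition hausdorff1 (d : nat) (A : set (d.-tuple R)) : \bar R :=
  ereal_sup [set hausdorff1_eps eps A | eps in [set e : R | 0 < e]].

Definition segment (d : nat) (a u : d.-tuple R) (L : R) : set (d.-tuple R) :=
  [set x | exists2 t : R, 0 <= t <= L &
             forall i : 'I_d, tnth x i = tnth a i + t * tnth u i].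

Definition GCC1 (d : nat) (ell gamma : R) (E : set (d.-tuple R)) : Prop :=
  forall (a u : d.-tuple R) (L : R), enorm u = 1 -> ell <= L ->
    ((gamma * ell)%:E <= hausdorff1 (segment a u L `&` E))%E.
Definition satisfies_GCC1 (d : nat) (E : set (d.-tuple R)) : Prop :=
  exists ell gamma : R, [/\ 0 < ell, 0 < gamma & GCC1 ell gamma E].

(* Lebesgue integral on R^d of a nonnegative function, as the iterated
   integral  int dx_0 int dx_1 ... int dx_{d-1}  (Tonelli). *)
Fixpoint iint (n : nat) : (n.-tuple R -> \bar R) -> \bar R :=
  match n return (n.-tuple R -> \bar R) -> \bar R with
  | 0 => fun h => h [tuple]
  | m.+1 => fun h =>
      (\int[@lebesgue_measure R]_x iint (fun t : m.-tuple R => h (cons_tuple x t)))%E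
  end.
Definition rint (d : nat) (h : d.-tuple R -> R) : R :=
  fine (iint (fun x => (Num.max (h x) 0)%:E)) -
  fine (iint (fun x => (Num.max (- h x) 0)%:E)).

(* complex-valued functions are represented by (real part, imaginary part) *)
Definition L2sq (d : nat) (A : set (d.-tuple R)) (f1 f2 : d.-tuple R -> R) : \bar R :=
  iint (fun x => (\1_A x * (f1 x ^+ 2 + f2 x ^+ 2))%:E).
Definition L2norm (d : nat) (A : set (d.-tuple R)) (f1 f2 : d.-tuple R -> R) : \bar R :=
  match L2sq A f1 f2 with
  | r%:E => (Num.sqrt r)%:E
  | +oo%E => +oo%E
  | -oo%E => 0%E
  end.

(* Fourier transform (convention  \hat f(xi) = int f(x) e^{-2 pi i x.xi} dx)
   of the truncation f 1_{|x| <= n}, which lies in L^1 when f is in L^2 *)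
Definition trunc_FT_re (d : nat) (f1 f2 : d.-tuple R -> R) (n : nat) (xi : d.-tuple R) : R :=
  rint (fun x => \1_[set y | enorm y <= n%:R] x *
     (f1 x * cos (2 * pi * dotp x xi) + f2 x * sin (2 * pi * dotp x xi))).
Definition trunc_FT_im (d : nat) (f1 f2 : d.-tuple R -> R) (n : nat) (xi : d.-tuple R) : R :=
  rint (fun x => \1_[set y | enorm y <= n%:R] x *
     (f2 x * cos (2 * pi * dotp x xi) - f1 x * sin (2 * pi * dotp x xi))).

Definition is_L2_FT (d : nat) (f1 f2 g1 g2 : d.-tuple R -> R) : Prop :=
  (fun n : nat => L2sq setT (fun xi => trunc_FT_re f1 f2 n xi - g1 xi)
                            (fun xi => trunc_FT_im f1 f2 n xi - g2 xi))
    @ \oo --> (0 : \bar R).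

End Defs.

(* Main.v *)
(* Localize f in frequency to a cube eta + [-A/2, A/2]^d, A large but fixed: on the physical side
   this multiplies f by the translates of a product of sinc kernels before taking the Fourier
   transform at eta (lemma [window_localization]).  When R is large the cube meets the annulus in
   a cap on which xi.e = R + O(1) for the unit vector e = eta/|eta|; when R is bounded this holds
   for any e.  Hence along each line of direction e the localized function is e^{2 pi i R t}
   times a function of bounded frequency, and after demodulation Newton's forward-difference
   formula extrapolates it, with geometrically small error, from k closely spaced nodes to any
   point within distance ell.  By the 1-GCC such nodes can be found near E on every segment of
   length ell.  Squaring and integrating over x and eta with Plancherel turns this into
   |f|^2 <= C (|f|^2 near E) + (tail of the sinc kernel + extrapolation error) |f|^2
            + C' (energy of f-hat off the annulus),
   where the middle term is absorbed once k and then A are chosen, and the last one vanishes in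
   the limit of the truncations f 1_{|x| <= N}. *)
Require Import Defs.
From HB Require Import structures.
From mathcomp Require Import all_boot all_order all_algebra.
From mathcomp Require Import all_classical all_reals all_analysis.
From mathcomp Require Import measurable_realfun ring lra.
Import Order.TTheory GRing.Theory Num.Theory.
Import numFieldNormedType.Exports.
Set Implicit Arguments.
Unset Strict Implicit.
Unset Printing Implicit Defensive.
Local Open Scope classical_set_scope.
Local Open Scope ring_scope.

(** The order of the choices is what keeps the constant free of [Rad]. The number [k] of nodes
    depends on [ell], on the node radius [r] and on the bound [b] for [|xi.e - Rad|]; the side [A]
    comes afterwards, because the energy that the sinc kernel leaks beyond distance [r] is of order
    [A ^ (n - 1)] against a main term [A ^ n], but is multiplied by extrapolation constants
    depending on [k]. So [b] must not depend on [A]: for large [Rad] the flatness of the cap allows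
    [b = beta + 1] whatever [A] is, and how large is large is decided by [A]. The bounded range that
    remains gets its own [b], hence its own [k] and [A]. Transforms are computed pointwise only for
    integrable functions, hence the truncations; these are no longer band-limited, and the energy
    off the annulus may carry a crude constant because it tends to 0. All estimates are made for
    real functions: cosine and sine integrals replace the complex transform, phase shifts replace
    multiplication by unit complex numbers, and the real and imaginary parts of f are recombined at
    the end thanks to the symmetry of the annulus. *)

Section RealIntegrals.
Context d (T : measurableType d) (R : realType) (m : {measure set T -> \bar R}).
Implicit Types (f g : T -> R).

Lemma ge0_integral_EFinD f g : measurable_fun setT f -> measurable_fun setT g ->
  (forall x, 0 <= f x) -> (forall x, 0 <= g x) ->
  (\int[m]_x (f x + g x)%:E = \int[m]_x (f x)%:E + \int[m]_x (g x)%:E)%E.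
Proof.
move=> mf mg f0 g0; under eq_integral do rewrite EFinD.
rewrite ge0_integralD//; first by move=> x _; rewrite lee_fin.
- exact/measurable_EFinP.
- by move=> x _; rewrite lee_fin.
- exact/measurable_EFinP.
Qed.

Lemma ge0_integral_EFinZ c f : measurable_fun setT f -> (forall x, 0 <= f x) -> 0 <= c ->
  (\int[m]_x (c * f x)%:E = c%:E * \int[m]_x (f x)%:E)%E.
Proof.
move=> mf f0 c0; under eq_integral do rewrite EFinM.
rewrite ge0_integralZl//; first exact/measurable_EFinP.
by move=> x _; rewrite lee_fin.
Qed.

Lemma ge0_integral_EFin_sum k (f : nat -> T -> R) : (forall j, measurable_fun setT (f j)) ->
  (forall j x, 0 <= f j x) ->
  (\int[m]_x (\sum_(j < k) f j x)%:E = \sum_(j < k) \int[m]_x (f j x)%:E)%E.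
Proof.
move=> mf f0; under eq_integral do rewrite -sumEFin.
rewrite ge0_integral_sum//; first by move=> j; exact/measurable_EFinP.
by move=> j x _; rewrite lee_fin.
Qed.

Lemma ge0_le_integral_EFin f g : measurable_fun setT f -> measurable_fun setT g ->
  (forall x, 0 <= f x) -> (forall x, f x <= g x) ->
  (\int[m]_x (f x)%:E <= \int[m]_x (g x)%:E)%E.
Proof.
move=> mf mg f0 fg; apply: ge0_le_integral => //.
- by move=> x _; rewrite lee_fin.
- exact/measurable_EFinP.
- exact/measurable_EFinP.
- by move=> x _; rewrite lee_fin.
Qed.

Lemma ge0_integrable f : measurable_fun setT f -> (forall x, 0 <= f x) ->
  (\int[m]_x (f x)%:E < +oo)%E -> m.-integrable setT (EFin \o f).
Proof.
move=> mf f0 fy; apply/integrableP; split; first exact/measurable_EFinP.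
by under eq_integral do rewrite /= ger0_norm//.
Qed.

End RealIntegrals.

Lemma measurable_integral_EFin d1 d2 (T1 : measurableType d1) (T2 : measurableType d2) (R : realType)
    (m : {sigma_finite_measure set T1 -> \bar R}) (k : T1 * T2 -> R) :
  measurable_fun setT k -> (forall p, 0 <= k p) ->
  measurable_fun setT (fun y => \int[m]_x (k (x, y))%:E)%E.
Proof.
move=> mk k0; apply: (@measurable_fun_fubini_tonelli_G _ _ _ _ _ m (EFin \o k)).
  exact/measurable_EFinP.
by move=> p; rewrite lee_fin.
Qed.

Lemma indicM_le (T : Type) (R : numDomainType) (S : set T) (x : T) (a : R) :
  0 <= a -> \1_S x * a <= a.
Proof. by move=> a0; rewrite ler_piMl// indicE lern1 leq_b1. Qed.

(** * Lebesgue measure on tuples and its invariances *)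

Section LebesgueTuple.
Variable R : realType.
Definition leb : {sigma_finite_measure set (measurableTypeR R) -> \bar R} := @lebesgue_measure R.

Definition consp n (p : measurableTypeR R * n.-tuple R) : n.+1.-tuple R := cons_tuple p.1 p.2.
Definition unconsp n (t : n.+1.-tuple R) : measurableTypeR R * n.-tuple R := (thead t, behead_tuple t).

Lemma conspK n : cancel (@consp n) (@unconsp n).
Proof.
case=> x t; rewrite /unconsp /consp /=; congr pair.
by apply: val_inj => /=.
Qed.

Lemma unconspK n : cancel (@unconsp n) (@consp n).
Proof. by move=> t; rewrite /consp /= [RHS]tuple_eta; apply: val_inj. Qed.

Lemma measurable_consp n : measurable_fun [set: measurableTypeR R * n.-tuple R] (@consp n).
Proof. exact: measurable_cons. Qed.

Lemma measurable_unconsp n : measurable_fun setT (@unconsp n).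
Proof.
apply/measurable_fun_pairP; split => /=.
  exact: (@measurable_tnth _ _ _ ord0).
exact: measurable_behead.
Qed.

Section push.
Variables (n : nat) (m : {sigma_finite_measure set (n.-tuple R) -> \bar R}).

Definition leb_cons : set (n.+1.-tuple R) -> \bar R :=
  pushforward (leb \x m)%E (@consp n).

HB.instance Definition _ := Measure.copy leb_cons
  (measure_function_pushforward__canonical__measure_function_Measure
     (leb \x m)%E (@measurable_consp n)).

Lemma leb_cons_sigma_finite : sigma_finite setT leb_cons.
Proof.
have /sigma_finiteP[F [TF ndF Foo]] := sigma_finiteT leb.
have /sigma_finiteP[G [TG ndG Goo]] := sigma_finiteT m.
exists (fun k => (@unconsp n) @^-1` (F k `*` G k)).
  rewrite -preimage_bigcup (_ : \bigcup_k _ = setT) ?preimage_setT//.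
  rewrite -setXTT TF TG predeqE => -[x y]; split.
    by move=> [k _ []/= ? ?]; split; exists k.
  move=> [/= [k _ Fkx] [l _ Gly]]; exists (maxn k l) => //; split.
  - by move: x Fkx; exact/subsetPset/ndF/leq_maxl.
  - by move: y Gly; exact/subsetPset/ndG/leq_maxr.
move=> k; have [mF Fk] := Foo k; have [mG Gk] := Goo k; split.
  by rewrite -[X in measurable X]setTI; apply: measurable_unconsp => //; exact: measurableX.
rewrite /leb_cons /pushforward -comp_preimage (_ : _ \o _ = id); last first.
  by apply/funext => p /=; rewrite conspK.
by rewrite preimage_id product_measure1E// lte_mul_pinfty// ge0_fin_numE.
Qed.

HB.instance Definition _ := Measure_isSigmaFinite.Build _ _ _ leb_cons
  leb_cons_sigma_finite.
End push.

HB.instance Definition _ := isFinite.Build _ _ _ (\d_([tuple] : 0.-tuple R) : set (0.-tuple R) -> \bar R) (fin_num_measure _).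

(** The recursion copies that of [iint]: a Dirac mass in dimension 0, then a product with [leb] for
    each new coordinate. Thus [iintE] is an induction with Tonelli at each step. *)
Fixpoint mu n : {sigma_finite_measure set (n.-tuple R) -> \bar R} :=
  match n with
  | 0 => (\d_([tuple] : 0.-tuple R))
  | m.+1 => (leb_cons (mu m))
  end.

End LebesgueTuple.

Arguments leb {R}.
Arguments mu {R} n.

Section LebesgueTupleIntegral.
Variable R : realType.
Local Open Scope ereal_scope.

Lemma measurable_cons_tuple n (x : R) :
  measurable_fun setT (fun t : n.-tuple R => cons_tuple x t).
Proof. exact: measurable_cons. Qed.

Lemma ge0_integral_mu_cons n (f : n.+1.-tuple R -> \bar R) :
  measurable_fun setT f -> (forall x, 0 <= f x) ->
  \int[mu n.+1]_x f x = \int[leb]_x \int[mu n]_t f (cons_tuple x t).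
Proof.
move=> mf f0.
rewrite [LHS](ge0_integral_pushforward (@measurable_consp R n) (leb \x mu n) measurableT mf)//.
rewrite preimage_setT fubini_tonelli1//; last by move=> p; exact: f0.
exact: (measurableT_comp mf (@measurable_consp R n)).
Qed.

Lemma measurable_integral_mu_cons n (f : n.+1.-tuple R -> \bar R) :
  measurable_fun setT f -> (forall x, 0 <= f x) ->
  measurable_fun [set: measurableTypeR R] (fun x => \int[mu n]_t f (cons_tuple x t)).
Proof.
move=> mf f0.
apply: (@measurable_fun_fubini_tonelli_F _ _ _ _ _ (mu n) (fun p => f (consp p))) => //.
exact: (measurableT_comp mf (@measurable_consp R n)).
Qed.

Lemma iintE n (f : n.-tuple R -> \bar R) :
  measurable_fun setT f -> (forall x, 0 <= f x) -> iint f = \int[mu n]_x f x.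
Proof.
elim: n f => [|n IH] f mf f0.
  by rewrite /= integral_dirac// diracT mul1e.
rewrite ge0_integral_mu_cons//; apply: eq_integral => x _.
by apply: IH => //; exact: (measurableT_comp mf (measurable_cons_tuple x)).
Qed.

(** The image of Lebesgue measure under the translation gives every interval []b, c]] its length, so
    uniqueness of Lebesgue measure identifies the two. *)
Lemma ge0_integral_leb_shift (f : R -> \bar R) (a : R) :
  measurable_fun [set: R] f -> (forall x, 0 <= f x) ->
  \int[leb]_x f (x + a)%R = \int[leb]_x f x.
Proof.
move=> mf f0.
have mad : measurable_fun [set: measurableTypeR R] (fun x : measurableTypeR R => (x + a)%R : measurableTypeR R).
  exact: measurable_funD.
rewrite -[LHS](ge0_integral_pushforward mad leb (D := setT))//.
apply: eq_measure_integral => A mA _; apply/esym.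
apply: (@lebesgue_measure_unique R (pushforward leb (fun x : measurableTypeR R => (x + a)%R : measurableTypeR R))) => //=.
move=> _ [[b c]] _ <-.
rewrite /pushforward (_ : _ @^-1` _ = `](b - a)%R, (c - a)%R]%classic); last first.
  by apply/seteqP; split=> x /=; rewrite !in_itv/= lerBrDr ltrBlDr.
rewrite /leb !lebesgue_measure_itv/= !lte_fin ltrD2r.
by case: ifP => // _; rewrite -!EFinB opprB addrA subrK.
Qed.

Lemma ge0_integral_leb_opp (f : R -> \bar R) :
  measurable_fun [set: R] f -> (forall x, 0 <= f x) ->
  \int[leb]_x f (- x)%R = \int[leb]_x f x.
Proof.
move=> mf f0.
have mad : measurable_fun [set: measurableTypeR R] (-%R : measurableTypeR R -> measurableTypeR R).
  exact: measurable_funN.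
rewrite -[LHS](ge0_integral_pushforward mad leb (D := setT))//.
by apply: eq_measure_integral => A mA _; rewrite -[RHS]lebesgue_measureN.
Qed.

Definition tadd n (x y : n.-tuple R) : n.-tuple R := [tuple (tnth x i + tnth y i)%R | i < n].
Definition topp n (x : n.-tuple R) : n.-tuple R := [tuple (- tnth x i)%R | i < n].
Definition tscale n (s : R) (x : n.-tuple R) : n.-tuple R := [tuple (s * tnth x i)%R | i < n].
Definition tsub n (x y : n.-tuple R) : n.-tuple R := [tuple (tnth x i - tnth y i)%R | i < n].

Lemma tuple_consE n (P : n.+1.-tuple R) x t :
  tnth P ord0 = x -> (forall i, tnth P (lift ord0 i) = tnth t i) -> P = cons_tuple x t.
Proof.
move=> P0 PS; apply: eq_from_tnth => i.
by case: (unliftP ord0 i) => [j ->|->]; rewrite ?PS ?P0 ?tnthS ?tnth0.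
Qed.

Lemma measurable_mktuple d (T : measurableType d) n (F : 'I_n -> T -> R) :
  (forall i, measurable_fun setT (F i)) ->
  measurable_fun setT (fun x => [tuple F i x | i < n]).
Proof.
move=> mF; apply/measurable_fun_tnthP => i.
by rewrite (_ : _ \o _ = F i)//; apply/funext => x /=; rewrite tnth_mktuple.
Qed.

Lemma measurable_tnthf d (T : measurableType d) n (f : T -> n.-tuple R) i :
  measurable_fun setT f -> measurable_fun setT (fun x => tnth (f x) i).
Proof. by move/measurable_fun_tnthP => /(_ i). Qed.

Lemma measurable_tadd d (T : measurableType d) n (f g : T -> n.-tuple R) :
  measurable_fun setT f -> measurable_fun setT g ->
  measurable_fun setT (fun x => tadd (f x) (g x)).
Proof.
move=> mf mg; apply: measurable_mktuple => i.
by apply: measurable_funD; exact: measurable_tnthf.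
Qed.

Lemma measurable_tsub d (T : measurableType d) n (f g : T -> n.-tuple R) :
  measurable_fun setT f -> measurable_fun setT g ->
  measurable_fun setT (fun x => tsub (f x) (g x)).
Proof.
move=> mf mg; apply: measurable_mktuple => i.
by apply: measurable_funB; exact: measurable_tnthf.
Qed.

Lemma measurable_topp d (T : measurableType d) n (f : T -> n.-tuple R) :
  measurable_fun setT f -> measurable_fun setT (fun x => topp (f x)).
Proof.
move=> mf; apply: measurable_mktuple => i.
by apply: measurableT_comp => //; exact: measurable_tnthf.
Qed.

(** Common source of the invariance under translations and under reflection: both act coordinate by
    coordinate, so the one-dimensional invariance propagates by induction on [n]. *)
Lemma ge0_integral_mu_coord n (c : 'I_n -> R -> R) (f : n.-tuple R -> \bar R) :
  (forall i, measurable_fun setT (c i)) ->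
  (forall i (g : R -> \bar R), measurable_fun setT g -> (forall x, 0 <= g x) ->
    \int[leb]_x g (c i x) = \int[leb]_x g x) ->
  measurable_fun setT f -> (forall x, 0 <= f x) ->
  \int[mu n]_x f [tuple c i (tnth x i) | i < n] = \int[mu n]_x f x.
Proof.
elim: n c f => [|n IH] c f mc cE mf f0.
  by apply: eq_integral => x _; congr f; rewrite (tuple0 x) tuple0.
have mfc : measurable_fun setT (fun x : n.+1.-tuple R => f [tuple c i (tnth x i) | i < n.+1]).
  apply: (measurableT_comp mf); apply: measurable_mktuple => i.
  exact: (measurableT_comp (mc i) (measurable_tnth i)).
have mft x : measurable_fun setT (fun t => f (cons_tuple x t)).
  exact: (measurableT_comp mf (measurable_cons_tuple x)).
rewrite (ge0_integral_mu_cons mfc (fun x => f0 _)) (ge0_integral_mu_cons mf f0).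
rewrite -(cE ord0 (fun x => \int[mu n]_t f (cons_tuple x t))); last 2 first.
- exact: measurable_integral_mu_cons.
- by move=> x; exact: integral_ge0.
apply: eq_integral => x _.
rewrite -(IH (fun i => c (lift ord0 i)) _ (fun i => mc _) (fun i => cE _) (mft (c ord0 x)) (fun t => f0 _)).
apply: eq_integral => t _; congr f.
by apply: tuple_consE => [|i]; rewrite !tnth_mktuple ?tnth0 ?tnthS.
Qed.

Lemma ge0_integral_mu_shift n (f : n.-tuple R -> \bar R) a :
  measurable_fun setT f -> (forall x, 0 <= f x) ->
  \int[mu n]_x f (tadd x a) = \int[mu n]_x f x.
Proof.
apply: (@ge0_integral_mu_coord _ (fun i x => x + tnth a i)%R) => [i|i g].
  exact: measurable_funD.
exact: ge0_integral_leb_shift.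
Qed.

Lemma ge0_integral_mu_opp n (f : n.-tuple R -> \bar R) :
  measurable_fun setT f -> (forall x, 0 <= f x) ->
  \int[mu n]_x f (topp x) = \int[mu n]_x f x.
Proof.
apply: (@ge0_integral_mu_coord _ (fun _ x => - x)%R) => [i|i g].
  exact: measurable_funN.
exact: ge0_integral_leb_opp.
Qed.

Lemma ge0_integral_mu_subr n (f : n.-tuple R -> \bar R) a :
  measurable_fun setT f -> (forall x, 0 <= f x) ->
  \int[mu n]_x f (tsub a x) = \int[mu n]_x f x.
Proof.
move=> mf f0; rewrite -(ge0_integral_mu_shift a mf f0).
rewrite -(ge0_integral_mu_opp (f := fun x => f (tadd x a)))//.
  apply: eq_integral => x _; congr f; apply: eq_from_tnth => i.
  by rewrite !tnth_mktuple addrC.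
by apply: (measurableT_comp mf); exact: measurable_tadd.
Qed.

Lemma ge0_integral_mu_subl n (f : n.-tuple R -> \bar R) a :
  measurable_fun setT f -> (forall x, 0 <= f x) ->
  \int[mu n]_x f (tsub x a) = \int[mu n]_x f x.
Proof.
move=> mf f0; rewrite -(ge0_integral_mu_shift (topp a) mf f0).
apply: eq_integral => x _; congr f; apply: eq_from_tnth => i.
by rewrite !tnth_mktuple.
Qed.

End LebesgueTupleIntegral.

(** * Fubini for real integrals under a product bound *)

Section DominatedFubini.
Context d1 d2 (T1 : measurableType d1) (T2 : measurableType d2) (R : realType).
Variables (m1 : {sigma_finite_measure set T1 -> \bar R})
  (m2 : {sigma_finite_measure set T2 -> \bar R}).
Implicit Types (k : T1 * T2 -> R).

Lemma integrable_dom d (T : measurableType d) (m : {measure set T -> \bar R}) (f g : T -> R) :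
  measurable_fun setT f -> m.-integrable setT (EFin \o g) ->
  (forall x, `|f x| <= g x) -> m.-integrable setT (EFin \o f).
Proof.
move=> mf ig fg; apply: (le_integrable measurableT _ _ ig).
  exact/measurable_EFinP.
by move=> x _ /=; rewrite lee_fin (le_trans (fg x))// ler_norm.
Qed.

Lemma integrable_mulr d (T : measurableType d) (m : {measure set T -> \bar R}) (f : T -> R) c :
  m.-integrable setT (EFin \o f) -> m.-integrable setT (EFin \o (fun x => f x * c)).
Proof.
by move=> If; have := integrableZr measurableT c If; apply: eq_integrable => // x _ /=; rewrite EFinM.
Qed.

Lemma EFin_Rintegral d (T : measurableType d) (m : {measure set T -> \bar R}) (f : T -> R) :
  m.-integrable setT (EFin \o f) -> (\int[m]_x f x)%:E = (\int[m]_x (f x)%:E)%E.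
Proof. by move=> If; rewrite fineK//; exact: integrable_fin_num. Qed.

(** Holds without integrability: the positive and negative parts have measurable integrals by
    Tonelli, and [fine] supplies a default where their difference is infinite. *)
Lemma measurable_Rintegral1 k : measurable_fun setT k ->
  measurable_fun setT (fun y => \int[m1]_x k (x, y)).
Proof.
move=> mk; rewrite /Rintegral; apply: (measurableT_comp (fine_measurable measurableT)).
have mEk : measurable_fun setT (EFin \o k) by exact/measurable_EFinP.
rewrite (_ : (fun _ => _) = fubini_G m1 (EFin \o k)^\+ \- fubini_G m1 (EFin \o k)^\-)%E; last first.
  apply/funext => y; rewrite [LHS]integralE /fubini_G.
  by congr (_ - _)%E; apply: eq_integral => x _; rewrite ?funeposE ?funenegE.
apply: emeasurable_funB.
- by apply: measurable_fun_fubini_tonelli_G => //; exact: measurable_funepos.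
- by apply: measurable_fun_fubini_tonelli_G => //; exact: measurable_funeneg.
Qed.

Variables (phi : T1 -> R) (psi : T2 -> R).
Hypotheses (iphi : m1.-integrable setT (EFin \o phi))
  (ipsi : m2.-integrable setT (EFin \o psi)).

(** Domination by a product of two integrable functions gives joint integrability and, in the two
    lemmas that follow, integrability of every section rather than of almost every one. *)
Lemma integrable_dom2 k : measurable_fun setT k ->
  (forall x y, `|k (x, y)| <= phi x * psi y) ->
  (m1 \x m2)%E.-integrable setT (EFin \o k).
Proof.
move=> mk kle; apply/integrable12ltyP; first exact/measurable_EFinP.
have mphi : measurable_fun setT phi by case/integrableP: iphi => /measurable_EFinP.
have mpsi : measurable_fun setT psi by case/integrableP: ipsi => /measurable_EFinP.
have mphiE : measurable_fun setT (fun x => (`|phi x|)%:E).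
  by apply/measurable_EFinP; exact: measurableT_comp.
have mpsiE : measurable_fun setT (fun x => (`|psi x|)%:E).
  by apply/measurable_EFinP; exact: measurableT_comp.
have kle' x y : (`|(EFin \o k) (x, y)| <= (`|phi x|)%:E * (`|psi y|)%:E)%E.
  by rewrite /= lee_fin -normrM (le_trans (kle x y))// ler_norm.
have fphi : (\int[m1]_x (`|phi x|)%:E)%E \is a fin_num.
  exact: (integrable_fin_num measurableT (integrable_norm iphi)).
have fpsi : (\int[m2]_x (`|psi x|)%:E)%E \is a fin_num.
  exact: (integrable_fin_num measurableT (integrable_norm ipsi)).
apply: (@le_lt_trans _ _ (\int[m1]_x ((`|phi x|)%:E * \int[m2]_y (`|psi y|)%:E))%E); last first.
  rewrite ge0_integralZr//; last exact: integral_ge0.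
  by rewrite -(fineK fphi) -(fineK fpsi) -EFinM ltry.
apply: ge0_le_integral => //.
- by move=> x _; exact: integral_ge0.
- apply: (@measurable_fun_fubini_tonelli_F _ _ _ _ _ m2 (fun p => `|(EFin \o k) p|%E)) => //.
  by apply: measurableT_comp => //; exact/measurable_EFinP.
- by apply: emeasurable_funM.
move=> x _; rewrite -ge0_integralZl//.
apply: ge0_le_integral => //.
- apply: measurableT_comp => //; apply/measurable_EFinP.
  exact: (measurableT_comp mk (pair1_measurable x)).
- by apply: emeasurable_funM.
Qed.

Lemma integrable_dom2_sec1 k y : measurable_fun setT k ->
  (forall x y, `|k (x, y)| <= phi x * psi y) ->
  m1.-integrable setT (fun x => (k (x, y))%:E).
Proof.
move=> mk kle; apply: (@integrable_dom _ _ m1 (fun x => k (x, y)) (fun x => phi x * psi y)) => //.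
  exact: (measurableT_comp mk (pair2_measurable y)).
have := integrableZr measurableT (psi y) iphi.
by apply: eq_integrable => // x _ /=; rewrite EFinM.
Qed.

Lemma integrable_dom2_sec2 k x : measurable_fun setT k ->
  (forall x y, `|k (x, y)| <= phi x * psi y) ->
  m2.-integrable setT (fun y => (k (x, y))%:E).
Proof.
move=> mk kle; apply: (@integrable_dom _ _ m2 (fun y => k (x, y)) (fun y => phi x * psi y)) => //.
  exact: (measurableT_comp mk (pair1_measurable x)).
have := integrableZl measurableT (phi x) ipsi.
by apply: eq_integrable => // y _ /=; rewrite EFinM.
Qed.

Lemma Rintegral_prod k : measurable_fun setT k ->
  (forall x y, `|k (x, y)| <= phi x * psi y) ->
  \int[m1]_x \int[m2]_y k (x, y) = \int[(m1 \x m2)%E]_p k p.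
Proof.
move=> mk kle; have ik := integrable_dom2 mk kle.
rewrite /Rintegral -(integral12_prod_meas1 ik); congr fine; apply: eq_integral => x _.
by rewrite -[RHS]EFin_Rintegral//; exact: integrable_dom2_sec2.
Qed.

Lemma Rfubini k : measurable_fun setT k ->
  (forall x y, `|k (x, y)| <= phi x * psi y) ->
  \int[m1]_x \int[m2]_y k (x, y) = \int[m2]_y \int[m1]_x k (x, y).
Proof.
move=> mk kle; have ik := integrable_dom2 mk kle.
rewrite Rintegral_prod// /Rintegral -(integral21_prod_meas1 ik); congr fine; apply: eq_integral => y _.
by rewrite [RHS]EFin_Rintegral//; exact: integrable_dom2_sec1.
Qed.

End DominatedFubini.

(** * Cosine transforms of product weights *)

Section ProductKernels.
Variable R : realType.

Lemma Rintegral_mu_cons n (f : n.+1.-tuple R -> R) (phi : R -> R) (psi : n.-tuple R -> R) :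
  measurable_fun setT f ->
  leb.-integrable setT (EFin \o phi) -> (mu n).-integrable setT (EFin \o psi) ->
  (forall x t, `|f (cons_tuple x t)| <= phi x * psi t) ->
  (mu n.+1).-integrable setT (EFin \o f) /\
  \int[mu n.+1]_x f x = \int[leb]_x \int[mu n]_t f (cons_tuple x t).
Proof.
move=> mf iphi ipsi fle.
have mk : measurable_fun setT (fun p : measurableTypeR R * n.-tuple R => f (consp p)).
  exact: (measurableT_comp mf (@measurable_consp R n)).
have mEf : measurable_fun setT (EFin \o f) by exact/measurable_EFinP.
have ik : (leb \x mu n)%E.-integrable ((@consp R n) @^-1` setT) ((EFin \o f) \o @consp R n).
  rewrite preimage_setT.
  apply: (@integrable_dom2 _ _ _ _ _ leb (mu n) phi psi iphi ipsi (fun p => f (consp p))) => //.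
have I := integrable_pushforward (@measurable_consp R n) mEf ik measurableT.
split; first exact: I.
rewrite (Rintegral_prod iphi ipsi mk)//.
rewrite /Rintegral; congr fine.
exact: (integral_pushforward (@measurable_consp R n) mEf ik measurableT).
Qed.

Definition tprod n (w : R -> R) (x : n.-tuple R) : R := \prod_(i < n) w (tnth x i).

Lemma tprod_cons n (w : R -> R) x (t : n.-tuple R) :
  tprod w (cons_tuple x t) = w x * tprod w t.
Proof.
rewrite /tprod big_ord_recl tnth0; congr (_ * _).
by apply: eq_bigr => i _; rewrite tnthS.
Qed.

Lemma dotp_cons n (b : n.+1.-tuple R) x (t : n.-tuple R) :
  dotp b (cons_tuple x t) = thead b * x + dotp (behead_tuple b) t.
Proof.
rewrite /dotp big_ord_recl tnth0; congr (_ + _).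
by apply: eq_bigr => i _; rewrite tnthS [in LHS](tuple_eta b) tnthS.
Qed.

Lemma measurable_tprod d (T : measurableType d) n (w : R -> R) (f : T -> n.-tuple R) :
  measurable_fun setT w -> measurable_fun setT f ->
  measurable_fun setT (fun x => tprod w (f x)).
Proof.
move=> mw mf; apply: measurable_prod => i _.
by apply: (measurableT_comp mw); exact: measurable_tnthf.
Qed.

Lemma measurable_dotp d (T : measurableType d) n (f g : T -> n.-tuple R) :
  measurable_fun setT f -> measurable_fun setT g ->
  measurable_fun setT (fun x => dotp (f x) (g x)).
Proof.
move=> mf mg; apply: measurable_sum => i.
by apply: measurable_funM; exact: measurable_tnthf.
Qed.

Lemma tprod_ge0 n (w : R -> R) (x : n.-tuple R) : (forall t, 0 <= w t) -> 0 <= tprod w x.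
Proof. by move=> w0; apply: prodr_ge0. Qed.

Lemma measurable_cosf d (T : measurableType d) (f : T -> R) :
  measurable_fun setT f -> measurable_fun setT (fun x => cos (f x)).
Proof.
move=> mf; apply: (measurableT_comp _ mf).
by apply: continuous_measurable_fun; exact: continuous_cos.
Qed.

Lemma measurable_sinf d (T : measurableType d) (f : T -> R) :
  measurable_fun setT f -> measurable_fun setT (fun x => sin (f x)).
Proof.
move=> mf; apply: (measurableT_comp _ mf).
by apply: continuous_measurable_fun; exact: continuous_sin.
Qed.

Lemma normrM_cos_le (x y : R) : `|x * cos y| <= `|x|.
Proof. by rewrite normrM ler_piMr// cos_max. Qed.

Lemma normrM_sin_le (x y : R) : `|x * sin y| <= `|x|.
Proof. by rewrite normrM ler_piMr// sin_max. Qed.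

Lemma measurable_cos_dotp n (b : n.-tuple R) (c th : R) :
  measurable_fun setT (fun x => cos (c * dotp b x + th)).
Proof.
apply: measurable_cosf; apply: measurable_funD => //; apply: measurable_funM => //.
exact: measurable_dotp.
Qed.

Section cosine.
Variables (w k : R -> R) (c : R).
Hypotheses (w0 : forall x, 0 <= w x)
  (iw : leb.-integrable setT (EFin \o w))
  (hk : forall b th, \int[leb]_x (w x * cos (c * (b * x) + th)) = k b * cos th).

Let mw : measurable_fun setT w.
Proof. by case/integrableP: iw => /measurable_EFinP. Qed.

Lemma tprod_integrable n : (mu n).-integrable setT (EFin \o (@tprod n w)).
Proof.
elim: n => [|n IH].
  apply/integrableP; split; first exact/measurable_EFinP/measurable_tprod.
  rewrite integral_dirac//; first by rewrite diracT mul1e ltry.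
  by apply: measurableT_comp => //; apply/measurable_EFinP; exact: measurable_tprod.
apply: (proj1 (Rintegral_mu_cons _ iw IH _)) => [|x t].
  exact: measurable_tprod.
by rewrite tprod_cons ger0_norm// mulr_ge0// tprod_ge0.
Qed.

(** The free phase [th] lets the induction stay within real cosines: once the first coordinate is
    fixed, its share of the angle joins the phase of the others. Hypothesis [hk] expresses that the
    transform of [w] is the real function [k]. *)
Lemma Rintegral_tprod_cos n (b : n.-tuple R) th :
  \int[mu n]_x (tprod w x * cos (c * dotp b x + th)) = tprod k b * cos th.
Proof.
elim: n b th => [|n IH] b th.
  rewrite /Rintegral integral_dirac//; last first.
    apply/measurable_EFinP; by apply: measurable_funM; [exact: measurable_tprod|exact: measurable_cos_dotp].
  by rewrite diracT mul1e /= /tprod /dotp !big_ord0 mulr0 add0r.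
rewrite (proj2 (Rintegral_mu_cons _ iw (tprod_integrable n) _)); last 2 first.
  by apply: measurable_funM; [exact: measurable_tprod|exact: measurable_cos_dotp].
- move=> x t; rewrite tprod_cons (le_trans (normrM_cos_le _ _))// ger0_norm//.
  by rewrite mulr_ge0// tprod_ge0.
transitivity (\int[leb]_x (tprod k (behead_tuple b) * (w x * cos (c * (thead b * x) + th)))).
  apply: eq_Rintegral => x _.
  under eq_Rintegral => t _.
    rewrite tprod_cons dotp_cons -mulrA.
    rewrite (_ : c * _ + th = c * dotp (behead_tuple b) t + (c * (thead b * x) + th)); last by ring.
    over.
  rewrite RintegralZl// ?IH; first by ring.
  apply: (integrable_dom _ (tprod_integrable n)) => [|t].
    by apply: measurable_funM; [exact: measurable_tprod|exact: measurable_cos_dotp].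
  by rewrite (le_trans (normrM_cos_le _ _))// ger0_norm// tprod_ge0.
rewrite RintegralZl ?hk//; last first.
  apply: (integrable_dom _ iw) => [|t].
    by apply: measurable_funM => //; apply: measurable_cosf; apply: measurable_funD => //; apply: measurable_funM => //; apply: measurable_funM.
  by rewrite (le_trans (normrM_cos_le _ _))// ger0_norm.
by rewrite -[in RHS](unconspK b) [tprod k (consp _)]tprod_cons; ring.
Qed.
End cosine.

End ProductKernels.

(** * One-dimensional integrals: inverse-square tails, box and Poisson kernels *)

Section OneDimensional.
Variable R : realType.

Lemma ge0_integral_leb_split (f : R -> \bar R) :
  measurable_fun [set: R] f -> (forall x, 0 <= f x)%E ->
  (\int[leb]_x f x = \int[leb]_(x in `[0%R, +oo[) f x + \int[leb]_(x in `[0%R, +oo[) f (- x)%R)%E.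
Proof.
move=> mf f0.
have mfN : measurable_fun [set: R] (fun x => f (- x)%R).
  by apply: (measurableT_comp mf); exact: measurable_funN.
have E : [set: measurableTypeR R] = `]-oo, 0%R[ `|` `[0%R, +oo[.
  by apply/seteqP; split => x //= _; rewrite !in_itv /= andbT; case: ltP => _; [left|right].
rewrite [in LHS]E ge0_integral_setU//; first last.
- apply/disj_setPS => x /= [] ; rewrite !in_itv/= andbT => h1 h2.
  by move: (lt_le_trans h1 h2); rewrite ltxx.
- exact: measurable_funTS.
rewrite addeC; congr (_ + _)%E.
rewrite (ge0_integration_by_substitution0 mfN)//.
under [RHS]eq_integral do rewrite opprK.
rewrite (@integral_itv_bndo_bndc _ _ _ f)//.
exact: measurable_funTS.
Qed.

Lemma ge0_integral_is_derive (f F : R -> R) (a l : R) :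
  (forall x, a <= x -> 0 <= f x) ->
  (forall x, a <= x -> {for x, continuous f}) ->
  (forall x, a <= x -> is_derive x 1 F (f x)) ->
  F x @[x --> +oo] --> l ->
  (\int[leb]_(x in `[a, +oo[) (f x)%:E = (l - F a)%:E)%E.
Proof.
move=> f0 cf dF Fl; rewrite (@ge0_continuous_FTC2y R f F a l)//.
- by apply: continuous_in_subspaceT => x /set_mem; rewrite /= in_itv/= andbT; exact: cf.
- by move=> x ax; have [] := dF x (ltW ax).
- apply: cvg_at_right_filter; have [dFa _] := dF a (lexx a).
  exact/differentiable_continuous/derivable1_diffP.
- by move=> x; rewrite in_itv/= andbT => ax; rewrite derive1E; have := dF x (ltW ax) => -[_ ->].
Qed.

Lemma cvgyV : (x : R)^-1 @[x --> +oo] --> (0 : R).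
Proof.
apply/gtr0_cvgV0; last exact: cvg_id.
exact: nbhs_pinfty_gt.
Qed.

Lemma continuous_inv_sqr (r x : R) : 0 < r -> r <= x -> {for x, continuous (fun x : R => x ^- 2)}.
Proof.
move=> r0 rx; have x0 : x ^+ 2 != 0 by rewrite sqrf_eq0 gt_eqF// (lt_le_trans r0).
exact: (cvgV x0 (@exprn_continuous _ 2 x)).
Qed.

Lemma integral_inv_sqr (r : R) : 0 < r ->
  (\int[leb]_(x in `[r, +oo[) (x ^- 2)%:E = r^-1%:E)%E.
Proof.
move=> r0; rewrite (_ : r^-1 = 0 - (fun x => - x^-1) r); last by rewrite sub0r opprK.
apply: (@ge0_integral_is_derive _ (fun x => - x^-1) r 0).
- by move=> x _; rewrite invr_ge0 sqr_ge0.
- by move=> x; exact: continuous_inv_sqr.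
- move=> x rx; have x0 : x != 0 by rewrite gt_eqF// (lt_le_trans r0).
  by apply: is_derive_eq; [apply: is_deriveN; apply: is_deriveV|rewrite [_ *: _]mulr1 opprK].
- by rewrite -[X in _ --> X]oppr0; apply: cvgN; exact: cvgyV.
Qed.

Lemma integral_tail_half_le (f : R -> R) (c r : R) : measurable_fun setT f ->
  (forall x, 0 <= f x) -> 0 <= c -> 0 < r ->
  (forall x, `|x| < r -> f x = 0) -> (forall x, r <= `|x| -> f x <= c * x ^- 2) ->
  (\int[leb]_(x in `[0%R, +oo[) (f x)%:E <= (c / r)%:E)%E.
Proof.
move=> mf f0 c0 r0 fr fc.
have mEf : measurable_fun [set: R] (fun x => (f x)%:E) by exact/measurable_EFinP.
have E : `[0, +oo[%classic = `[0, r[%classic `|` `[r, +oo[%classic :> set (measurableTypeR R).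
  by rewrite -itv_bndbnd_setU// bnd_simp ltW.
rewrite E ge0_integral_setU//; first last.
- apply/disj_setPS => x /= [] ; rewrite !in_itv/= andbT => /andP[_ h1] h2.
  by move: (lt_le_trans h1 h2); rewrite ltxx.
- by move=> x _; rewrite lee_fin.
- exact: measurable_funTS.
rewrite (eq_integral (cst 0%E)); last first.
  by move=> x; rewrite inE /= in_itv /= => /andP[x0 xr]; rewrite fr// ger0_norm.
rewrite integral0 add0e.
have mi : measurable_fun (`[r, +oo[%classic : set R) (fun x : R => (x ^- 2)%:E).
  apply/measurable_EFinP; apply: subspace_continuous_measurable_fun => //.
  apply: continuous_in_subspaceT => x /set_mem; rewrite /= in_itv/= andbT.
  exact: continuous_inv_sqr.
rewrite EFinM -(integral_inv_sqr r0) -ge0_integralZl//; first last.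
- by move=> x _; rewrite lee_fin invr_ge0 sqr_ge0.
apply: ge0_le_integral => //.
- by move=> x _; rewrite lee_fin.
- exact: measurable_funTS.
- exact: emeasurable_funM.
- move=> x; rewrite /= in_itv/= andbT => rx; rewrite lee_fin fc// ger0_norm//.
  by rewrite (le_trans (ltW r0)).
Qed.

Lemma integral_tail_le (f : R -> R) (c r : R) : measurable_fun setT f ->
  (forall x, 0 <= f x) -> 0 <= c -> 0 < r ->
  (forall x, `|x| < r -> f x = 0) -> (forall x, r <= `|x| -> f x <= c * x ^- 2) ->
  (\int[leb]_x (f x)%:E <= (2 * (c / r))%:E)%E.
Proof.
move=> mf f0 c0 r0 fr fc.
have mEf : measurable_fun [set: R] (fun x => (f x)%:E) by exact/measurable_EFinP.
rewrite (ge0_integral_leb_split mEf)//.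
rewrite mulr_natl mulr2n EFinD leeD//; apply: integral_tail_half_le => //.
- by apply: measurableT_comp => //; exact: measurable_funN.
- by move=> x; rewrite -normrN => /fr.
- by move=> x; rewrite -normrN => /fc; rewrite sqrrN.
Qed.

Section box_kernel.
Variable A : R.
Hypothesis A0 : 0 < A.

Definition boxw (x : R) : R := if `|x| <= A / 2 then 1 else 0.
(** The sinc transform of [boxw] at angular frequency [b]. At [b = 0] the quotient would default to
    0 instead of its limit [A]. *)
Definition boxk (b : R) : R := if b == 0 then A else 2 * sin (b * (A / 2)) / b.

Lemma boxwE : boxw = \1_(`[- (A / 2), A / 2] : set R).
Proof. by apply/funext => x; rewrite /boxw indicE ler_norml mem_setE in_itv /=; case: ifP. Qed.

Lemma measurable_boxw : measurable_fun setT boxw.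
Proof. by rewrite boxwE; exact: measurable_indic. Qed.

Lemma boxw_ge0 x : 0 <= boxw x. Proof. by rewrite /boxw; case: ifP. Qed.

Lemma boxw_integrable : leb.-integrable setT (EFin \o boxw).
Proof. by rewrite boxwE; exact: integrable_indic_itv. Qed.

Lemma Rintegral_boxw_cos b th :
  \int[leb]_x (boxw x * cos (b * x + th)) = boxk b * cos th.
Proof.
have hA : - (A / 2) < A / 2 by rewrite gtrN// divr_gt0.
rewrite (_ : (\int[leb]_x _) = \int[leb]_(x in `[- (A/2), A/2]) cos (b * x + th)); last first.
  rewrite [RHS]Rintegral_mkcond; apply: eq_Rintegral => x _.
  by rewrite patchE boxwE indicE; case: ifP => _; rewrite ?mul1r ?mul0r.
rewrite /boxk; case: eqVneq => [->|b0].
  under eq_Rintegral do rewrite mul0r add0r.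
  rewrite Rintegral_cst// /leb/= lebesgue_measure_itv/= lte_fin hA mulrC; congr (_ * _).
  by rewrite -EFinB/=; field.
have dF (x : R) : is_derive x 1 (fun x : R => sin (b * x + th) / b) (cos (b * x + th)).
  apply: is_derive_eq; rewrite /GRing.scale /=. by field.
have dc (x : R) : is_derive x 1 (fun x : R => cos (b * x + th)) (- sin (b * x + th) * b).
  by apply: is_derive_eq; rewrite /GRing.scale /=; ring.
have cder (f : R -> R) (x l : R) : is_derive x 1 f l -> {for x, continuous f}.
  by move=> [df _]; exact/differentiable_continuous/derivable1_diffP.
rewrite /Rintegral (@continuous_FTC2 R _ (fun x => sin (b * x + th) / b))//.
- rewrite -EFinB /= mulrN -mulrBl (addrC _ th) (addrC _ th) sinB sinD.
  by rewrite mulrAC; congr (_ * _); ring.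
- by apply: continuous_subspaceT => x; exact: (cder _ _ _ (dc x)).
- split.
  + by move=> x _; have [] := dF x.
  + by apply: cvg_at_right_filter; exact: (cder _ _ _ (dF _)).
  + by apply: cvg_at_left_filter; exact: (cder _ _ _ (dF _)).
- by move=> x _; rewrite derive1E; have [_ ->] := dF x.
Qed.

End box_kernel.

Section poisson_kernel.
Variable a : R.
Hypothesis a0 : 0 < a.

Definition expw (x : R) : R := expR (- (a * `|x|)).
(** Transform of [expw] at angular frequency [b]: up to scaling the Cauchy density, i.e. the Poisson
    kernel of the line. *)
Definition expk (b : R) : R := 2 * a / (a ^+ 2 + b ^+ 2).

Lemma expw_ge0 x : 0 <= expw x. Proof. exact: expR_ge0. Qed.

Lemma measurable_expw : measurable_fun setT expw.
Proof.
apply: measurableT_comp => //; apply: measurable_funN.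
by apply: measurable_funM => //; exact: measurable_normr.
Qed.

Lemma cvgy_expRN : expR (- (a * x)) @[x --> +oo] --> (0 : R).
Proof.
under eq_fun do rewrite mulrC.
apply: (@cvg_comp _ _ _ (fun x => x * a) (fun y => expR (- y))); last exact: cvgr_expR.
by apply: gt0_cvgMly => //; exact: cvg_id.
Qed.

(* [1 + cos] in place of [cos] keeps the integrand nonnegative, as the improper FTC requires. *)
Lemma integral_half_expw_cos (b th : R) :
  (\int[leb]_(x in `[0%R, +oo[) (expR (- (a * x)) * (1 + cos (b * x + th)))%:E =
   (a^-1 + (a * cos th - b * sin th) / (a ^+ 2 + b ^+ 2))%:E)%E.
Proof.
have ab0 : a ^+ 2 + b ^+ 2 != 0 by rewrite gt_eqF// ltr_wpDr ?sqr_ge0// exprn_gt0.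
have an0 : a != 0 by rewrite gt_eqF.
pose F := fun x : R => expR (- (a * x)) * ((b * sin (b * x + th) - a * cos (b * x + th)) / (a ^+ 2 + b ^+ 2) - a^-1).
rewrite (_ : _ + _ / _ = 0 - F 0); last first.
  by rewrite /F !mulr0 oppr0 expR0 !add0r mul1r; ring.
apply: ge0_integral_is_derive.
- by move=> x _; rewrite mulr_ge0 ?expR_ge0// addrC -lerBlDr sub0r cos_geN1.
- move=> x _.
  have : is_derive x 1 (fun x : R => expR (- (a * x)) * (1 + cos (b * x + th)))
     (- a * expR (- (a * x)) * (1 + cos (b * x + th)) - b * expR (- (a * x)) * sin (b * x + th)).
    by apply: is_derive_eq; rewrite /GRing.scale /=; ring.
  by move=> [df _]; exact/differentiable_continuous/derivable1_diffP.
- move=> x _; apply: is_derive_eq; rewrite /GRing.scale /=; field.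
  by rewrite an0 ab0.
- pose M := (`|b| + a) / (a ^+ 2 + b ^+ 2) + a^-1.
  apply: (@squeeze_cvgr _ _ _ _ (fun x => - (expR (- (a * x)) * M)) (fun x => expR (- (a * x)) * M)).
  + near=> x; rewrite -ler_norml normrM ger0_norm ?expR_ge0// ler_wpM2l ?expR_ge0//.
    rewrite (le_trans (ler_normB _ _))// lerD//; last by rewrite gtr0_norm// invr_gt0.
    rewrite normrM normfV (ger0_norm (addr_ge0 (sqr_ge0 a) (sqr_ge0 b))).
    rewrite ler_wpM2r ?invr_ge0 ?addr_ge0 ?sqr_ge0//.
    rewrite (le_trans (ler_normB _ _))// lerD ?normrM_sin_le//.
    by rewrite (le_trans (normrM_cos_le _ _))// gtr0_norm.
  + by rewrite -[X in _ --> X]oppr0 -(mul0r M); apply: cvgN; apply: cvgMr_tmp; exact: cvgy_expRN.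
  + by rewrite -(mul0r M); apply: cvgMr_tmp; exact: cvgy_expRN.
Unshelve. all: by end_near. Qed.

Lemma integral_expw : (\int[leb]_x (expw x)%:E = (2 / a)%:E)%E.
Proof.
rewrite ge0_integral_leb_split; last 2 first.
- by apply/measurable_EFinP; exact: measurable_expw.
- by move=> x; rewrite lee_fin expw_ge0.
have H : (\int[leb]_(x in `[0%R, +oo[) (expR (- (a * x)))%:E = (a^-1)%:E)%E.
  (* At frequency 0 and phase [pi / 2] the cosine vanishes, leaving the bare exponential. *)
  have := @integral_half_expw_cos 0 (pi / 2).
  under eq_integral do rewrite mul0r add0r cos_pihalf addr0 mulr1.
  by rewrite cos_pihalf sin_pihalf !mulr0 mul0r subr0 mul0r addr0.
rewrite mulr_natl mulr2n EFinD; congr (_ + _)%E; rewrite -[RHS]H; apply: eq_integral => x;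
  rewrite inE/= in_itv/= andbT => x0; rewrite /expw ?normrN ger0_norm//.
Qed.

Lemma expw_integrable : leb.-integrable setT (EFin \o expw).
Proof.
by apply: ge0_integrable; [exact: measurable_expw|exact: expw_ge0|rewrite integral_expw ltry].
Qed.

Lemma Rintegral_expw_cos b th :
  \int[leb]_x (expw x * cos (b * x + th)) = expk b * cos th.
Proof.
have ab0 : a ^+ 2 + b ^+ 2 != 0 by rewrite gt_eqF// ltr_wpDr ?sqr_ge0// exprn_gt0.
have mc : measurable_fun setT (fun x : R => cos (b * x + th)).
  by apply: measurable_cosf; apply: measurable_funD => //; exact: measurable_funM.
have H : (\int[leb]_x (expw x * (1 + cos (b * x + th)))%:E = (2 / a + expk b * cos th)%:E)%E.
  rewrite ge0_integral_leb_split; last 2 first.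
  - apply/measurable_EFinP; apply: measurable_funM; first exact: measurable_expw.
    exact: measurable_funD.
  - by move=> x; rewrite lee_fin mulr_ge0 ?expw_ge0// addrC -lerBlDr sub0r cos_geN1.
  (* The negative half-line contributes the same formula with [- b], so the two sine terms
     cancel. *)
  rewrite (_ : 2 / a + _ = (a^-1 + (a * cos th - b * sin th) / (a ^+ 2 + b ^+ 2))
     + (a^-1 + (a * cos th - (- b) * sin th) / (a ^+ 2 + (- b) ^+ 2))); last first.
    by rewrite /expk sqrrN; field; rewrite ab0 gt_eqF.
  rewrite EFinD -!integral_half_expw_cos; congr (_ + _)%E; apply: eq_integral => x;
    rewrite inE/= in_itv/= andbT => x0; rewrite /expw ?normrN ger0_norm//.
  by rewrite mulNr mulrN.
have I1 : leb.-integrable setT (EFin \o (fun x => expw x * cos (b * x + th))).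
  apply: (integrable_dom _ expw_integrable) => [|x].
    by apply: measurable_funM => //; exact: measurable_expw.
  by rewrite (le_trans (normrM_cos_le _ _))// ger0_norm ?expw_ge0.
have H1 : \int[leb]_x (expw x * (1 + cos (b * x + th))) = 2 / a + expk b * cos th.
  by rewrite /Rintegral H.
(* The 1 that was added to the cosine for positivity contributes [2 / a], which is cancelled
   here. *)
apply: (@addrI _ (2 / a)); rewrite -H1.
have -> : 2 / a = \int[leb]_x expw x by rewrite /Rintegral integral_expw.
rewrite -RintegralD//; last exact: expw_integrable.
by apply: eq_Rintegral => x _; rewrite mulrDr mulr1.
Qed.

Lemma expk_ge0 b : 0 <= expk b.
Proof. by rewrite divr_ge0 ?addr_ge0 ?sqr_ge0// mulr_ge0// ltW. Qed.

Lemma continuous_expk c : continuous (fun z : R => expk (c * z)).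
Proof.
move=> z; apply: cvgM; first exact: cvg_cst.
apply: cvgV; first by rewrite gt_eqF// ltr_wpDr ?sqr_ge0// exprn_gt0.
apply: cvgD; first exact: cvg_cst.
apply: (@continuous_comp _ _ _ (fun z => c * z) (fun y : R => y ^+ 2)); last exact: exprn_continuous.
by apply: cvgMl_tmp; exact: cvg_id.
Qed.

Lemma measurable_expk c : measurable_fun setT (fun z : R => expk (c * z)).
Proof. by apply: continuous_measurable_fun; exact: continuous_expk. Qed.

Lemma integral_expk : (\int[leb]_z (expk (2 * pi * z))%:E = 1%:E)%E.
Proof.
have pi0 : 0 < pi :> R by exact: pi_gt0.
have an0 : a != 0 by rewrite gt_eqF.
have pin0 : pi != 0 :> R by rewrite gt_eqF.
have mk := measurable_expk (2 * pi).
rewrite ge0_integral_leb_split; last 2 first.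
- exact/measurable_EFinP.
- by move=> x; rewrite lee_fin expk_ge0.
have H : (\int[leb]_(x in `[0%R, +oo[) (expk (2 * pi * x))%:E = (1 / 2)%:E)%E.
  (* A primitive that tends to 1/2. The factor [2 * pi] in the argument of [expk] is what normalizes
     the total mass to 1. *)
  pose F := fun z : R => pi^-1 * atan (2 * pi / a * z).
  rewrite (_ : 1 / 2 = 1 / 2 - F 0); last by rewrite /F mulr0 atan0 mulr0 subr0.
  apply: ge0_integral_is_derive.
  - by move=> x _; exact: expk_ge0.
  - by move=> x _; exact: continuous_expk.
  - move=> x _; rewrite /F /expk.
    have h1 : a ^+ 2 + (2 * pi * x) ^+ 2 != 0.
      by rewrite gt_eqF// ltr_wpDr ?sqr_ge0// exprn_gt0.
    have h2 : 1 + (2 * pi / a * x) ^+ 2 != 0.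
      by rewrite gt_eqF// ltr_wpDr ?sqr_ge0.
    have d1 : is_derive x 1 (fun z : R => 2 * pi / a * z) (2 * pi / a).
      by apply: is_derive_eq; rewrite [_ *: _]mulr1.
    have d2 := is_derive1_comp (is_derive1_atan (2 * pi / a * x)) d1.
    apply: is_derive_eq; rewrite /GRing.scale /=; clear d1 d2.
    move: h1 h2 pin0; generalize (@pi R) => p h1 h2 pin0; field.
    by rewrite h1 an0.
  - rewrite (_ : 1 / 2 = pi^-1 * (pi / 2)); last by move: pin0; generalize (@pi R) => p pin0; field.
    apply: cvgMl_tmp.
    under eq_fun do rewrite mulrC.
    apply: (@cvg_comp _ _ _ (fun x => x * (2 * pi / a)) (@atan R)); last exact: cvgy_atan.
    by apply: gt0_cvgMly; [rewrite divr_gt0// mulr_gt0|exact: cvg_id].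
rewrite (_ : 1%:E = (1/2)%:E + (1/2)%:E)%E; last by rewrite -EFinD; congr EFin; field.
congr (_ + _)%E => //; rewrite -[RHS]H.
by apply: eq_integral => x _; rewrite /expk mulrN sqrrN.
Qed.

Lemma expk_le b : b != 0 -> expk b <= 2 * a * b ^- 2.
Proof.
move=> b0; rewrite ler_wpM2l ?mulr_ge0 ?(ltW a0)// lef_pV2 ?posrE.
- by rewrite lerDr sqr_ge0.
- by rewrite ltr_wpDr ?sqr_ge0// exprn_gt0.
- by rewrite exprn_even_gt0.
Qed.

End poisson_kernel.

End OneDimensional.

(** * Convergence to zero and L2-continuity of translations *)

Section TendsToZero.
Context {R : realType}.

Definition tends0 (u : nat -> \bar R) :=
  forall e : R, 0 < e -> exists N, forall k, (N <= k)%N -> (u k <= e%:E)%E.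

Lemma tends0P (u : nat -> \bar R) : (forall k, 0 <= u k)%E ->
  (u @ \oo --> 0%E) <-> tends0 u.
Proof.
move=> u0; split=> [/fine_cvgP[[N1 _ fu] /cvgrPdist_le uc] e e0|H].
  have [N2 _ H] := uc _ e0; exists (maxn N1 N2) => k; rewrite geq_max => /andP[k1 k2].
  have := H k k2; rewrite sub0r normrN /= -lee_fin => H1.
  by rewrite -(fineK (fu k k1)) (le_trans _ H1)// lee_fin ler_norm.
apply/fine_cvgP; split.
  have [N HN] := H 1 ltr01; exists N => // k /= Nk.
  by rewrite ge0_fin_numE// (le_lt_trans (HN k Nk))// ltry.
apply/cvgrPdist_le => e e0; have [N HN] := H e e0; exists N => // k /= Nk.
have fk : u k \is a fin_num by rewrite ge0_fin_numE// (le_lt_trans (HN k Nk))// ltry.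
by rewrite sub0r normrN ger0_norm ?fine_ge0// -lee_fin fineK// HN.
Qed.

Lemma tends0_le (u v : nat -> \bar R) : (forall k, u k <= v k)%E -> tends0 v -> tends0 u.
Proof.
move=> uv v0 e e0; have [N HN] := v0 e e0; exists N => k Nk.
exact: le_trans (uv k) (HN k Nk).
Qed.

Lemma tends0D (u v : nat -> \bar R) : tends0 u -> tends0 v -> tends0 (fun k => u k + v k)%E.
Proof.
move=> u0 v0 e e0; have e2 : 0 < e / 2 by rewrite divr_gt0.
have [N1 H1] := u0 _ e2; have [N2 H2] := v0 _ e2.
exists (maxn N1 N2) => k; rewrite geq_max => /andP[k1 k2].
by rewrite (splitr e) EFinD leeD ?H1 ?H2.
Qed.

Lemma tends0Z (u : nat -> \bar R) (c : R) : 0 <= c -> tends0 u -> tends0 (fun k => c%:E * u k)%E.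
Proof.
move=> c0 u0 e e0; have c1 : 0 < c + 1 by rewrite ltr_wpDl.
have [N HN] := u0 (e / (c + 1)) (divr_gt0 e0 c1); exists N => k Nk.
rewrite (le_trans (lee_wpmul2l _ (HN k Nk))) ?lee_fin//.
by rewrite mulrCA ler_piMr ?(ltW e0)// ler_pdivrMr// mul1r lerDl.
Qed.

(** Dominated convergence in the form used on fibres: pointwise convergence is required only where
    the integrable majorant [H] is finite, which is almost everywhere. *)
Lemma integral_tends0 d (T : measurableType d) (m : {measure set T -> \bar R})
    (G : nat -> T -> \bar R) (H : T -> \bar R) :
  (forall k, measurable_fun setT (G k)) -> measurable_fun setT H ->
  (forall k x, 0 <= G k x)%E -> (forall x, 0 <= H x)%E -> (forall k x, G k x <= H x)%E ->
  (\int[m]_x H x < +oo)%E ->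
  (forall x, (H x < +oo)%E -> tends0 (G ^~ x)) ->
  tends0 (fun k => \int[m]_x G k x)%E.
Proof.
move=> mG mH G0 H0 GH Hoo Gx.
have iH : m.-integrable setT H.
  by apply/integrableP; split => //; under eq_integral do rewrite gee0_abs//.
have aeH := integrable_ae measurableT iH.
have Gx0 : \forall x \ae m, setT x -> G x0 x @[x0 --> \oo] --> cst 0%E x.
  apply: filterS aeH => x /(_ I) Hx _; apply/tends0P => //; apply: Gx.
  by rewrite -ge0_fin_numE.
have GH' : \forall x \ae m, forall k, setT x -> (`|G k x| <= H x)%E.
  by apply: aeW => x k _; rewrite gee0_abs.
have [_ _] := dominated_convergence measurableT mG (measurable_cst _) Gx0 iH GH'.
rewrite integral_cst// mul0e => K; apply/tends0P => // k; exact: integral_ge0.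
Qed.

End TendsToZero.

Section TranslationContinuity1.
Variable R : realType.

Lemma sqrD_le2 (x y : R) : (x + y) ^+ 2 <= 2 * x ^+ 2 + 2 * y ^+ 2.
Proof. by rewrite -subr_ge0 (_ : _ - _ = (x - y) ^+ 2) ?sqr_ge0//; ring. Qed.

Lemma sqrB_le2 (x y : R) : (x - y) ^+ 2 <= 2 * x ^+ 2 + 2 * y ^+ 2.
Proof. by rewrite -(sqrrN y); exact: sqrD_le2. Qed.

Definition L2e d (T : measurableType d) (m : {measure set T -> \bar R}) (f : T -> R) : \bar R :=
  (\int[m]_x (f x ^+ 2)%:E)%E.

Lemma L2e_ge0 d (T : measurableType d) (m : {measure set T -> \bar R}) (f : T -> R) :
  (0 <= L2e m f)%E.
Proof. by apply: integral_ge0 => x _; rewrite lee_fin sqr_ge0. Qed.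

Lemma measurable_sqrE d (T : measurableType d) (f : T -> R) : measurable_fun setT f ->
  measurable_fun setT (fun x => (f x ^+ 2)%:E).
Proof. by move=> mf; apply/measurable_EFinP; exact: measurable_funX. Qed.

Lemma L2eB_le d (T : measurableType d) (m : {measure set T -> \bar R}) (f g : T -> R) :
  measurable_fun setT f -> measurable_fun setT g ->
  (L2e m (fun x => f x - g x)%R <= 2%:E * L2e m f + 2%:E * L2e m g)%E.
Proof.
move=> mf mg; have mf2 := measurable_sqrE mf; have mg2 := measurable_sqrE mg.
rewrite /L2e -!ge0_integralZl ?lee_fin//;
  try by move=> x _; rewrite lee_fin sqr_ge0.
rewrite -ge0_integralD//; try by move=> x _; rewrite -EFinM lee_fin mulr_ge0// sqr_ge0.
2,3: by apply: emeasurable_funM.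
apply: ge0_le_integral => //.
- by move=> x _; rewrite lee_fin sqr_ge0.
- by apply: measurable_sqrE; exact: measurable_funB.
- by apply: emeasurable_funD; exact: emeasurable_funM.
- by move=> x _; rewrite -!EFinM -EFinD lee_fin sqrB_le2.
Qed.

Lemma L2e_shift_cc (g : R -> R) (t : nat -> R) (M K : R) :
  continuous g -> (forall x, `|g x| <= M) -> (forall x, K < `|x| -> g x = 0) ->
  (forall k, `|t k| <= k.+1%:R^-1) ->
  tends0 (fun k => L2e leb (fun x => g (x + t k) - g x)).
Proof.
move=> cg gM gK tk.
have M0 : 0 <= M by rewrite (le_trans _ (gM 0)).
have mg : measurable_fun setT g by exact: continuous_measurable_fun.
(* Since [|t k| <= 1], both [g] and its translate vanish outside the support interval widened by
   1. *)
pose H (x : R) : \bar R := (((2 * M) ^+ 2)%:E * (\1_(`[(- (K + 1))%R, (K + 1)%R]%classic : set R) x)%:E)%E.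
have t1 k : `|t k| <= 1 by rewrite (le_trans (tk k))// invf_le1// ler1n.
have mD k : measurable_fun setT (fun x : R => g (x + t k) - g x).
  apply: measurable_funB => //; apply: (measurableT_comp mg).
  exact: measurable_funD.
apply: (@integral_tends0 _ _ _ leb _ H).
- by move=> k; exact: (measurable_sqrE (mD k)).
- by apply: emeasurable_funM => //; apply/measurable_EFinP; exact: measurable_indic.
- by move=> k x; rewrite lee_fin sqr_ge0.
- by move=> x; rewrite /H -EFinM lee_fin mulr_ge0 ?sqr_ge0.
- move=> k x; rewrite /H -EFinM lee_fin indicE mem_setE in_itv /= -ler_norml.
  case: (leP `|x| (K + 1)) => xK.
    rewrite mulr1 -[leLHS]real_normK ?num_real// ler_sqr ?nnegrE ?mulr_ge0//.
    by rewrite (le_trans (ler_normB _ _))// mulr_natl mulr2n lerD.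
  rewrite mulr0 !gK ?subrr ?expr0n//; first by rewrite (le_lt_trans _ xK)// lerDl.
  have := lerB_normD x (t k); have := t1 k; lra.
- have mI : measurable_fun [set: R] (EFin \o (\1_(`[(- (K + 1))%R, (K + 1)%R]%classic : set R) : R -> R)).
    by apply/measurable_EFinP; exact: measurable_indic.
  rewrite /H ge0_integralZl//; try by [move=> x _; rewrite lee_fin | rewrite lee_fin sqr_ge0].
  rewrite integral_indic// setIT /leb/= lebesgue_measure_itv/= lte_fin.
  by case: ifP => _; rewrite ?mule0 ?ltry// -EFinB -EFinM ltry.
- move=> x _ e e0.
  have /cvgrPdist_le/(_ (Num.sqrt e)) := cg x; rewrite sqrtr_gt0 => /(_ e0).
  move=> /nbhs_ballP[r /= r0 Hr].
  have [N HN] : exists N, N.+1%:R^-1 < r.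
    by have [N _ /(_ N (leqnn _))] := near_infty_natSinv_lt (PosNum r0); exists N.
  exists N => k Nk; rewrite lee_fin -[leLHS]real_normK ?num_real// -(sqr_sqrtr (ltW e0)).
  rewrite ler_sqr ?nnegrE ?sqrtr_ge0// distrC; apply: Hr.
  rewrite /ball /= opprD addrA subrr sub0r normrN (le_lt_trans (tk k))//.
  by rewrite (le_lt_trans _ HN)// lef_pV2 ?posrE// ler_nat.
Qed.

(** [f] is first cut off in height and position at level [N]. Continuous functions approximate the
    result in L1 on a bounded interval; clamping them to [[-N, N]] and multiplying by a cutoff
    upgrades this to L2, because the squared error is then at most [2 N] times the error. *)
Lemma L2e_density (f : R -> R) (e : R) :
  measurable_fun setT f -> (L2e leb f < +oo)%E -> 0 < e ->
  exists g M K, [/\ continuous g, (forall x, `|g x| <= M), (forall x, K < `|x| -> g x = 0)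
    & (L2e leb (fun x => f x - g x)%R <= e%:E)%E].
Proof.
move=> mf foo e0.
pose fN (N : nat) x := if (`|x| <= N%:R) && (`|f x| <= N%:R) then f x else 0.
have mfN N : measurable_fun setT (fN N).
  apply: measurable_fun_ifT => //; apply: measurable_and; apply: measurable_fun_ler => //.
  exact: measurableT_comp.
have mf2 := measurable_sqrE mf.
have T0 : tends0 (fun N => L2e leb (fun x => f x - fN N x)%R).
  apply: (@integral_tends0 _ _ _ leb (fun N x => ((f x - fN N x) ^+ 2)%:E) (fun x => (f x ^+ 2)%:E)) => //.
  - by move=> k; exact: (measurable_sqrE (measurable_funB mf (mfN k))).
  - by move=> k x; rewrite lee_fin sqr_ge0.
  - by move=> x; rewrite lee_fin sqr_ge0.
  - move=> k x; rewrite lee_fin /fN; case: ifP => _; last by rewrite subr0.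
    by rewrite subrr expr0n sqr_ge0.
  - move=> x _ d d0; exists (Num.bound (Num.max `|x| `|f x|)) => k Nk.
    have M0 : 0 <= Num.max `|x| `|f x| by rewrite le_max normr_ge0.
    have B := archi_boundP M0.
    have {B} : Num.max `|x| `|f x| <= k%:R.
      by rewrite (le_trans (ltW B))// ler_nat.
    by rewrite ge_max /fN => ->; rewrite subrr expr0n lee_fin ltW.
have e4 : 0 < e / 4 by rewrite divr_gt0.
have [N NR0 HN0] : exists2 N, 0 < N%:R :> R & (L2e leb (fun x => f x - fN N x)%R <= (e / 4)%:E)%E.
  by have [N0 HN0] := T0 _ e4; exists N0.+1; [rewrite ltr0n|exact: HN0 (leqnSn _)].
pose E : set R := `[(- (N%:R + 1))%R, (N%:R + 1)%R]%classic.
have EE x : E x = (`|x| <= N%:R + 1) by rewrite /E /= in_itv /= ler_norml.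
have fN_le x : `|fN N x| <= N%:R.
  by rewrite /fN; case: ifP => [/andP[_ //]|_]; rewrite normr0 ler0n.
have mE : measurable (E : set (measurableTypeR R)) by exact: measurable_itv.
have Eoo : (leb E < +oo)%E.
  by rewrite /leb/= lebesgue_measure_itv/= lte_fin; case: ifP => _; rewrite ?ltry// -EFinB ltry.
have iE : leb.-integrable E (EFin \o fN N).
  apply: measurable_bounded_integrable => //.
    exact: (measurable_funTS (mfN N)).
  exists N%:R; split; first exact: num_real.
  by move=> y Ny x _; rewrite /= (le_trans (fN_le x))// ltW.
have [g_ [cg ig gcv]] := approximation_continuous_integrable mE Eoo iE.
(* Division by [2 * N] anticipates the passage from the L1 error to the L2 error. *)
have [j Hj] : exists j, (\int[leb]_(x in E) `|(fN N x - g_ j x)%:E| <= (e / 4 / (2 * N%:R))%:E)%E.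
  have /tends0P T1 := gcv; case: (T1 _ (e / 4 / (2 * N%:R))).
  - by move=> k; exact: integral_ge0.
  - by rewrite divr_gt0// mulr_gt0.
  - by move=> j Hj; exists j; exact: Hj.
(* The clamp [c] does not increase the distance to [fN N], whose values already lie in [[-N, N]].
   The cutoff [chi] is 1 up to [N], and where it varies [fN N] is 0, so multiplying by it does no
   harm. *)
pose c x := Num.max (- N%:R) (Num.min N%:R (g_ j x)).
pose chi (x : R) := Num.max 0 (Num.min 1 (N%:R + 1 - `|x|)).
have c_le x : `|c x| <= N%:R.
  by rewrite /c ler_norml le_max lexx /= ge_max ge_min lexx /= andbT; lra.
have cg_le x : `|c x| <= `|g_ j x|.
  rewrite /c /Num.max /Num.min; case: (ltP N%:R (g_ j x)) => h1; case: ltP => h2 //.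
  - by rewrite !ger0_norm ?ltW// (lt_trans _ h1).
  - by rewrite normrN ger0_norm ?(ltW NR0)// ger0_norm ?ltW// (lt_trans NR0).
  - by rewrite normrN ger0_norm ?(ltW NR0)// ler_normr (lerNr N%:R) h2 orbT.
have fc_le x : `|fN N x - c x| <= `|fN N x - g_ j x|.
  have := fN_le x; rewrite ler_norml => /andP[l1 l2].
  rewrite /c /Num.max /Num.min; case: (ltP N%:R (g_ j x)) => h1; case: ltP => h2 //.
  - by rewrite ler0_norm ?subr_le0// ler0_norm ?subr_le0//; lra.
  - by rewrite ler_norml; lra.
  - by rewrite ger0_norm ?subr_ge0// ger0_norm ?subr_ge0//; lra.
have chi01 x : 0 <= chi x <= 1.
  by rewrite /chi le_max lexx /= ge_max ler01 ge_min lexx.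
have cchi : continuous chi.
  move=> x; apply: (@continuous_max _ _ (fun=> 0) (fun x : R => Num.min 1 (N%:R + 1 - `|x|))); first exact: cvg_cst.
  apply: (@continuous_min _ _ (fun=> 1) (fun x : R => N%:R + 1 - `|x|)); first exact: cvg_cst.
  by apply: cvgB; [exact: cvg_cst|exact: norm_continuous].
have cc : continuous c.
  move=> x; apply: (@continuous_max _ _ (fun=> - N%:R) (fun x : R => Num.min N%:R (g_ j x))); first exact: cvg_cst.
  by apply: (@continuous_min _ _ (fun=> N%:R) (g_ j)); [exact: cvg_cst|exact: cg].
have mg : measurable_fun setT (fun x => chi x * c x).
  by apply: measurable_funM; exact: continuous_measurable_fun.
have chic_le x : `|chi x * c x| <= `|c x|.
  by have /andP[x0 x1] := chi01 x; rewrite normrM (ger0_norm x0) ler_piMl.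
exists (fun x => chi x * c x), N%:R, (N%:R + 1); split.
- by move=> x; apply: cvgM; [exact: cchi|exact: cc].
- by move=> x; exact: le_trans (chic_le x) (c_le x).
- move=> x Nx; rewrite /chi max_l ?mul0r// ge_min.
  by rewrite subr_le0 (ltW Nx) orbT.
have K : (L2e leb (fun x => fN N x - chi x * c x)%R <= (e / 4)%:E)%E.
  have mgj : measurable_fun setT (g_ j) by exact: continuous_measurable_fun.
  rewrite (_ : e / 4 = 2 * N%:R * (e / 4 / (2 * N%:R))); last by field; rewrite gt_eqF.
  rewrite EFinM; apply: (@le_trans _ _ ((2 * N%:R)%:E * \int[leb]_(x in E) `|(fN N x - g_ j x)%:E|)%E); last first.
    by rewrite lee_wpmul2l// lee_fin mulr_ge0.
  have mfg : measurable_fun setT (fun x => `|(fN N x - g_ j x)%:E|%E).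
    by apply: measurableT_comp => //; apply/measurable_EFinP; exact: measurable_funB.
  have m2 : measurable_fun setT (fun x => ((2 * N%:R)%:E * `|(fN N x - g_ j x)%:E|)%E).
    exact: emeasurable_funM.
  rewrite -ge0_integralZl//; try by [exact: (measurable_funTS mfg)|rewrite lee_fin mulr_ge0].
  rewrite [leRHS]integral_mkcond; apply: ge0_le_integral => //.
  - by move=> x _; rewrite lee_fin sqr_ge0.
  - exact: (measurable_sqrE (measurable_funB (mfN N) mg)).
  - exact: ((measurable_restrictT _ mE).1 (measurable_funTS m2)).
  move=> x _; rewrite patchE; case: ifPn => [_|/negP xE].
    rewrite abse_EFin -EFinM lee_fin /=.
    have l1 : `|fN N x - chi x * c x| <= `|fN N x - g_ j x|.
      have [xN|xN] := leP `|x| N%:R.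
        have -> : chi x = 1 by rewrite /chi min_l; [rewrite max_r | lra].
        by rewrite mul1r.
      have -> : fN N x = 0 by rewrite /fN leNgt xN.
      by rewrite !sub0r !normrN (le_trans (chic_le x)).
    rewrite -[leLHS]real_normK ?num_real// expr2 ler_pM//.
    rewrite (le_trans (ler_normB _ _))// mulr_natl mulr2n lerD//.
    exact: le_trans (chic_le x) (c_le x).
  have {}xE : N%:R + 1 < `|x|.
    by rewrite ltNge; apply/negP => h; apply: xE; rewrite inE EE.
  have -> : fN N x = 0 by rewrite /fN leNgt (lt_trans _ xE) ?ltrDl.
  rewrite /chi max_l ?mul0r ?subr0 ?expr0n//.
  by rewrite ge_min subr_le0 (ltW xE) orbT.
have mfN' := mfN N.
rewrite (_ : (fun x => f x - chi x * c x) = (fun x => (f x - fN N x) - (chi x * c x - fN N x))); last first.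
  by apply/funext => x; ring.
apply: (le_trans (L2eB_le leb _ _)); [exact: measurable_funB|exact: measurable_funB|].
rewrite (_ : e%:E = (2%:E * (e / 4)%:E + 2%:E * (e / 4)%:E)%E); last first.
  by rewrite -EFinM -EFinD; congr EFin; field.
apply: leeD; rewrite lee_wpmul2l ?lee_fin//.
rewrite (_ : L2e _ _ = L2e leb (fun x => fN N x - chi x * c x)%R)//.
by apply: eq_integral => x _; rewrite -sqrrN opprB.
Qed.

Lemma L2e_leb_shift (f : R -> R) (t : R) : measurable_fun setT f ->
  L2e leb (fun x => f (x + t)) = L2e leb f.
Proof.
move=> mf; rewrite /L2e -[RHS](@ge0_integral_leb_shift _ (fun x => (f x ^+ 2)%:E) t)//.
- exact: measurable_sqrE.
- by move=> x; rewrite lee_fin sqr_ge0.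
Qed.

Lemma L2e_leb_shift_cvg (f : R -> R) (t : nat -> R) :
  measurable_fun setT f -> (L2e leb f < +oo)%E ->
  (forall k, `|t k| <= k.+1%:R^-1) ->
  tends0 (fun k => L2e leb (fun x => f (x + t k) - f x)).
Proof.
move=> mf foo tk e e0.
(* Each use of [(x - y)^2 <= 2 x^2 + 2 y^2] doubles the errors: the three contributions carry the
   factors 2, 4 and 4, for a total of 10/16. *)
have e16 : 0 < e / 16 by rewrite divr_gt0.
have [g [M [K [cg gM gK fg]]]] := L2e_density mf foo e16.
have mg : measurable_fun setT g by exact: continuous_measurable_fun.
have [N HN] := L2e_shift_cc cg gM gK tk e16.
exists N => k Nk; have {}HN := HN k Nk.
have ms : measurable_fun setT (fun x : R => x + t k) by exact: measurable_funD.
have mft : measurable_fun setT (fun x : R => f (x + t k)) by exact: (measurableT_comp mf ms).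
have mgt : measurable_fun setT (fun x : R => g (x + t k)) by exact: (measurableT_comp mg ms).
have mfg : measurable_fun setT (fun x : R => f x - g x) by exact: measurable_funB.
rewrite (_ : (fun x => f (x + t k) - f x) = (fun x => (f (x + t k) - g (x + t k)) - ((f x - g x) - (g (x + t k) - g x)))); last first.
  by apply/funext => x; ring.
apply: (le_trans (L2eB_le leb _ _)).
  exact: measurable_funB.
  by apply: measurable_funB => //; exact: measurable_funB.
rewrite (@L2e_leb_shift (fun x => f x - g x))//.
apply: (@le_trans _ _ (2%:E * (e / 16)%:E + 2%:E * (2%:E * (e / 16)%:E + 2%:E * (e / 16)%:E))%E); last first.
  by rewrite -?(EFinM, EFinD) lee_fin; lra.
apply: leeD; rewrite lee_wpmul2l ?lee_fin//.
apply: (le_trans (L2eB_le leb _ _)) => //; first exact: measurable_funB.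
by apply: leeD; rewrite lee_wpmul2l ?lee_fin.
Qed.

End TranslationContinuity1.

Section TranslationContinuity.
Variable R : realType.

Lemma L2e_mu_shift n (f : n.-tuple R -> R) (z : n.-tuple R) : measurable_fun setT f ->
  L2e (mu n) (fun x => f (tadd x z)) = L2e (mu n) f.
Proof.
move=> mf; rewrite /L2e -[RHS](@ge0_integral_mu_shift _ _ (fun x => (f x ^+ 2)%:E) z)//.
- exact: measurable_sqrE.
- by move=> x; rewrite lee_fin sqr_ge0.
Qed.

Lemma L2e_sym d (T : measurableType d) (m : {measure set T -> \bar R}) (f g : T -> R) :
  L2e m (fun x => f x - g x) = L2e m (fun x => g x - f x).
Proof. by apply: eq_integral => x _; rewrite -sqrrN opprB. Qed.

Lemma measurable_fun_tadd n (f : n.-tuple R -> R) (z : n.-tuple R) :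
  measurable_fun setT f -> measurable_fun setT (fun x => f (tadd x z)).
Proof. by move=> mf; apply: (measurableT_comp mf); exact: measurable_tadd. Qed.

Lemma tadd0 n (x : n.-tuple R) : tadd x [tuple 0 | i < n] = x.
Proof. by apply: eq_from_tnth => i; rewrite !tnth_mktuple addr0. Qed.

Lemma L2e_mu_shift_le n (f : n.-tuple R -> R) (z : n.-tuple R) : measurable_fun setT f ->
  (L2e (mu n) (fun x => f (tadd x z) - f x)%R <= 4%:E * L2e (mu n) f)%E.
Proof.
move=> mf; apply: (le_trans (L2eB_le (mu n) (measurable_fun_tadd z mf) mf)).
rewrite L2e_mu_shift// -ge0_muleDl ?lee_fin//.
by rewrite -EFinD -natrD.
Qed.

Lemma L2e_leb_shift_le (f : R -> R) (t : R) : measurable_fun setT f ->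
  (L2e leb (fun x => f (x + t) - f x)%R <= 4%:E * L2e leb f)%E.
Proof.
move=> mf; have ms : measurable_fun setT (fun x : R => x + t) by exact: measurable_funD.
apply: (le_trans (L2eB_le leb (measurableT_comp mf ms) mf)).
rewrite L2e_leb_shift// -ge0_muleDl ?lee_fin//.
by rewrite -EFinD -natrD.
Qed.

Lemma L2e_mu_cons n (f : n.+1.-tuple R -> R) : measurable_fun setT f ->
  L2e (mu n.+1) f = (\int[leb]_x L2e (mu n) (fun t => f (cons_tuple x t)))%E.
Proof.
move=> mf; rewrite /L2e ge0_integral_mu_cons//; first exact: measurable_sqrE.
by move=> x; rewrite lee_fin sqr_ge0.
Qed.

Lemma L2e_mu_cons_swap n (f : n.+1.-tuple R -> R) : measurable_fun setT f ->
  L2e (mu n.+1) f = (\int[mu n]_t L2e leb (fun x => f (cons_tuple x t)))%E.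
Proof.
move=> mf; rewrite L2e_mu_cons//.
rewrite /L2e (fubini_tonelli (m1 := leb) (m2 := mu n) (fun p => (f (consp p) ^+ 2)%:E))//.
  by apply: measurable_sqrE; exact: (measurableT_comp mf (@measurable_consp R n)).
by move=> p; rewrite lee_fin sqr_ge0.
Qed.

Lemma measurable_L2e_cons1 n (f : n.+1.-tuple R -> R) : measurable_fun setT f ->
  measurable_fun [set: measurableTypeR R] (fun x => L2e (mu n) (fun t => f (cons_tuple x t))).
Proof.
move=> mf; apply: (measurable_integral_mu_cons (f := fun x => (f x ^+ 2)%:E)).
  exact: measurable_sqrE.
by move=> p; rewrite lee_fin sqr_ge0.
Qed.

Lemma measurable_L2e_cons2 n (f : n.+1.-tuple R -> R) : measurable_fun setT f ->
  measurable_fun setT (fun t => L2e leb (fun x => f (cons_tuple x t))).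
Proof.
move=> mf; apply: (measurable_integral_EFin leb (k := fun p => f (consp p) ^+ 2)) => [|p].
  by apply: measurable_funX; exact: (measurableT_comp mf (@measurable_consp R n)).
exact: sqr_ge0.
Qed.

Lemma measurable_cons_tuple_l n (t : n.-tuple R) :
  measurable_fun [set: R] (fun x => cons_tuple x t).
Proof. exact: measurable_cons. Qed.

Lemma tadd_cons_tuple n x (t : n.-tuple R) y u :
  tadd (cons_tuple x t) (cons_tuple y u) = cons_tuple (x + y) (tadd t u).
Proof. by apply: tuple_consE => [|i]; rewrite !tnth_mktuple ?tnth0// !tnthS. Qed.

Lemma tnth_behead_tuple n (t : n.+1.-tuple R) i :
  tnth (behead_tuple t) i = tnth t (lift ord0 i).
Proof. by rewrite [in RHS](tuple_eta t) tnthS. Qed.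

(** A translation is split into one of the first coordinate and one of the others. Each converges on
    every fibre of finite energy, by the one-dimensional case or by induction, and four times the
    energy of the fibre is a majorant. *)
Lemma L2e_mu_shift_cvg n (f : n.-tuple R -> R) (z : nat -> n.-tuple R) :
  measurable_fun setT f -> (L2e (mu n) f < +oo)%E ->
  (forall k i, `|tnth (z k) i| <= k.+1%:R^-1) ->
  tends0 (fun k => L2e (mu n) (fun x => f (tadd x (z k)) - f x)).
Proof.
elim: n f z => [|n IH] f z mf foo zk.
  move=> e e0; exists 0%N => k _; rewrite /L2e integral0_eq ?lee_fin ?ltW// => x _.
  by rewrite (tuple0 (tadd _ _)) (tuple0 x) subrr expr0n.
pose s k := thead (z k); pose y k := behead_tuple (z k).
have sk k : `|s k| <= k.+1%:R^-1 by exact: zk.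
have yk k i : `|tnth (y k) i| <= k.+1%:R^-1.
  by rewrite tnth_behead_tuple.
pose z1 k : n.+1.-tuple R := cons_tuple (s k) [tuple 0 | i < n].
pose z2 k : n.+1.-tuple R := cons_tuple 0 (y k).
have mf1 k := measurable_funB (measurable_fun_tadd (z1 k) mf) mf.
have mf2 k := measurable_funB (measurable_fun_tadd (z2 k) mf) mf.
have H4 : (4%:E * L2e (mu n.+1) f < +oo)%E.
  by rewrite lte_mul_pinfty// lee_fin.
have T1 : tends0 (fun k => L2e (mu n.+1) (fun x => f (tadd x (z1 k)) - f x)).
  apply: (@tends0_le _ _ (fun k => \int[mu n]_t L2e leb (fun x => f (cons_tuple (x + s k) t) - f (cons_tuple x t))%R)%E).
    move=> k; rewrite L2e_mu_cons_swap; last exact: mf1.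
    rewrite le_eqVlt; apply/orP; left; apply/eqP; apply: eq_integral => t _; apply: eq_integral => x _; by rewrite /= /z1 tadd_cons_tuple tadd0.
  apply: (@integral_tends0 _ _ _ (mu n) _ (fun t => 4%:E * L2e leb (fun x => f (cons_tuple x t)))%E).
  - move=> k; have := measurable_L2e_cons2 (mf1 k); congr measurable_fun; apply/funext => t.
    apply: eq_integral => x _; by rewrite /= /z1 tadd_cons_tuple tadd0.
  - by apply: emeasurable_funM => //; exact: measurable_L2e_cons2.
  - by move=> k t; exact: L2e_ge0.
  - by move=> t; rewrite mule_ge0 ?lee_fin// L2e_ge0.
  - move=> k t; apply: (@L2e_leb_shift_le (fun x => f (cons_tuple x t))).
    exact: (measurableT_comp mf (measurable_cons_tuple_l t)).
  - rewrite ge0_integralZl ?lee_fin//; first by rewrite -L2e_mu_cons_swap.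
      exact: measurable_L2e_cons2.
    by move=> t _; exact: L2e_ge0.
  - move=> t Ht; apply: (@L2e_leb_shift_cvg _ (fun x => f (cons_tuple x t))) => //.
      exact: (measurableT_comp mf (measurable_cons_tuple_l t)).
    rewrite ltNge; apply/negP; rewrite leye_eq => /eqP E; move: Ht.
    by rewrite E gt0_muley ?ltxx// lte_fin.
have T2 : tends0 (fun k => L2e (mu n.+1) (fun x => f (tadd x (z2 k)) - f x)).
  apply: (@tends0_le _ _ (fun k => \int[leb]_x L2e (mu n) (fun t => f (cons_tuple x (tadd t (y k))) - f (cons_tuple x t))%R)%E).
    move=> k; rewrite L2e_mu_cons; last exact: mf2.
    rewrite le_eqVlt; apply/orP; left; apply/eqP; apply: eq_integral => x _; apply: eq_integral => t _; by rewrite /= /z2 tadd_cons_tuple addr0.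
  apply: (@integral_tends0 _ _ _ leb _ (fun x => 4%:E * L2e (mu n) (fun t => f (cons_tuple x t)))%E).
  - move=> k; have := measurable_L2e_cons1 (mf2 k); congr measurable_fun; apply/funext => x.
    apply: eq_integral => t _; by rewrite /= /z2 tadd_cons_tuple addr0.
  - by apply: emeasurable_funM => //; exact: measurable_L2e_cons1.
  - by move=> k t; exact: L2e_ge0.
  - by move=> t; rewrite mule_ge0 ?lee_fin// L2e_ge0.
  - move=> k x; apply: (@L2e_mu_shift_le _ (fun t => f (cons_tuple x t))).
    exact: (measurableT_comp mf (measurable_cons_tuple x)).
  - rewrite ge0_integralZl ?lee_fin//; first by rewrite -L2e_mu_cons.
      exact: measurable_L2e_cons1.
    by move=> t _; exact: L2e_ge0.
  - move=> x Hx; apply: (IH (fun t => f (cons_tuple x t))) => //.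
      exact: (measurableT_comp mf (measurable_cons_tuple x)).
    rewrite ltNge; apply/negP; rewrite leye_eq => /eqP E; move: Hx.
    by rewrite E gt0_muley ?ltxx// lte_fin.
apply: (@tends0_le _ _ (fun k => 2%:E * L2e (mu n.+1) (fun x => f (tadd x (z1 k)) - f x)%R +
   2%:E * L2e (mu n.+1) (fun x => f (tadd x (z2 k)) - f x)%R)%E); last first.
  by apply: tends0D; apply: tends0Z.
move=> k; pose g x := f (tadd x (z1 k)).
have mg : measurable_fun setT g by exact: measurable_fun_tadd.
have zE x : tadd x (z k) = tadd (tadd x (z2 k)) (z1 k).
  apply: eq_from_tnth => i; rewrite !tnth_mktuple -addrA; congr (_ + _).
  case: (unliftP ord0 i) => [j ->|->].
    by rewrite !tnthS tnth_mktuple addr0 tnth_behead_tuple.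
  by rewrite !tnth0 add0r.
rewrite (_ : (fun x => f (tadd x (z k)) - f x) =
   (fun x => (g (tadd x (z2 k)) - f (tadd x (z2 k))) - (f x - f (tadd x (z2 k))))); last first.
  by apply/funext => x; rewrite zE /g; ring.
have m1 : measurable_fun setT (fun x => g x - f x) by exact: measurable_funB.
apply: (le_trans (L2eB_le (mu n.+1) (measurable_fun_tadd (z2 k) m1) _)).
  by apply: measurable_funB => //; exact: measurable_fun_tadd.
by rewrite (L2e_mu_shift (z2 k) m1) (L2e_sym (mu n.+1) f).
Qed.

(** Dominated convergence needs sequences, the Poisson kernel needs a radius. If no radius worked,
    bad shifts of size at most [1 / (k + 1)] would form a sequence contradicting
    [L2e_mu_shift_cvg]. *)
Lemma L2e_mu_shift_near n (f : n.-tuple R -> R) (e : R) :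
  measurable_fun setT f -> (L2e (mu n) f < +oo)%E -> 0 < e ->
  exists2 r : R, 0 < r & forall z, (forall i, `|tnth z i| <= r) ->
    (L2e (mu n) (fun x => f (tadd x z) - f x)%R <= e%:E)%E.
Proof.
move=> mf foo e0; apply: contrapT => H.
have {}H k : exists z, (forall i, `|tnth z i| <= k.+1%:R^-1) /\
    ~ (L2e (mu n) (fun x => f (tadd x z) - f x)%R <= e%:E)%E.
  apply: contrapT => H'; apply: H; exists k.+1%:R^-1; first by rewrite invr_gt0.
  by move=> z zr; apply: contrapT => Hz; apply: H'; exists z.
have [z Hz] := choice H.
have [N HN] := L2e_mu_shift_cvg mf foo (fun k => (Hz k).1) e0.
exact: (Hz N).2 (HN N (leqnn _)).
Qed.

End TranslationContinuity.

(** * Tails of product densities *)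

Section TensorTail.
Variable R : realType.

(** The factors may differ from one coordinate to another because the tail estimate alters exactly
    one of them. *)
Lemma ge0_integral_tensor n (w : 'I_n -> R -> R) :
  (forall i, measurable_fun setT (w i)) -> (forall i x, 0 <= w i x) ->
  (\int[mu n]_x (\prod_(i < n) w i (tnth x i))%:E = \prod_(i < n) \int[leb]_x (w i x)%:E)%E.
Proof.
elim: n w => [|n IH] w mw w0.
  rewrite big_ord0 (eq_integral (cst 1%E)); last by move=> x _; rewrite big_ord0.
  by rewrite integral_cst// mul1e /= diracT.
have mP k (v : 'I_k -> R -> R) : (forall i, measurable_fun setT (v i)) ->
    measurable_fun setT (fun x : k.-tuple R => (\prod_(i < k) v i (tnth x i))%:E).
  move=> mv; apply/measurable_EFinP; apply: measurable_prod => i _.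
  exact: (measurableT_comp (mv i) (measurable_tnth i)).
rewrite ge0_integral_mu_cons; last 2 first.
- exact: mP.
- by move=> x; rewrite lee_fin prodr_ge0.
rewrite big_ord_recl.
pose v i := w (lift ord0 i).
have I0 : (0 <= \int[mu n]_x (\prod_(i < n) v i (tnth x i))%:E)%E.
  by apply: integral_ge0 => x _; rewrite lee_fin prodr_ge0// => i _; exact: w0.
rewrite -(IH v) //; [|by move=> i; exact: mw|by move=> i x; exact: w0].
have mw0 : measurable_fun [set: R] (fun x => (w ord0 x)%:E) by exact/measurable_EFinP.
rewrite -ge0_integralZr//; try by move=> x _; rewrite lee_fin.
apply: eq_integral => x _; rewrite -ge0_integralZl ?lee_fin//; last 2 first.
- by apply: mP => i; exact: mw.
- by move=> t _; rewrite lee_fin prodr_ge0// => i _; exact: w0.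
apply: eq_integral => t _; rewrite big_ord_recl tnth0 -EFinM; congr (_ * _)%:E.
by apply: eq_bigr => i _; rewrite tnthS.
Qed.

Lemma ge0_integral_tprod n (w : R -> R) (m : R) :
  measurable_fun setT w -> (forall x, 0 <= w x) -> (\int[leb]_x (w x)%:E = m%:E)%E ->
  (\int[mu n]_x (tprod w x)%:E = (m ^+ n)%:E)%E.
Proof.
move=> mw w0 wm; rewrite (ge0_integral_tensor (w := fun _ : 'I_n => w))//.
by under eq_bigr do rewrite wm; rewrite prodEFin prodr_const card_ord.
Qed.

Definition far n (r : R) : set (n.-tuple R) := [set x | exists i, r <= `|tnth x i|].

Lemma measurable_far n r : measurable (@far n r).
Proof.
rewrite (_ : @far n r = \bigcup_(i in [set: 'I_n]) (fun x : n.-tuple R => `|tnth x i|) @^-1` `[r, +oo[%classic).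
  apply: fin_bigcup_measurable => // i _; rewrite -[X in measurable X]setTI.
  have mt : measurable_fun setT (fun x : n.-tuple R => `|tnth x i|).
    by apply: measurableT_comp => //; exact: measurable_tnth.
  exact: (mt measurableT _ (measurable_itv _)).
apply/seteqP; split => x /=.
  by move=> [i ri]; exists i => //=; rewrite in_itv /= andbT.
by move=> [i _]; rewrite /= in_itv /= andbT => ri; exists i.
Qed.

(** Union bound over the coordinate that is large: truncating the factor of that coordinate leaves
    [n - 1] full masses [m] and one inverse-square tail [2 * (c / r)]. *)
Lemma integral_tprod_far_le n (w : R -> R) (m c r : R) :
  measurable_fun setT w -> (forall x, 0 <= w x) -> (\int[leb]_x (w x)%:E = m%:E)%E ->
  0 <= c -> 0 < r -> (forall x, r <= `|x| -> w x <= c * x ^- 2) ->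
  (\int[mu n]_x ((\1_(@far n r) x)%:E * (tprod w x)%:E) <= (n%:R * (m ^+ n.-1 * (2 * (c / r))))%:E)%E.
Proof.
move=> mw w0 wm c0 r0 wc.
have m0 : 0 <= m by rewrite -lee_fin -wm integral_ge0// => x _; rewrite lee_fin.
pose wr x := if r <= `|x| then w x else 0.
have mwr : measurable_fun setT wr.
  by apply: measurable_fun_ifT => //; apply: measurable_fun_ler.
have wr0 x : 0 <= wr x by rewrite /wr; case: ifP.
pose v (i j : 'I_n) := if j == i then wr else w.
have mv i j : measurable_fun setT (v i j) by rewrite /v; case: ifP.
have v0 i j x : 0 <= v i j x by rewrite /v; case: ifP.
have mV i : measurable_fun setT (fun x : n.-tuple R => (\prod_(j < n) v i j (tnth x j))%:E).
  apply/measurable_EFinP; apply: measurable_prod => j _.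
  exact: (measurableT_comp (mv i j) (measurable_tnth j)).
apply: (@le_trans _ _ (\int[mu n]_x \sum_(i < n) (\prod_(j < n) v i j (tnth x j))%:E)%E).
  apply: ge0_le_integral => //.
  - by move=> x _; rewrite mule_ge0// lee_fin ?tprod_ge0.
  - apply: emeasurable_funM; first by apply/measurable_EFinP; exact: measurable_indic (measurable_far _).
    by apply/measurable_EFinP; exact: measurable_tprod.
  - exact: emeasurable_sum.
  move=> x _; rewrite indicE; case: (boolP (x \in _)) => /= [|_]; last first.
    by rewrite mul0e sume_ge0// => i _; rewrite lee_fin prodr_ge0.
  rewrite inE => -[i ri]; rewrite mul1e (bigD1 i)//=.
  rewrite (_ : tprod w x = \prod_(j < n) v i j (tnth x j)).
    by rewrite leeDl// sume_ge0// => j _; rewrite lee_fin prodr_ge0.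
  apply: eq_bigr => j _; rewrite /v; case: eqP => // ->; by rewrite /wr ri.
rewrite ge0_integral_sum//; last by move=> i x _; rewrite lee_fin prodr_ge0.
apply: (@le_trans _ _ (\sum_(i < n) (m ^+ n.-1 * (2 * (c / r)))%:E)%E); last first.
  rewrite sumEFin lee_fin sumr_const card_ord.
  by rewrite [leRHS]mulr_natl.
apply: lee_sum => i _; rewrite ge0_integral_tensor// (bigD1 i)//=.
rewrite (eq_bigr (fun=> m%:E)); last by move=> j ji; rewrite /v (negbTE ji).
rewrite prodEFin prodr_const cardC1 card_ord muleC EFinM lee_wpmul2l ?lee_fin ?exprn_ge0//.
rewrite /v eqxx; apply: integral_tail_le => //.
- by move=> x xr; rewrite /wr leNgt xr.
- by move=> x xr; rewrite /wr xr wc.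
Qed.

End TensorTail.

(** * Fourier energies of real functions *)

Section FourierEnergy.
Variable R : realType.
Variable n : nat.
Implicit Types (phi : n.-tuple R -> R) (xi : n.-tuple R).

(* For real [phi], [En phi xi] is the squared modulus of the Fourier transform at [xi], and
   [Hf phi xi th] is the real part of the transform rotated by the phase [th]. *)
Definition FC phi xi : R := \int[mu n]_x (phi x * cos (2 * pi * dotp x xi)).
Definition FS phi xi : R := \int[mu n]_x (phi x * sin (2 * pi * dotp x xi)).
Definition En phi xi : R := FC phi xi ^+ 2 + FS phi xi ^+ 2.
Definition Hf phi xi (th : R) : R := FC phi xi * cos th + FS phi xi * sin th.

Lemma En_ge0 phi xi : 0 <= En phi xi.
Proof. by rewrite addr_ge0 ?sqr_ge0. Qed.

Lemma Hf_shift phi xi a b :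
  Hf phi xi (a + b) = cos a * Hf phi xi b + sin a * Hf phi xi (b + pi / 2).
Proof. by rewrite /Hf cosD sinD cosDpihalf sinDpihalf; ring. Qed.

(** Two phases in quadrature replace the real and imaginary parts of a complex number. This is how
    an energy is recovered from quantities that are linear in [phi]. *)
Lemma Hf_sqrD phi xi th : Hf phi xi th ^+ 2 + Hf phi xi (th + pi / 2) ^+ 2 = En phi xi.
Proof.
rewrite /Hf cosDpihalf sinDpihalf /En.
rewrite -[RHS]mulr1 -(cos2Dsin2 th); ring.
Qed.

Lemma Hf_sqr_le phi xi th : Hf phi xi th ^+ 2 <= En phi xi.
Proof. by rewrite -(Hf_sqrD phi xi th) lerDl sqr_ge0. Qed.

Lemma measurable_phase d (T : measurableType d) (f g : T -> n.-tuple R) (th : T -> R) :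
  measurable_fun setT f -> measurable_fun setT g -> measurable_fun setT th ->
  measurable_fun setT (fun t => 2 * pi * dotp (f t) (g t) + th t).
Proof.
move=> mf mg mth; apply: measurable_funD => //; apply: measurable_funM => //.
exact: measurable_dotp.
Qed.

Lemma measurable_phase0 d (T : measurableType d) (f g : T -> n.-tuple R) :
  measurable_fun setT f -> measurable_fun setT g ->
  measurable_fun setT (fun t => 2 * pi * dotp (f t) (g t)).
Proof. by move=> mf mg; apply: measurable_funM => //; exact: measurable_dotp. Qed.

Section integrable.
Variable phi : n.-tuple R -> R.
Hypothesis iphi : (mu n).-integrable setT (EFin \o phi).

Let mphi : measurable_fun setT phi.
Proof. by case/integrableP: iphi => /measurable_EFinP. Qed.

Lemma integrable_absR : (mu n).-integrable setT (EFin \o (fun x => `|phi x|)).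
Proof. exact: (integrable_norm iphi). Qed.

Lemma measurable_FC : measurable_fun setT (FC phi).
Proof.
apply: (@measurable_Rintegral1 _ _ _ _ _ (mu n) (fun p => phi p.1 * cos (2 * pi * dotp p.1 p.2))).
apply: measurable_funM; first exact: (measurableT_comp mphi).
by apply: measurable_cosf; exact: measurable_phase0.
Qed.

Lemma measurable_FS : measurable_fun setT (FS phi).
Proof.
apply: (@measurable_Rintegral1 _ _ _ _ _ (mu n) (fun p => phi p.1 * sin (2 * pi * dotp p.1 p.2))).
apply: measurable_funM; first exact: (measurableT_comp mphi).
by apply: measurable_sinf; exact: measurable_phase0.
Qed.

Lemma measurable_En : measurable_fun setT (En phi).
Proof. by apply: measurable_funD; apply: measurable_funX; [exact: measurable_FC|exact: measurable_FS]. Qed.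

Lemma integrable_cosM (th : n.-tuple R -> R) : measurable_fun setT th ->
  (mu n).-integrable setT (EFin \o (fun x => phi x * cos (th x))).
Proof.
move=> mth; apply: (integrable_dom _ integrable_absR) => [|x].
  by apply: measurable_funM => //; exact: measurable_cosf.
exact: normrM_cos_le.
Qed.

Lemma integrable_sinM (th : n.-tuple R -> R) : measurable_fun setT th ->
  (mu n).-integrable setT (EFin \o (fun x => phi x * sin (th x))).
Proof.
move=> mth; apply: (integrable_dom _ integrable_absR) => [|x].
  by apply: measurable_funM => //; exact: measurable_sinf.
exact: normrM_sin_le.
Qed.

Lemma HfE xi th : Hf phi xi th = \int[mu n]_y (phi y * cos (th - 2 * pi * dotp y xi)).
Proof.
have mph : measurable_fun setT (fun y : n.-tuple R => 2 * pi * dotp y xi).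
  exact: measurable_phase0.
rewrite /Hf /FC /FS -!RintegralZr//; [|exact: integrable_sinM|exact: integrable_cosM].
rewrite -RintegralD//; last 2 first.
- exact: (integrable_mulr (cos th) (integrable_cosM mph)).
- exact: (integrable_mulr (sin th) (integrable_sinM mph)).
by apply: eq_Rintegral => y _; rewrite cosB; ring.
Qed.

Lemma Hf_le xi th : `|Hf phi xi th| <= \int[mu n]_x `|phi x|.
Proof.
have mph : measurable_fun setT (fun y : n.-tuple R => th - 2 * pi * dotp y xi).
  by apply: measurable_funB => //; exact: measurable_phase0.
rewrite HfE (le_trans (le_normr_Rintegral _ _))//; first exact: integrable_cosM.
apply: le_Rintegral => //.
- by apply: (integrable_norm (integrable_cosM mph)).
- exact: integrable_absR.
- by move=> x _; exact: normrM_cos_le.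
Qed.

(** Only one of the two factors in each square is opened as an integral, which makes the energy
    linear in [Hf] and ready for Fubini. *)
Lemma En_Hf xi : En phi xi = \int[mu n]_x (phi x * Hf phi xi (2 * pi * dotp x xi)).
Proof.
have mph : measurable_fun setT (fun y : n.-tuple R => 2 * pi * dotp y xi).
  exact: measurable_phase0.
rewrite /En !expr2 [X in X * _]/FC [X in _ + X * _]/FS.
rewrite -!RintegralZr//; [|exact: integrable_sinM|exact: integrable_cosM].
rewrite -RintegralD//; last 2 first.
- exact: (integrable_mulr (FC phi xi) (integrable_cosM mph)).
- exact: (integrable_mulr (FS phi xi) (integrable_sinM mph)).
by apply: eq_Rintegral => y _; rewrite /Hf; ring.
Qed.

Lemma measurable_Hf d (T : measurableType d) (f : T -> n.-tuple R) (th : T -> R) :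
  measurable_fun setT f -> measurable_fun setT th ->
  measurable_fun setT (fun t => Hf phi (f t) (th t)).
Proof.
move=> mf mth; apply: measurable_funD; apply: measurable_funM.
- exact: (measurableT_comp measurable_FC mf).
- exact: measurable_cosf.
- exact: (measurableT_comp measurable_FS mf).
- exact: measurable_sinf.
Qed.

Section weight.
Variables (w k : R -> R).
Hypotheses (w0 : forall t : R, 0 <= w t)
  (iw : leb.-integrable setT (EFin \o w))
  (hk : forall b th, \int[leb]_x (w x * cos (2 * pi * (b * x) + th)) = k b * cos th).

Let mw : measurable_fun setT w.
Proof. by case/integrableP: iw => /measurable_EFinP. Qed.
Let mW : measurable_fun setT (@tprod R n w). Proof. exact: measurable_tprod. Qed.
Let iW := @tprod_integrable R w w0 iw n.

Lemma kernel_bounded : exists2 B, 0 <= B & forall b, `|k b| <= B.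
Proof.
exists (\int[leb]_x w x) => [|b]; first by apply: Rintegral_ge0.
have := hk b 0; rewrite cos0 mulr1 => <-.
have mc : measurable_fun setT (fun x : R => cos (2 * pi * (b * x) + 0)).
  by apply: measurable_cosf; apply: measurable_funD => //; apply: measurable_funM => //; exact: measurable_funM.
have Iw : leb.-integrable setT (EFin \o (fun x => w x * cos (2 * pi * (b * x) + 0))).
  apply: (integrable_dom _ iw) => [|y]; first exact: measurable_funM.
  by rewrite (le_trans (normrM_cos_le _ _))// ger0_norm.
rewrite (le_trans (le_normr_Rintegral _ _))//; apply: le_Rintegral => //.
  exact: (integrable_norm Iw).
by move=> y _; rewrite (le_trans (normrM_cos_le _ _))// ger0_norm.
Qed.

Lemma measurable_kernel : measurable_fun setT k.
Proof.
rewrite (_ : k = fun b => \int[leb]_x (w x * cos (2 * pi * (b * x) + 0))); last first.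
  by apply/funext => b; rewrite hk cos0 mulr1.
apply: (@measurable_Rintegral1 _ _ _ _ _ leb (fun p : measurableTypeR R * R => w p.1 * cos (2 * pi * (p.2 * p.1) + 0))).
apply: measurable_funM; first exact: (measurableT_comp mw).
by apply: measurable_cosf; apply: measurable_funD => //; apply: measurable_funM => //; exact: measurable_funM.
Qed.

Lemma tkernel_bounded : exists2 B, 0 <= B & forall z : n.-tuple R, `|tprod k z| <= B.
Proof.
have [B B0 kB] := kernel_bounded; exists (B ^+ n) => [|z]; first exact: exprn_ge0.
rewrite normr_prod -[X in B ^+ X]card_ord -prodr_const; apply: ler_prod => i _.
by rewrite normr_ge0 kB.
Qed.

Lemma measurable_tkernel d (T : measurableType d) (f : T -> n.-tuple R) :
  measurable_fun setT f -> measurable_fun setT (fun t => tprod k (f t)).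
Proof. by move=> mf; apply: measurable_tprod => //; exact: measurable_kernel. Qed.

Lemma Rintegral_weight_Hf x :
  \int[mu n]_xi (tprod w xi * Hf phi xi (2 * pi * dotp x xi)) =
  \int[mu n]_y (phi y * tprod k (tsub x y)).
Proof.
under eq_Rintegral => xi _.
  rewrite HfE -RintegralZl//; last first.
    by apply: integrable_cosM; apply: measurable_funB => //; exact: measurable_phase0.
  over.
rewrite (Rfubini iW integrable_absR
  (k := fun p => tprod w p.1 * (phi p.2 * cos (2 * pi * dotp x p.1 - 2 * pi * dotp p.2 p.1))))/=; last 2 first.
- apply: measurable_funM; first exact: (measurableT_comp mW).
  apply: measurable_funM; first exact: (measurableT_comp mphi).
  by apply: measurable_cosf; apply: measurable_funB; exact: measurable_phase0.
- by move=> xi y /=; rewrite normrM ger0_norm ?tprod_ge0// ler_wpM2l ?tprod_ge0// normrM_cos_le.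
apply: eq_Rintegral => y _.
under eq_Rintegral => xi _.
  rewrite mulrCA (_ : _ - _ = 2 * pi * dotp (tsub x y) xi + 0); last first.
    rewrite -mulrBr addr0; congr (_ * _); rewrite /dotp -sumrB; apply: eq_bigr => i _.
    by rewrite tnth_mktuple mulrBl.
  over.
rewrite RintegralZl// ?(Rintegral_tprod_cos w0 iw hk) ?cos0 ?mulr1//.
apply: (integrable_dom _ iW) => [|xi].
  by apply: measurable_funM => //; apply: measurable_cosf; exact: measurable_phase.
by rewrite (le_trans (normrM_cos_le _ _))// ger0_norm ?tprod_ge0.
Qed.

(** A weight on the frequency side becomes convolution with its transform on the physical side.
    Fubini is used twice, through [En_Hf] and then through [Rintegral_weight_Hf]. *)
Lemma Rintegral_weight_En :
  \int[mu n]_xi (tprod w xi * En phi xi) =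
  \int[mu n]_x \int[mu n]_y (phi x * (phi y * tprod k (tsub x y))).
Proof.
pose M := \int[mu n]_x `|phi x|.
have M0 : 0 <= M by apply: Rintegral_ge0.
have iWM : (mu n).-integrable setT (EFin \o (fun xi => tprod w xi * M)).
  exact: (integrable_mulr M iW).
have mH x : measurable_fun setT (fun xi => Hf phi xi (2 * pi * dotp x xi)).
  by apply: measurable_Hf => //; exact: measurable_phase0.
under eq_Rintegral => xi _.
  rewrite En_Hf -RintegralZl//; last first.
    apply: (integrable_dom (g := fun x => `|phi x| * M)) => [||x].
    - by apply: measurable_funM => //; apply: measurable_Hf => //; exact: measurable_phase0.
    - exact: (integrable_mulr M integrable_absR).
    - by rewrite normrM ler_wpM2l// Hf_le.
  over.
rewrite (Rfubini iWM integrable_absR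
  (k := fun p => tprod w p.1 * (phi p.2 * Hf phi p.1 (2 * pi * dotp p.2 p.1))))/=; last 2 first.
- apply: measurable_funM; first exact: (measurableT_comp mW).
  apply: measurable_funM; first exact: (measurableT_comp mphi).
  by apply: measurable_Hf => //; exact: measurable_phase0.
- move=> xi y /=; rewrite normrM ger0_norm ?tprod_ge0// -[leRHS]mulrA ler_wpM2l ?tprod_ge0//.
  by rewrite normrM mulrC ler_wpM2r// Hf_le.
have iH x : (mu n).-integrable setT (EFin \o (fun xi => tprod w xi * Hf phi xi (2 * pi * dotp x xi))).
  apply: (integrable_dom _ iWM) => [|xi]; first exact: measurable_funM.
  by rewrite normrM ger0_norm ?tprod_ge0// ler_wpM2l ?tprod_ge0// Hf_le.
apply: eq_Rintegral => x _; under eq_Rintegral do rewrite mulrCA.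
rewrite RintegralZl// Rintegral_weight_Hf -RintegralZl//.
have [B B0 kB] := tkernel_bounded.
apply: (integrable_dom (g := fun y => `|phi y| * B)) => [||y].
- by apply: measurable_funM => //; apply: measurable_tkernel; exact: measurable_tsub.
- exact: (integrable_mulr B integrable_absR).
- by rewrite normrM ler_wpM2l.
Qed.

End weight.
End integrable.

End FourierEnergy.

(** * Plancherel for integrable functions of finite energy *)

Section Plancherel.
Variable R : realType.
Variable n : nat.
Variable phi : n.-tuple R -> R.
Hypotheses (iphi : (mu n).-integrable setT (EFin \o phi)) (phi2 : (L2e (mu n) phi < +oo)%E).

Let mphi : measurable_fun setT phi.
Proof. by case/integrableP: iphi => /measurable_EFinP. Qed.

Lemma tsub_tsub (x y : n.-tuple R) : tsub x (tsub x y) = y.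
Proof. by apply: eq_from_tnth => i; rewrite !tnth_mktuple opprB addrC subrK. Qed.

Section approx.
Variable a : R.
Hypothesis a0 : 0 < a.

Let w := expw a.
Let k (t : R) := expk a (2 * pi * t).
Let W : n.-tuple R -> R := tprod k.

Let w0 t : 0 <= w t. Proof. exact: expw_ge0. Qed.
Let iw : leb.-integrable setT (EFin \o w). Proof. exact: expw_integrable. Qed.
Let hk b th : \int[leb]_x (w x * cos (2 * pi * (b * x) + th)) = k b * cos th.
Proof. by rewrite /k -Rintegral_expw_cos//; apply: eq_Rintegral => x _; rewrite mulrA. Qed.

Let k0 t : 0 <= k t. Proof. exact: expk_ge0. Qed.
Let mk : measurable_fun setT k. Proof. exact: measurable_expk. Qed.
Let W0 z : 0 <= W z. Proof. exact: tprod_ge0. Qed.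
Let mW d (T : measurableType d) (f : T -> n.-tuple R) :
  measurable_fun setT f -> measurable_fun setT (fun t => W (f t)).
Proof. by move=> mf; apply: measurable_tprod. Qed.

Let intW : (\int[mu n]_z (W z)%:E = 1)%E.
Proof. by rewrite (ge0_integral_tprod n mk k0 (integral_expk a0)) expr1n. Qed.

(* [2 A + D = B1 + B2] is the polarization identity weighted by the Poisson kernel [W]; [A]
   carries the energy damped by [expR (- a |xi|)], and [D] vanishes with [a] by L2-continuity
   of translations. *)
Let m2 := (@mu R n \x mu n)%E.
Let B1 (p : n.-tuple R * n.-tuple R) := phi p.1 ^+ 2 * W (tsub p.1 p.2).
Let B2 (p : n.-tuple R * n.-tuple R) := phi p.2 ^+ 2 * W (tsub p.1 p.2).
Let D (p : n.-tuple R * n.-tuple R) := (phi p.1 - phi p.2) ^+ 2 * W (tsub p.1 p.2).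
Let A (p : n.-tuple R * n.-tuple R) := phi p.1 * (phi p.2 * W (tsub p.1 p.2)).

Let mW12 : measurable_fun setT (fun p : n.-tuple R * n.-tuple R => W (tsub p.1 p.2)).
Proof. by apply: mW; exact: measurable_tsub. Qed.
Let mphi1 : measurable_fun setT (fun p : n.-tuple R * n.-tuple R => phi p.1).
Proof. exact: (measurableT_comp mphi). Qed.
Let mphi2 : measurable_fun setT (fun p : n.-tuple R * n.-tuple R => phi p.2).
Proof. exact: (measurableT_comp mphi). Qed.

Let mB1 : measurable_fun setT B1. Proof. by apply: measurable_funM => //; exact: measurable_funX. Qed.
Let mB2 : measurable_fun setT B2. Proof. by apply: measurable_funM => //; exact: measurable_funX. Qed.
Let mD : measurable_fun setT D.
Proof. by apply: measurable_funM => //; apply: measurable_funX; exact: measurable_funB. Qed.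
Let mA : measurable_fun setT A. Proof. by apply: measurable_funM => //; exact: measurable_funM. Qed.

Let B1_ge0 p : 0 <= B1 p. Proof. by rewrite mulr_ge0// sqr_ge0. Qed.
Let B2_ge0 p : 0 <= B2 p. Proof. by rewrite mulr_ge0// sqr_ge0. Qed.
Let D_ge0 p : (0 <= (D p)%:E)%E. Proof. by rewrite lee_fin mulr_ge0// sqr_ge0. Qed.

Let mWx x : measurable_fun setT (fun y => (W (tsub x y))%:E).
Proof. by apply/measurable_EFinP; apply: mW; exact: measurable_tsub. Qed.
Let mWy y : measurable_fun setT (fun x => (W (tsub x y))%:E).
Proof. by apply/measurable_EFinP; apply: mW; exact: measurable_tsub. Qed.
Let mWE : measurable_fun setT (fun x => (W x)%:E).
Proof. by apply/measurable_EFinP; apply: (@mW _ _ id). Qed.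

Let intB1 : (\int[m2]_p (B1 p)%:E = L2e (mu n) phi)%E.
Proof.
rewrite fubini_tonelli1//; last exact/measurable_EFinP.
apply: eq_integral => x _; rewrite /fubini_F /B1 /=.
under eq_integral do rewrite EFinM.
rewrite ge0_integralZl ?lee_fin ?sqr_ge0//; last by move=> y _; rewrite lee_fin.
rewrite (ge0_integral_mu_subr x (f := fun z => (W z)%:E))// ?intW ?mule1//.
Qed.

Let intB2 : (\int[m2]_p (B2 p)%:E = L2e (mu n) phi)%E.
Proof.
rewrite fubini_tonelli2//; last exact/measurable_EFinP.
apply: eq_integral => y _; rewrite /fubini_G /B2 /=.
under eq_integral do rewrite EFinM.
rewrite ge0_integralZl ?lee_fin ?sqr_ge0//; last by move=> x _; rewrite lee_fin.
rewrite (ge0_integral_mu_subl y (f := fun z => (W z)%:E))// ?intW ?mule1//.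
Qed.

Let iB1 : m2.-integrable setT (EFin \o B1).
Proof. by apply: ge0_integrable => //; rewrite intB1. Qed.
Let iB2 : m2.-integrable setT (EFin \o B2).
Proof. by apply: ge0_integrable => //; rewrite intB2. Qed.
Let A_dominated : exists2 M, (mu n).-integrable setT (EFin \o (fun y => `|phi y| * M)) &
  forall x y, `|A (x, y)| <= `|phi x| * (`|phi y| * M).
Proof.
have [M M0 WM] := @tkernel_bounded R n w k w0 iw hk.
exists M => [|x y]; first exact: (integrable_mulr M (integrable_absR iphi)).
by rewrite !normrM ler_wpM2l// ler_wpM2l// WM.
Qed.
Let iA : m2.-integrable setT (EFin \o A).
Proof. by have [M iM AM] := A_dominated; exact: (integrable_dom2 (integrable_absR iphi) iM). Qed.
Let iD : m2.-integrable setT (EFin \o D).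
Proof.
have := integrableB measurableT (integrableD measurableT iB1 iB2) (integrableZl measurableT 2 iA).
apply: eq_integrable => // p _ /=; rewrite /D /B1 /B2 /A -?EFinM -?EFinD; congr EFin; ring.
Qed.

Definition energy_defect : \bar R := (\int[m2]_p (D p)%:E)%E.

Lemma integrable_weight_En : (mu n).-integrable setT (EFin \o (fun xi => tprod w xi * En phi xi)).
Proof.
pose M := \int[mu n]_x `|phi x|.
have iW := @tprod_integrable R w w0 iw n.
apply: (integrable_dom (g := fun xi => tprod w xi * (2 * M ^+ 2))) => [||xi].
- by apply: measurable_funM; [exact: measurable_tprod (measurable_expw a) _ | exact: measurable_En].
- exact: (integrable_mulr (2 * M ^+ 2) iW).
rewrite normrM (ger0_norm (En_ge0 _ _)) (ger0_norm (tprod_ge0 _ _))// ler_wpM2l ?tprod_ge0//.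
rewrite -(Hf_sqrD phi xi 0) mulr_natl mulr2n lerD// -[leLHS]real_normK ?num_real//;
  by rewrite ler_sqr ?nnegrE ?Rintegral_ge0// Hf_le.
Qed.

Lemma weighted_energy :
  (2%:E * \int[mu n]_xi (tprod w xi * En phi xi)%:E + energy_defect = 2%:E * L2e (mu n) phi)%E.
Proof.
rewrite -(EFin_Rintegral integrable_weight_En).
rewrite (Rintegral_weight_En iphi w0 iw hk).
have [M iM AM] := A_dominated.
rewrite (Rintegral_prod (integrable_absR iphi) iM (k := A))//.
rewrite (EFin_Rintegral iA) /energy_defect -[(\int[_]_p (D p)%:E)%E]/(\int[m2]_p (EFin \o D) p)%E.
rewrite -integralZl// -integralD//; last exact: integrableZl.
transitivity (\int[m2]_p ((EFin \o B1) p + (EFin \o B2) p))%E.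
  by apply: eq_integral => p _ /=; rewrite /D /B1 /B2 /A -?EFinM -?EFinD; congr EFin; ring.
rewrite integralD// intB1 intB2 -[in RHS](fineK (x := L2e (mu n) phi)) ?ge0_fin_numE ?L2e_ge0//.
rewrite -[in LHS](fineK (x := L2e (mu n) phi)) ?ge0_fin_numE ?L2e_ge0//.
by rewrite -EFinM -EFinD mulr_natl mulr2n.
Qed.

(** After the substitution [z = x - y] the defect is an average, against the mass-one kernel [W], of
    the L2 cost of translating by [- z]. Translations within [r] cost at most [e]; the others cost
    at most four times the energy, weighted by the tail of [W], which is proportional to [a]. *)
Lemma energy_defect_le (e r : R) : 0 < r -> 0 <= e ->
  (forall z, (forall i, `|tnth z i| <= r) -> (L2e (mu n) (fun x => phi (tadd x z) - phi x)%R <= e%:E)%E) ->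
  (energy_defect <= e%:E + 4%:E * L2e (mu n) phi * (n%:R * (2 * (2 * a / (2 * pi) ^+ 2 / r)))%:E)%E.
Proof.
move=> r0 e0 He; rewrite /energy_defect fubini_tonelli1//; last exact/measurable_EFinP.
pose g (p : n.-tuple R * n.-tuple R) : \bar R := ((phi p.1 - phi (tsub p.1 p.2)) ^+ 2 * W p.2)%:E.
have mg : measurable_fun setT g.
  apply/measurable_EFinP; apply: measurable_funM; last exact: mW.
  apply: measurable_funX; apply: measurable_funB => //.
  by apply: (measurableT_comp mphi); exact: measurable_tsub.
have g0 p : (0 <= g p)%E by rewrite lee_fin mulr_ge0 ?sqr_ge0.
have Vfin : L2e (mu n) phi \is a fin_num by rewrite ge0_fin_numE// L2e_ge0.
set V := fine (L2e (mu n) phi); have VE : L2e (mu n) phi = V%:E by rewrite fineK.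
have V0 : 0 <= V by rewrite fine_ge0// L2e_ge0.
rewrite (_ : (\int[_]_x _)%E = (\int[mu n]_x \int[mu n]_z g (x, z))%E); last first.
  apply: eq_integral => x _; rewrite /fubini_F.
  rewrite -(ge0_integral_mu_subr x (f := fun z => g (x, z)))//; last exact: (measurableT_comp mg (pair1_measurable x)).
  by apply: eq_integral => y _; rewrite /g /D /= tsub_tsub.
rewrite fubini_tonelli//.
have gE z : (\int[mu n]_x g (x, z) = (W z)%:E * L2e (mu n) (fun x => phi (tadd x (topp z)) - phi x)%R)%E.
  rewrite L2e_sym /L2e -ge0_integralZl ?lee_fin//; last 2 first.
  - by apply: measurable_sqrE; apply: measurable_funB => //; exact: measurable_fun_tadd.
  - by move=> x _; rewrite lee_fin sqr_ge0.
  apply: eq_integral => x _; rewrite /g /= -EFinM mulrC; congr (_ * (_ - phi _) ^+ 2)%:E.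
  by apply: eq_from_tnth => i; rewrite !tnth_mktuple.
apply: (@le_trans _ _ (\int[mu n]_z (e%:E * (W z)%:E + (4 * V)%:E * ((\1_(@far R n r) z)%:E * (W z)%:E)))%E).
  apply: ge0_le_integral => //.
  - by move=> z _; exact: integral_ge0.
  - exact: measurable_fun_fubini_tonelli_G.
  - apply: emeasurable_funD; apply: emeasurable_funM => //; apply: emeasurable_funM => //.
    by apply/measurable_EFinP; exact: measurable_indic (measurable_far _).
  move=> z _; rewrite gE muleC; have [zr|zr] := pselect (@far R n r z).
    rewrite (@le_trans _ _ ((4 * V)%:E * (W z)%:E)%E)//.
      by rewrite lee_wpmul2r ?lee_fin// EFinM -VE; exact: L2e_mu_shift_le.
    rewrite indicE mem_set// mul1e leeDr// mule_ge0 ?lee_fin//.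
  rewrite (@le_trans _ _ (e%:E * (W z)%:E)%E)//.
    rewrite lee_wpmul2r ?lee_fin//; apply: He => i; rewrite tnth_mktuple normrN leNgt.
    by apply/negP => ri; apply: zr; exists i; exact: ltW.
  by rewrite leeDl// mule_ge0 ?lee_fin ?mulr_ge0// mule_ge0// lee_fin.
have mI : measurable_fun setT (fun z => ((\1_(@far R n r) z)%:E * (W z)%:E)%E).
  apply: emeasurable_funM => //.
  by apply/measurable_EFinP; exact: measurable_indic (measurable_far _).
have I0 z : (0 <= (\1_(@far R n r) z)%:E * (W z)%:E)%E by rewrite mule_ge0// lee_fin.
rewrite ge0_integralD//;
  try by [move=> z _; rewrite mule_ge0 ?lee_fin ?mulr_ge0|exact: emeasurable_funM].
rewrite !ge0_integralZl ?lee_fin ?mulr_ge0//; last by move=> z _; rewrite lee_fin.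
rewrite intW mule1 VE leeD2l// EFinM; apply: lee_wpmul2l; first by rewrite lee_fin mulr_ge0.
have c0 : 0 <= 2 * a / (2 * pi) ^+ 2 by rewrite divr_ge0 ?sqr_ge0// mulr_ge0// ltW.
rewrite (le_trans (integral_tprod_far_le n mk k0 (integral_expk a0) c0 r0 _))//.
  move=> t rt; have tn0 : t != 0 by apply/eqP => t0; move: rt; rewrite t0 normr0 leNgt r0.
  have t0 : 2 * pi * t != 0 by rewrite !mulf_neq0// gt_eqF// pi_gt0.
  by rewrite (le_trans (expk_le a0 t0))// (exprMn 2 (2 * pi)) invfM mulrA.
by rewrite expr1n mul1r.
Qed.

End approx.

(** One inequality drops the nonnegative defect and lets the damping disappear by monotone
    convergence. The other removes the damping at once and uses that the defect can be made
    small. *)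
Lemma plancherel : (\int[mu n]_xi (En phi xi)%:E = L2e (mu n) phi)%E.
Proof.
have mEn : measurable_fun setT (fun xi => (En phi xi)%:E).
  by apply/measurable_EFinP; exact: measurable_En.
have Vfin : L2e (mu n) phi \is a fin_num by rewrite ge0_fin_numE// L2e_ge0.
set V := fine (L2e (mu n) phi); have VE : L2e (mu n) phi = V%:E by rewrite fineK.
have V0 : 0 <= V by rewrite fine_ge0// L2e_ge0.
pose wk k xi : \bar R := (tprod (expw k.+1%:R^-1) xi * En phi xi)%:E.
have ek0 k : 0 < k.+1%:R^-1 :> R by rewrite invr_gt0.
have wk0 k xi : (0 <= wk k xi)%E by rewrite lee_fin mulr_ge0 ?En_ge0 ?tprod_ge0// => t; exact: expw_ge0.
have mwk k : measurable_fun setT (wk k).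
  by apply/measurable_EFinP; have /integrableP[/measurable_EFinP] := integrable_weight_En (ek0 k).
have D0 k : (0 <= energy_defect k.+1%:R^-1)%E.
  apply: integral_ge0 => p _; rewrite lee_fin mulr_ge0 ?sqr_ge0// tprod_ge0// => t.
  exact: expk_ge0.
apply/eqP; rewrite eq_le; apply/andP; split.
  have cvgw : (\int[mu n]_xi wk k xi)%E @[k --> \oo] --> (\int[mu n]_xi (En phi xi)%:E)%E.
    rewrite (_ : (\int[mu n]_xi _)%E = (\int[mu n]_xi limn (wk ^~ xi))%E).
      apply: cvg_monotone_convergence => //.
      move=> xi _ i j ij; rewrite lee_fin ler_wpM2r ?En_ge0//.
      apply: ler_prod => t _; rewrite expw_ge0 ler_expR lerN2 ler_wpM2r//.
      by rewrite lef_pV2 ?posrE// ler_nat ltnS.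
    apply: eq_integral => xi _; apply/esym/cvg_lim => //.
    apply/fine_cvgP; split; first by near=> k.
    rewrite -[X in _ --> X]mul1r; apply: cvgM; last exact: cvg_cst.
    rewrite -[X in _ --> X](_ : \prod_(i < n) 1 = 1); last by rewrite big1.
    apply: cvg_big => [|i _]; first exact: mul_continuous.
    rewrite /expw -[X in _ --> X]expR0; apply: continuous_cvg; first exact: continuous_expR.
    rewrite -[X in _ --> X]oppr0 -[X in _ --> - X](mul0r `|tnth xi i|).
    by apply: cvgN; apply: cvgMr_tmp; exact: (@cvg_harmonic R).
  apply: (cvge_to_le cvgw); near=> k.
  have H : (2%:E * \int[mu n]_xi wk k xi <= 2%:E * L2e (mu n) phi)%E.
    by rewrite -(weighted_energy (ek0 k)) leeDl.
  by move: H; rewrite lee_pmul2l ?lte_fin.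
apply/lee_addgt0Pr => e e0.
have [r r0 Hr] := L2e_mu_shift_near mphi phi2 e0.
(* The coefficient of [a] in [energy_defect_le]. The radius [r] is fixed by [e] first, and only then
   is [a] taken small. *)
pose cst0 := 4 * V * (n%:R * (2 * (2 / (2 * pi) ^+ 2 / r))).
have cst00 : 0 <= cst0.
  by rewrite /cst0 !mulr_ge0 ?invr_ge0 ?sqr_ge0// ltW.
have [a a0 ae] : exists2 a : R, 0 < a & cst0 * a <= e.
  exists (e / (cst0 + 1)); first by rewrite divr_gt0// ltr_wpDl.
  by rewrite mulrCA ler_piMr ?(ltW e0)// ler_pdivrMr ?ltr_wpDl// mul1r lerDl.
have DE := energy_defect_le a0 r0 (ltW e0) Hr.
have {}DE : (energy_defect a <= (2 * e)%:E)%E.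
  rewrite (le_trans DE)// VE -EFinM -EFinD lee_fin (_ : 2 * e = e + e) ?lerD2l; last by ring.
  apply: le_trans ae; rewrite le_eqVlt; apply/orP; left; apply/eqP; rewrite /cst0.
  by move: (_ ^- 2) => q; ring.
have : (2%:E * L2e (mu n) phi <= 2%:E * (\int[mu n]_xi (En phi xi)%:E + e%:E))%E.
  have I0 : (0 <= \int[mu n]_xi (En phi xi)%:E)%E.
    by apply: integral_ge0 => xi _; rewrite lee_fin En_ge0.
  rewrite -(weighted_energy a0) [leRHS]ge0_muleDr ?lee_fin ?(ltW e0)//.
  apply: leeD; last by rewrite (le_trans DE)// EFinM.
  rewrite lee_wpmul2l ?lee_fin//.
  have mw : measurable_fun setT (fun xi => (tprod (expw a) xi * En phi xi)%:E).
    by apply/measurable_EFinP; have /integrableP[/measurable_EFinP] := integrable_weight_En a0.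
  apply: ge0_le_integral => //.
  - by move=> xi _; rewrite lee_fin mulr_ge0 ?En_ge0 ?tprod_ge0// => t; exact: expw_ge0.
  - move=> xi _; rewrite lee_fin ler_piMl ?En_ge0//.
    rewrite -[leRHS](_ : \prod_(i < n) 1 = 1 :> R); last by rewrite big1.
    apply: ler_prod => i _; rewrite expw_ge0 /expw -[leRHS]expR0 ler_expR oppr_le0.
    by rewrite mulr_ge0// ltW.
by rewrite lee_pmul2l ?lte_fin.
Unshelve. all: by end_near. Qed.

End Plancherel.

(** * Newton forward differences and their remainder *)

Section NewtonExtrapolation.
Variable R : realType.
Implicit Types (g : nat -> R).

Definition nd g (j : nat) : R := g j.+1 - g j.

Lemma iter_nd_shift k g j : iter k nd (fun i => g i.+1) j = iter k nd g j.+1.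
Proof. by elim: k j => [|k IH] j //=; rewrite /nd !IH. Qed.

(** The shift operator is 1 plus the difference operator. The induction applies the formula to the
    shifted sequence and concludes with the Pascal rule. *)
Lemma newton_forward g m :
  g m = \sum_(k < m.+1) 'C(m, k)%:R * iter k nd g 0.
Proof.
elim: m g => [|m IH] g; first by rewrite big_ord1 bin0 mul1r.
rewrite (IH (fun i => g i.+1)).
have E k : iter k nd (fun i => g i.+1) 0%N = iter k.+1 nd g 0%N + iter k nd g 0%N.
  by rewrite iter_nd_shift iterS [nd _ _]/(_ - _) subrK.
under eq_bigr => k _ do rewrite E mulrDr.
rewrite big_split /= [RHS]big_ord_recl bin0 mul1r.
under [in RHS]eq_bigr => k _ do rewrite lift0 binS natrD mulrDl.
rewrite big_split /= [LHS]addrC addrA; congr (_ + _).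
rewrite [LHS]big_ord_recl bin0 mul1r; congr (_ + _).
rewrite [in RHS]big_ord_recr /= bin_small// mul0r addr0.
by apply: eq_bigr.
Qed.

Lemma iter_nd_linear k : exists c : nat -> R, forall g N, (k < N)%N -> forall i,
  iter k nd g i = \sum_(j < N) c j * g (i + j)%N.
Proof.
elim: k => [|k [c IH]].
  exists (fun j => (j == 0%N)%:R) => g [//|N] _ i.
  rewrite big_ord_recl mul1r addn0 big1 ?addr0// => j _.
  by rewrite mul0r.
exists (fun j => (if j is j'.+1 then c j' else 0) - c j) => g [//|N] kN i.
rewrite /= /nd (IH g N)// (IH g N.+1); last exact: ltnW.
under [in RHS]eq_bigr do rewrite mulrBl.
rewrite [RHS]sumrB; congr (_ - _); rewrite [RHS]big_ord_recl mul0r add0r.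
by apply: eq_bigr => j _; rewrite lift0 addnS.
Qed.

(** Size of the Newton terms of order at least [n] for a sequence whose difference of order [k] is
    at most [s ^+ k]. *)
Definition newton_rem (n m : nat) (s : R) : R :=
  \sum_(k < m.+1 | (n <= k)%N) 'C(m, k)%:R * s ^+ k.

(** Differences of order below [n] involve only the first [n] values. The coefficients are chosen
    before [g], so the same ones serve every frequency and can be taken out of an integral over
    [xi]. *)
Lemma newton_extrapolation n m : exists c : nat -> R, forall g,
  g m = \sum_(j < n) c j * g j + \sum_(k < m.+1 | (n <= k)%N) 'C(m, k)%:R * iter k nd g 0.
Proof.
have [c Hc] := choice iter_nd_linear.
exists (fun j => \sum_(k < m.+1 | (k < n)%N) 'C(m, k)%:R * c k j) => g.
rewrite [LHS]newton_forward (bigID (fun k : 'I_m.+1 => (k < n)%N)) /=; congr (_ + _); last first.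
  by apply: eq_bigl => k; rewrite -leqNgt.
under [RHS]eq_bigr do rewrite mulr_suml.
rewrite exchange_big /=; apply: eq_bigr => k kn.
rewrite (Hc k g n kn) mulr_sumr; apply: eq_bigr => j _.
by rewrite add0n mulrA.
Qed.

Lemma newton_rem_ge0 n m s : 0 <= s -> 0 <= newton_rem n m s.
Proof. by move=> s0; apply: sumr_ge0 => k _; rewrite mulr_ge0 ?exprn_ge0. Qed.

(** In the remainder [k >= n], so [s ^+ k] is at most [2^-1 ^+ n] times [(2 * s) ^+ k]; the sum is
    then completed to the full binomial expansion. *)
Lemma newton_rem_le n m s : 0 <= s -> newton_rem n m s <= 2^-1 ^+ n * (1 + 2 * s) ^+ m.
Proof.
move=> s0.
have E : (1 + 2 * s) ^+ m = \sum_(k < m.+1) 'C(m, k)%:R * (2 * s) ^+ k.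
  by rewrite exprDn; apply: eq_bigr => k _; rewrite expr1n mul1r [RHS]mulr_natl.
rewrite E mulr_sumr [leRHS](bigID (fun k : 'I_m.+1 => (n <= k)%N)) /=.
apply: (@le_trans _ _ (\sum_(k < m.+1 | (n <= k)%N) 2^-1 ^+ n * ('C(m, k)%:R * (2 * s) ^+ k))); last first.
  rewrite lerDl sumr_ge0// => k _; apply: mulr_ge0; first by rewrite exprn_ge0 ?invr_ge0.
  by apply: mulr_ge0 => //; rewrite exprn_ge0 ?mulr_ge0.
apply: ler_sum => k nk; rewrite mulrCA ler_wpM2l// exprMn mulrA ler_peMl ?exprn_ge0//.
rewrite -(subnKC nk) exprD mulrA -exprMn mulVf// expr1n mul1r.
by rewrite exprn_ege1// ler1n.
Qed.

(** In the application [m] steps cover at most [ell] and [s] is at most the step times a bounded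
    frequency, so [m * s] stays bounded however fine the nodes are and the factor [2^-1 ^+ n]
    wins. *)
Lemma newton_rem_exp n m s : 0 <= s -> newton_rem n m s <= 2^-1 ^+ n * expR (2 * (m%:R * s)).
Proof.
move=> s0; rewrite (le_trans (newton_rem_le n m s0))// ler_wpM2l ?exprn_ge0//.
rewrite (_ : 2 * (m%:R * s) = m%:R * (2 * s)); last by ring.
rewrite expRM_natl lerXn2r ?nnegrE ?expR_ge0//; first by rewrite addr_ge0 ?mulr_ge0.
exact: expR_ge1Dx.
Qed.

(** Fallback for frequencies off the annulus, where only the trivial bound 2 on the multiplier of a
    difference is available. *)
Lemma newton_rem_le5 n m s : 0 <= s -> s <= 2 -> newton_rem n m s <= 5 ^+ m.
Proof.
move=> s0 s2; rewrite (le_trans (newton_rem_le n m s0))//.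
have h : (1 + 2 * s) ^+ m <= 5 ^+ m.
  by rewrite lerXn2r ?nnegrE//; lra.
rewrite (le_trans _ h)// ler_piMl ?exprn_ge0//; first lra.
by rewrite exprn_ile1// invf_le1// ler1n.
Qed.

(** Real form of [e^(i om) - 1 = 2 sin(om/2) e^(i (om/2 + pi/2))]: each difference multiplies a
    sinusoid by a fixed factor and advances its phase by a fixed angle. *)
Lemma iter_nd_trig (C S psi om : R) k j :
  let T th := C * cos th + S * sin th in
  iter k nd (fun j => T (psi + j%:R * om)) j =
  (2 * sin (om / 2)) ^+ k * T (psi + j%:R * om + k%:R * (om / 2 + pi / 2)).
Proof.
move=> T; elim: k j => [|k IH] j; first by rewrite /= expr0 mul1r mul0r addr0.
rewrite /= /nd !IH -mulrBr exprS (mulrC (2 * _)) -mulrA; congr (_ * _).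
set a := psi + j%:R * om + k%:R * (om / 2 + pi / 2).
have -> : psi + j.+1%:R * om + k%:R * (om / 2 + pi / 2) = (a + om / 2) + om / 2.
  by rewrite /a -natr1; move: (pi : R) => p; lra.
have -> : psi + j%:R * om + k.+1%:R * (om / 2 + pi / 2) = (a + om / 2) + pi / 2.
  by rewrite /a -natr1; move: (pi : R) => p; lra.
have key c : 2 * sin (om / 2) * T (c + pi / 2) = T (c + om / 2) - T (c - om / 2).
  by rewrite /T cosDpihalf sinDpihalf !cosD !sinD !cosN !sinN; ring.
by rewrite key addrK.
Qed.

Lemma normr_sin_le (x : R) : `|sin x| <= `|x|.
Proof.
wlog x0 : x / 0 <= x.
  move=> H; have [/H//|/ltW x0] := leP 0 x.
  by rewrite -normrN -sinN -[leRHS]normrN H// oppr_ge0.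
rewrite (ger0_norm x0); move: x0; rewrite le_eqVlt => /predU1P[<-|x0].
  by rewrite sin0 normr0.
have [c _] := MVT x0 (fun y _ => is_derive_sin y) (continuous_subspaceT (@continuous_sin R)).
rewrite sin0 !subr0 => ->; rewrite normrM (gtr0_norm x0) ler_piMl ?(ltW x0)//.
exact: cos_max.
Qed.

Lemma sigma_le (om : R) : `|2 * sin (om / 2)| <= `|om|.
Proof.
rewrite normrM ger0_norm// mulrC -ler_pdivlMr// (le_trans (normr_sin_le _))//.
by rewrite normrM [`|2^-1|]ger0_norm ?invr_ge0.
Qed.

Lemma sigma_le2 (om : R) : `|2 * sin (om / 2)| <= 2.
Proof. by rewrite normrM ger0_norm// ler_piMr// sin_max. Qed.

End NewtonExtrapolation.

(** * Borel neighbourhoods made of grid cells *)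

Section Cells.
Variables (R : realType) (n : nat).
Implicit Types (E S : set (n.-tuple R)) (r : R) (x y w : n.-tuple R).

Definition supnbhd E r : set (n.-tuple R) :=
  [set x | exists2 w, E w & forall i, `|tnth x i - tnth w i| < r].

Definition cell r x : {ffun 'I_n -> int} := [ffun i => Num.floor (tnth x i / r)].

(* Union of the grid cells of side [r] that meet [S]; it is measurable for every [S]. *)
Definition cellhull r S : set (n.-tuple R) := [set x | exists2 y, S y & cell r x = cell r y].

Lemma measurable_cell r (k : {ffun 'I_n -> int}) : measurable [set x | cell r x = k].
Proof.
rewrite (_ : [set x | _] = \bigcap_(i in [set: 'I_n]) (fun x : n.-tuple R => tnth x i / r) @^-1` `[(k i)%:~R, (k i + 1)%:~R[%classic).
  apply: fin_bigcap_measurable => // i _.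
  have mt : measurable_fun setT (fun x : n.-tuple R => tnth x i / r).
    by apply: measurable_funM => //; exact: measurable_tnth.
  by rewrite -[X in measurable X]setTI; exact: (mt measurableT _ (measurable_itv _)).
apply/seteqP; split => x /=.
  move=> <- i _ /=; rewrite in_itv /= ffunE.
  by rewrite floor_le_tmp floorD1_gt.
move=> H; apply/ffunP => i; rewrite ffunE; have := H i I; rewrite /= in_itv /=.
exact: floor_def.
Qed.

(** The cells are labelled by integer vectors, a countable type, which [unpickle] enumerates. *)
Lemma measurable_cellhull r S : measurable (cellhull r S).
Proof.
pose F m := if @unpickle {ffun 'I_n -> int} m is Some k then
  [set x | cell r x = k /\ exists2 y, S y & cell r y = k] else set0.
rewrite (_ : cellhull r S = \bigcup_m F m).
  apply: bigcupT_measurable => m; rewrite /F; case: unpickle => // k.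
  have [H|H] := pselect (exists2 y, S y & cell r y = k).
    rewrite (_ : [set x | _] = [set x | cell r x = k]); first exact: measurable_cell.
    by apply/seteqP; split => x /= => [[]|->].
  rewrite (_ : [set x | _] = set0)//.
  by apply/seteqP; split => x /= => [[_ /H]|].
apply/seteqP; split => x /=.
  by move=> [y Sy xy]; exists (pickle (cell r x)) => //; rewrite /F pickleK; split=> //; exists y.
by move=> [m _]; rewrite /F; case: unpickle => // k /= [<- [y Sy yk]]; exists y.
Qed.

Lemma sub_cellhull r S : S `<=` cellhull r S.
Proof. by move=> x Sx; exists x. Qed.

Lemma cell_close r x y i : 0 < r -> cell r x = cell r y -> `|tnth x i - tnth y i| < r.
Proof.
move=> r0 /ffunP/(_ i); rewrite !ffunE => H.
have := floor_itv (tnth x i / r); have := floor_itv (tnth y i / r).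
rewrite H; set k := Num.floor _ => /andP[h1 h2] /andP[h3 h4].
rewrite -(ltr_pM2r (x := r^-1)) ?invr_gt0// divff ?gt_eqF//.
rewrite -[X in _ * X < _](gtr0_norm (x := r^-1)) ?invr_gt0// -normrM mulrBl ltr_norml.
move: h2 h4; rewrite intrD => h2 h4; lra.
Qed.

Lemma cellhull_supnbhd E r s : 0 < r -> cellhull r (supnbhd E s) `<=` supnbhd E (s + r).
Proof.
move=> r0 x [y [w Ew yw] xy]; exists w => // i.
have := cell_close i r0 xy; have := yw i.
have := ler_distD (tnth y i) (tnth x i) (tnth w i); lra.
Qed.

(** The inner hull lies within sup-distance [2 * r] of [E] and the outer one contains all points
    closer than [3 * r]; the remaining gap [r] is where the decay of the sinc kernel acts. *)
Lemma far_cellhull E r x y : 0 < r ->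
  cellhull r (supnbhd E r) x -> ~ cellhull r (supnbhd E (3 * r)) y ->
  far r (tsub x y).
Proof.
move=> r0 /(cellhull_supnbhd r0)[w Ew xw] ny; apply: contrapT => nf; apply: ny.
apply: sub_cellhull; exists w => // i.
have xy : `|tnth x i - tnth y i| < r.
  rewrite ltNge; apply/negP => rxy; apply: nf; exists i.
  by rewrite tnth_mktuple.
have := ler_distD (tnth x i) (tnth y i) (tnth w i); have := xw i; rewrite (distrC (tnth y i) (tnth x i)); lra.
Qed.

Lemma supnbhd_Unbhd E r delta : 0 < delta -> r <= delta / (2 * n.+1%:R) ->
  supnbhd E r `<=` Unbhd delta E.
Proof.
move=> d0 rd x [w Ew xw]; exists w => //; rewrite /edist.
rewrite -(ltr_sqr (x := Num.sqrt _)) ?nnegrE ?sqrtr_ge0 ?ltW// sqr_sqrtr; last first.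
  by apply: sumr_ge0 => i _; rewrite sqr_ge0.
set q := delta / (2 * n.+1%:R) in rd.
have n1 : 0 < n.+1%:R :> R by rewrite ltr0n.
have q0 : 0 < q by rewrite divr_gt0// mulr_gt0.
apply: (@le_lt_trans _ _ (\sum_(i < n) q ^+ 2)).
  apply: ler_sum => i _; rewrite -[leLHS]real_normK ?num_real//.
  by rewrite lerXn2r ?nnegrE ?(ltW q0)// ltW// (lt_le_trans (xw i)).
rewrite sumr_const card_ord -mulr_natl /q expr_div_n.
rewrite mulrCA -[ltRHS]mulr1 ltr_pM2l ?exprn_gt0// ltr_pdivrMr ?exprn_gt0 ?mulr_gt0// mul1r.
have nS : n%:R < n.+1%:R :> R by rewrite ltr_nat.
have S2 : n.+1%:R <= n.+1%:R ^+ 2 :> R by rewrite expr2 ler_peMr// ler1n.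
by rewrite exprMn; move: nS S2; lra.
Qed.

End Cells.

(** * Sampling nodes supplied by the geometric control condition *)

Section Segments.
Variables (R : realType) (n : nat).
Implicit Types (E : set (n.-tuple R)) (r : R).

Lemma ediam_set0 : ediam (@set0 (n.-tuple R)) = 0%E.
Proof.
rewrite /ediam (_ : _ `|` _ = [set 0%E]) ?ereal_sup1//.
by apply/seteqP; split => r /=; [move=> [//|[x [y []]]]|left].
Qed.

Lemma hausdorff1_set0 : (@hausdorff1 R n set0 <= 0)%E.
Proof.
apply: ge_ereal_sup => _ [e e0 <-]; apply: ereal_inf_lbound.
exists (fun=> set0); split => //.
- by move=> k; rewrite ediam_set0 lee_fin ltW.
- by rewrite eseries0// => k _ _; rewrite ediam_set0.
Qed.

Lemma enorm_topp (e : n.-tuple R) : enorm (topp e) = enorm e.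
Proof.
rewrite /enorm /dotp; congr Num.sqrt; apply: eq_bigr => i _.
by rewrite tnth_mktuple mulrNN.
Qed.

(** A segment missing [E] would have intersection of measure 0, below [gamma * ell]. The condition
    is applied in direction [- e], so that the point found lies behind [x]. *)
Lemma GCC1_segment E ell gamma (x e : n.-tuple R) : 0 < ell -> 0 < gamma ->
  GCC1 ell gamma E -> enorm e = 1 ->
  exists2 t, 0 <= t <= ell & exists2 w, E w & forall i, tnth w i = tnth x i - t * tnth e i.
Proof.
move=> l0 g0 H e1; have := H x (topp e) ell; rewrite enorm_topp => /(_ e1 (lexx _)).
have [->|] := eqVneq (segment x (topp e) ell `&` E) set0.
  move=> /le_trans/(_ hausdorff1_set0); rewrite lee_fin leNgt.
  by rewrite mulr_gt0.
move=> /set0P[w [[t tl wt] Ew]] _; exists t => //; exists w => // i.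
by rewrite wt tnth_mktuple mulrN.
Qed.

Lemma tnth_le_enorm (e : n.-tuple R) i : `|tnth e i| <= enorm e.
Proof.
rewrite /enorm -sqrtr_sqr; apply: ler_wsqrtr; rewrite /dotp (bigD1 i)//= -expr2.
by rewrite lerDl sumr_ge0// => j _; rewrite -expr2 sqr_ge0.
Qed.

(* The nodes [x - (m - j) tau e] climb from the point of [E] found on the segment towards [x]. *)
Lemma GCC1_nodes E ell gamma (x e : n.-tuple R) (k : nat) r : 0 < ell -> 0 < gamma ->
  GCC1 ell gamma E -> enorm e = 1 -> 0 < r -> (0 < k)%N ->
  exists2 m, (m <= Num.truncn (ell / (r / k%:R)))%N &
    forall j, (j < k)%N -> supnbhd E r (tadd (tadd x (tscale (- (m%:R * (r / k%:R))) e)) (tscale (j%:R * (r / k%:R)) e)).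
Proof.
move=> l0 g0 H e1 r0 k0.
have [t /andP[t0 tl] [w Ew wE]] := GCC1_segment x l0 g0 H e1.
have kR : 0 < k%:R :> R by rewrite ltr0n.
set tau := r / k%:R; have tau0 : 0 < tau by rewrite divr_gt0.
have tt : 0 <= t / tau by rewrite divr_ge0// ltW.
(* Rounding [t] down to a multiple of [tau] leaves an offset in [[0, tau)]. Node [j] is thus at
   distance less than [(j + 1) * tau <= k * tau = r] from the point of [E], which is why [tau] is
   [r / k]. *)
have /andP[m1 m2] := truncn_itv tt; set m := Num.truncn (t / tau) in m1 m2.
exists m; first by rewrite le_truncn// ler_wpM2r// invr_ge0 ltW.
move=> j jk; exists w => // i; rewrite wE !tnth_mktuple.
rewrite (_ : _ - _ = (t - m%:R * tau + j%:R * tau) * tnth e i); last by ring.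
rewrite normrM; have := tnth_le_enorm e i; rewrite e1 => ei.
have s0 : 0 <= t - m%:R * tau by rewrite subr_ge0 -ler_pdivlMr.
have s1 : t - m%:R * tau < tau.
  by move: m2; rewrite ltr_pdivrMr// -natr1 mulrDl mul1r ltrBlDr addrC.
have s2 : 0 <= t - m%:R * tau + j%:R * tau by rewrite addr_ge0// mulr_ge0// ltW.
rewrite (ger0_norm s2) (@le_lt_trans _ _ (t - m%:R * tau + j%:R * tau))//; first by rewrite ler_piMr.
have : j.+1%:R * tau <= r.
  by rewrite /tau mulrA ler_pdivrMr// mulrC ler_wpM2l ?(ltW r0)// ler_nat.
by rewrite -natr1 mulrDl mul1r; lra.
Qed.

End Segments.

(** * Directions in which a cap of the annulus is flat *)

Section Caps.
Variables (R : realType) (n : nat).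
Implicit Types (x y z e xi eta : n.-tuple R).

Lemma dotp_ge0 x : 0 <= dotp x x.
Proof. by apply: sumr_ge0 => i _; rewrite -expr2 sqr_ge0. Qed.

Lemma enorm_ge0 x : 0 <= enorm x. Proof. exact: sqrtr_ge0. Qed.

Lemma sqr_enorm x : enorm x ^+ 2 = dotp x x.
Proof. by rewrite sqr_sqrtr// dotp_ge0. Qed.

Lemma dotpC x y : dotp x y = dotp y x.
Proof. by apply: eq_bigr => i _; rewrite mulrC. Qed.

Lemma dotp_tscale s x y : dotp (tscale s x) y = s * dotp x y.
Proof. by rewrite mulr_sumr; apply: eq_bigr => i _; rewrite tnth_mktuple mulrA. Qed.

Lemma enorm_tscale s x : 0 <= s -> enorm (tscale s x) = s * enorm x.
Proof.
move=> s0; rewrite /enorm dotp_tscale dotpC dotp_tscale mulrA -expr2 sqrtrM ?sqr_ge0//.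
by rewrite sqrtr_sqr ger0_norm.
Qed.

Lemma dotp_lincomb s t x y :
  dotp (tsub (tscale s x) (tscale t y)) (tsub (tscale s x) (tscale t y)) =
  s ^+ 2 * dotp x x + t ^+ 2 * dotp y y - 2 * (s * t * dotp x y).
Proof.
rewrite /dotp !mulr_sumr -big_split /= -sumrB.
by apply: eq_bigr => i _; rewrite !tnth_mktuple; ring.
Qed.

(** Cauchy-Schwarz, by expanding the square of [enorm y] times [x] minus [enorm x] times [y]. The
    division by the product of the norms forces a separate case when it is 0. *)
Lemma dotp_le x y : dotp x y <= enorm x * enorm y.
Proof.
have := dotp_ge0 (tsub (tscale (enorm y) x) (tscale (enorm x) y)).
rewrite dotp_lincomb -!sqr_enorm => H.
have [xy|] := ltP 0 (enorm x * enorm y).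
  by rewrite -(ler_pM2l (x := 2 * (enorm y * enorm x))); [lra|rewrite mulr_gt0// mulrC].
rewrite le_eqVlt ltNge mulr_ge0 ?enorm_ge0// orbF mulf_eq0 => /orP[|] /eqP z0.
  rewrite z0 mul0r [dotp _ _]big1// => i _.
  have : tnth x i = 0 by apply/eqP; rewrite -normr_le0 -z0 tnth_le_enorm.
  by move=> ->; rewrite mul0r.
rewrite z0 mulr0 [dotp _ _]big1// => i _.
have : tnth y i = 0 by apply/eqP; rewrite -normr_le0 -z0 tnth_le_enorm.
by move=> ->; rewrite mulr0.
Qed.

Lemma dotpN x y : dotp (topp x) y = - dotp x y.
Proof. by rewrite /dotp -sumrN; apply: eq_bigr => i _; rewrite tnth_mktuple mulNr. Qed.

Lemma normr_dotp_le x y : `|dotp x y| <= enorm x * enorm y.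
Proof.
rewrite ler_norml dotp_le andbT lerNl -dotpN.
by rewrite (le_trans (dotp_le _ _))// enorm_topp.
Qed.

Hypothesis n0 : (0 < n)%N.

Lemma exists_unit : exists e : n.-tuple R, enorm e = 1.
Proof.
pose i0 := Ordinal n0; exists [tuple (i == i0)%:R | i < n].
rewrite /enorm /dotp (bigD1 i0)//= big1 ?addr0 => [|i /negbTE ii].
  by rewrite tnth_mktuple eqxx mulr1 sqrtr1.
by rewrite tnth_mktuple ii mul0r.
Qed.

(* With [z = xi - eta] one has [xi.e - |xi| = ((|xi| - |eta|)^2 - |z|^2) / (2 |eta|)]
   for [e = eta / |eta|]: a cap of diameter [a] is flat up to [a^2 / |eta|]. *)
Lemma cap_direction (A beta Rad : R) (a := n%:R * (A / 2)) : 0 < A -> 0 < beta ->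
  beta + a + a ^+ 2 + 1 <= Rad -> forall eta, exists2 e, enorm e = 1 &
    forall xi, (forall i, `|tnth xi i - tnth eta i| <= A / 2) ->
      Rad - beta <= enorm xi <= Rad + beta -> `|dotp e xi - Rad| <= beta + 1.
Proof.
move=> A0 b0 HR eta.
have a0 : 0 <= a by rewrite /a mulr_ge0// divr_ge0// ltW.
have zle xi : (forall i, `|tnth xi i - tnth eta i| <= A / 2) ->
    dotp (tsub xi eta) (tsub xi eta) <= a ^+ 2.
  move=> H; apply: (@le_trans _ _ (\sum_(i < n) (A / 2) ^+ 2)).
    apply: ler_sum => i _; rewrite -expr2 tnth_mktuple -[leLHS]real_normK ?num_real//.
    by rewrite lerXn2r ?nnegrE// divr_ge0// ltW.
  rewrite sumr_const card_ord -[leLHS]mulr_natl /a (exprMn 2 n%:R) ler_wpM2r ?sqr_ge0//.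
  by rewrite expr2 ler_peMr// ler1n.
have dE xi : dotp (tsub xi eta) (tsub xi eta) = enorm xi ^+ 2 + enorm eta ^+ 2 - 2 * dotp xi eta.
  have := dotp_lincomb 1 1 xi eta; rewrite !expr1n !mul1r !sqr_enorm => <-.
  by congr dotp; apply: eq_from_tnth => i; rewrite !tnth_mktuple !mul1r.
have etale xi : (forall i, `|tnth xi i - tnth eta i| <= A / 2) -> (enorm xi - enorm eta) ^+ 2 <= a ^+ 2.
  move=> H; apply: le_trans (zle _ H); rewrite dE.
  have := dotp_le xi eta; lra.
have etage xi : (forall i, `|tnth xi i - tnth eta i| <= A / 2) -> enorm xi - a <= enorm eta.
  move=> /etale; rewrite -[leLHS]real_normK ?num_real// ler_sqr ?nnegrE//.
  by rewrite ler_norml; lra.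
(* For [eta = 0] there is no direction to normalize, but the cube then has radius at most
   [a < Rad - beta] and misses the annulus, so any unit vector will do. *)
have [e1|e1] := leP (enorm eta) 0.
  have [e0 e01] := exists_unit; exists e0 => // xi H /andP[H1 _].
  have := etage _ H; have : 0 <= a ^+ 2 by rewrite sqr_ge0.
  by move: HR e1 H1; lra.
exists (tscale (enorm eta)^-1 eta).
  by rewrite enorm_tscale ?invr_ge0 ?enorm_ge0// mulVf// gt_eqF.
move=> xi H /andP[H1 H2]; rewrite dotp_tscale.
have h1 := zle _ H; have h2 := etale _ H; have h3 := etage _ H; have h4 := dE xi.
(* The numerator below lies between [- a ^+ 2] and [a ^+ 2], while [enorm eta >= Rad - beta - a >= a
   ^+ 2 + 1]. The bound 1 is therefore independent of [A]. *)
have h5 : `|(enorm eta)^-1 * dotp eta xi - enorm xi| <= 1.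
  have -> : (enorm eta)^-1 * dotp eta xi - enorm xi =
      ((enorm xi - enorm eta) ^+ 2 - dotp (tsub xi eta) (tsub xi eta)) / (2 * enorm eta).
    by rewrite h4 (dotpC eta xi); field; rewrite gt_eqF.
  rewrite normrM [`|(2 * _)^-1|]gtr0_norm ?invr_gt0 ?mulr_gt0// ler_pdivrMr ?mulr_gt0// mul1r.
  rewrite ler_norml; have := dotp_ge0 (tsub xi eta); have := sqr_ge0 (enorm xi - enorm eta).
  by move: h1 h2 h3 HR H1; lra.
rewrite (_ : _ - Rad = ((enorm eta)^-1 * dotp eta xi - enorm xi) + (enorm xi - Rad)); last by ring.
rewrite (le_trans (ler_normD _ _))// addrC lerD// ler_norml; lra.
Qed.

(** Meant for bounded [Rad]: the bound comes from Cauchy-Schwarz alone, grows with [Rad], and asks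
    nothing of the size of the cube. *)
Lemma any_direction (beta Rad : R) : exists2 e, enorm e = 1 &
    forall xi, Rad - beta <= enorm xi <= Rad + beta -> `|dotp e xi - Rad| <= `|Rad| + (Rad + beta).
Proof.
have [e e1] := exists_unit; exists e => // xi /andP[_ H].
rewrite (le_trans (ler_normB _ _))// addrC lerD2l//.
by rewrite (le_trans (normr_dotp_le _ _))// e1 mul1r.
Qed.

End Caps.

(** * Localization to a frequency cube *)

Section FrequencyLocalization.
Variable R : realType.
Variable n : nat.

Lemma Rintegral_mu_shift (f : n.-tuple R -> R) a : measurable_fun setT f ->
  \int[mu n]_x f (tadd x a) = \int[mu n]_x f x.
Proof.
move=> mf; have mEf : measurable_fun setT (EFin \o f) by exact/measurable_EFinP.
rewrite /Rintegral [in LHS]integralE [in RHS]integralE.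
rewrite -(ge0_integral_mu_shift a (measurable_funepos mEf))//.
rewrite -(ge0_integral_mu_shift a (measurable_funeneg mEf))//.
by congr (fine (_ - _)); apply: eq_integral => x _; rewrite ?funeposE ?funenegE.
Qed.

Lemma Rintegral_mu_subl (f : n.-tuple R -> R) a : measurable_fun setT f ->
  \int[mu n]_x f (tsub x a) = \int[mu n]_x f x.
Proof.
move=> mf; rewrite -(Rintegral_mu_shift (topp a) mf); apply: eq_Rintegral => x _.
by congr f; apply: eq_from_tnth => i; rewrite !tnth_mktuple.
Qed.

Lemma dotp_subl (x y z : n.-tuple R) : dotp (tsub x y) z = dotp x z - dotp y z.
Proof. by rewrite /dotp -sumrB; apply: eq_bigr => i _; rewrite tnth_mktuple mulrBl. Qed.

Lemma dotp_addl (x y z : n.-tuple R) : dotp (tadd x y) z = dotp x z + dotp y z.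
Proof. by rewrite /dotp -big_split; apply: eq_bigr => i _; rewrite tnth_mktuple mulrDl. Qed.

Variable A : R.
Hypothesis A0 : 0 < A.

Definition qbox : n.-tuple R -> R := tprod (boxw A).
(** The factor [2 * pi] passes from the angular frequency of [boxk] to the convention of [FC] and
    [FS]. *)
Definition kbox1 (t : R) : R := boxk A (2 * pi * t).
Definition kbox : n.-tuple R -> R := tprod kbox1.

Lemma kbox1E b th : \int[leb]_x (boxw A x * cos (2 * pi * (b * x) + th)) = kbox1 b * cos th.
Proof. by rewrite /kbox1 -Rintegral_boxw_cos//; apply: eq_Rintegral => x _; rewrite mulrA. Qed.

Lemma qbox01 xi : qbox xi = 0 \/ qbox xi = 1.
Proof.
have [H|H] := pselect (forall i, `|tnth xi i| <= A / 2).
  by right; rewrite /qbox /tprod big1// => i _; rewrite /boxw H.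
left; apply/eqP/prodf_eq0; move/existsNP : H => [i /negP H].
by exists i => //; rewrite /boxw (negbTE H).
Qed.

Lemma qbox_ge0 xi : 0 <= qbox xi.
Proof. by have [->|->] := qbox01 xi. Qed.

Lemma qbox_sqr xi : qbox xi ^+ 2 = qbox xi.
Proof. by have [->|->] := qbox01 xi; rewrite ?expr0n ?expr1n. Qed.

Lemma qbox_neq0 xi i : qbox xi != 0 -> `|tnth xi i| <= A / 2.
Proof.
move=> /prodf_neq0/(_ i isT); rewrite /boxw; case: ifP => //.
by rewrite eqxx.
Qed.

Lemma integrable_qbox : (mu n).-integrable setT (EFin \o qbox).
Proof. by apply: tprod_integrable; [exact: boxw_ge0|exact: boxw_integrable]. Qed.

Lemma measurable_qbox d (T : measurableType d) (f : T -> n.-tuple R) :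
  measurable_fun setT f -> measurable_fun setT (fun t => qbox (f t)).
Proof. by move=> mf; apply: measurable_tprod => //; exact: measurable_boxw. Qed.

Lemma measurable_kbox d (T : measurableType d) (f : T -> n.-tuple R) :
  measurable_fun setT f -> measurable_fun setT (fun t => kbox (f t)).
Proof. by move=> mf; apply: (measurable_tkernel (boxw_integrable A) kbox1E mf). Qed.

Lemma kbox_bounded : exists2 B, 0 <= B & forall z, `|kbox z| <= B.
Proof. exact: (tkernel_bounded n (boxw_ge0 A) (boxw_integrable A) kbox1E). Qed.

Lemma Rintegral_qbox_shift (z eta : n.-tuple R) th :
  \int[mu n]_xi (qbox (tsub xi eta) * cos (2 * pi * dotp z xi + th)) =
  kbox z * cos (2 * pi * dotp z eta + th).
Proof.
rewrite -(Rintegral_tprod_cos (boxw_ge0 A) (boxw_integrable A) kbox1E).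
rewrite -[RHS](Rintegral_mu_subl eta); last first.
  apply: measurable_funM; first exact: measurable_qbox.
  by apply: measurable_cosf; exact: measurable_phase.
apply: eq_Rintegral => xi _; congr (_ * cos _).
rewrite (dotpC z (tsub _ _)) dotp_subl !(dotpC z); ring.
Qed.

Section localize.
Variable h : n.-tuple R -> R.
Hypothesis ih : (mu n).-integrable setT (EFin \o h).

Let mh : measurable_fun setT h.
Proof. by case/integrableP: ih => /measurable_EFinP. Qed.

Definition window (x y : n.-tuple R) : R := h y * kbox (tsub x y).

Lemma measurable_window x : measurable_fun setT (window x).
Proof. by apply: measurable_funM => //; apply: measurable_kbox; exact: measurable_tsub. Qed.

Lemma integrable_window x : (mu n).-integrable setT (EFin \o (window x)).
Proof.
have [B B0 kB] := kbox_bounded.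
apply: (integrable_dom (g := fun y => `|h y| * B)) => [||y].
- exact: measurable_window.
- exact: (integrable_mulr B (integrable_absR ih)).
- by rewrite normrM ler_wpM2l.
Qed.

Lemma integrable_qbox_shift eta : (mu n).-integrable setT (EFin \o (fun xi => qbox (tsub xi eta))).
Proof.
apply: ge0_integrable => [|xi|]; [|exact: qbox_ge0|].
  by apply: measurable_qbox; exact: measurable_tsub.
have mq : measurable_fun setT (fun xi => (qbox xi)%:E) by apply/measurable_EFinP; apply: (@measurable_qbox _ _ id).
rewrite (ge0_integral_mu_subl eta mq) => [|xi]; last by rewrite lee_fin qbox_ge0.
have /integrableP[_] := integrable_qbox; rewrite (eq_integral (fun xi => (qbox xi)%:E))//.
by move=> xi _ /=; rewrite ger0_norm// qbox_ge0.
Qed.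

(** Fubini and the transform of the translated cube. The phase [2 * pi * dotp x eta] undoes the
    centring at [eta]: seen as a function of [x], the left side is [h] filtered to the frequencies
    of the cube. *)
Lemma window_localization x eta th :
  Hf (window x) eta (2 * pi * dotp x eta + th) =
  \int[mu n]_xi (qbox (tsub xi eta) * Hf h xi (2 * pi * dotp x xi + th)).
Proof.
under [RHS]eq_Rintegral => xi _.
  rewrite (HfE ih) -RintegralZl//; last first.
    by apply: (integrable_cosM ih); apply: measurable_funB; [exact: measurable_phase|exact: measurable_phase0].
  over.
rewrite (Rfubini (integrable_qbox_shift eta) (integrable_absR ih)
  (k := fun p => qbox (tsub p.1 eta) * (h p.2 * cos (2 * pi * dotp x p.1 + th - 2 * pi * dotp p.2 p.1))))/=; last 2 first.
- apply: measurable_funM; first by apply: measurable_qbox; exact: measurable_tsub.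
  apply: measurable_funM; first exact: (measurableT_comp mh).
  by apply: measurable_cosf; apply: measurable_funB; [exact: measurable_phase|exact: measurable_phase0].
- by move=> xi y /=; rewrite normrM ger0_norm ?qbox_ge0// ler_wpM2l ?qbox_ge0// normrM_cos_le.
rewrite (HfE (integrable_window x)); apply: eq_Rintegral => y _.
under [RHS]eq_Rintegral => xi _.
  rewrite mulrCA (_ : 2 * pi * dotp x xi + th - _ = 2 * pi * dotp (tsub x y) xi + th); last first.
    by rewrite dotp_subl; ring.
  over.
rewrite RintegralZl//; last first.
  apply: (integrable_dom _ (integrable_qbox_shift eta)) => [|xi].
    apply: measurable_funM; first by apply: measurable_qbox; exact: measurable_tsub.
    by apply: measurable_cosf; exact: measurable_phase.
  by rewrite (le_trans (normrM_cos_le _ _))// ger0_norm// qbox_ge0.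
rewrite Rintegral_qbox_shift /window -mulrA; congr (_ * (_ * cos _)).
by rewrite dotp_subl; ring.
Qed.

Lemma measurable_window_En :
  measurable_fun setT (fun p : n.-tuple R * n.-tuple R => En (window p.1) p.2).
Proof.
have mw : measurable_fun setT (fun p : n.-tuple R * (n.-tuple R * n.-tuple R) => window p.2.1 p.1).
  apply: measurable_funM; first exact: (measurableT_comp mh).
  apply: measurable_kbox; apply: measurable_tsub => //.
  exact: (measurableT_comp measurable_fst measurable_snd).
have mp : measurable_fun setT (fun p : n.-tuple R * (n.-tuple R * n.-tuple R) => 2 * pi * dotp p.1 p.2.2).
  by apply: measurable_phase0 => //; exact: (measurableT_comp measurable_snd measurable_snd).
apply: measurable_funD; apply: measurable_funX.
- apply: (@measurable_Rintegral1 _ _ _ _ _ (mu n) (fun p => window p.2.1 p.1 * cos (2 * pi * dotp p.1 p.2.2))).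
  by apply: measurable_funM => //; exact: measurable_cosf.
- apply: (@measurable_Rintegral1 _ _ _ _ _ (mu n) (fun p => window p.2.1 p.1 * sin (2 * pi * dotp p.1 p.2.2))).
  by apply: measurable_funM => //; exact: measurable_sinf.
Qed.

End localize.
End FrequencyLocalization.

(** * Extrapolation of the localized function along a line *)

Section Extrapolation.
Variable R : realType.

Lemma Rintegral_sumZ d (T : measurableType d) (m : {measure set T -> \bar R}) k (c : nat -> R) (f : nat -> T -> R) :
  (forall j, m.-integrable setT (EFin \o f j)) ->
  m.-integrable setT (EFin \o (fun x => \sum_(j < k) c j * f j x)) /\
  \int[m]_x (\sum_(j < k) c j * f j x) = \sum_(j < k) c j * \int[m]_x f j x.
Proof.
move=> If; elim: k => [|k [IH1 IH2]].
  split; last by rewrite big_ord0; under eq_Rintegral do rewrite big_ord0; rewrite /Rintegral integral0.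
  by have := integrable0 m setT; apply: eq_integrable => // x _ /=; rewrite big_ord0.
have ifc : m.-integrable setT (EFin \o (fun x => c k * f k x)).
  by have := integrableZl measurableT (c k) (If k); apply: eq_integrable => // x _ /=; rewrite EFinM.
split.
  have := integrableD measurableT IH1 ifc.
  by apply: eq_integrable => // x _ /=; rewrite big_ord_recr /= EFinD.
rewrite big_ord_recr /= -IH2 -RintegralZl// -RintegralD//.
by apply: eq_Rintegral => x _; rewrite big_ord_recr.
Qed.

Lemma sqr_sum_le k (u : 'I_k -> R) : (\sum_(j < k) u j) ^+ 2 <= k%:R * \sum_(j < k) u j ^+ 2.
Proof.
apply: (@le_trans _ _ (\sum_(i < k) \sum_(j < k) (u i ^+ 2 / 2 + u j ^+ 2 / 2))).
  rewrite expr2 mulr_suml; apply: ler_sum => i _; rewrite mulr_sumr; apply: ler_sum => j _.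
  by have := sqr_ge0 (u i - u j); rewrite sqrrB; lra.
rewrite le_eqVlt; apply/orP; left; apply/eqP.
under eq_bigr do rewrite big_split /= sumr_const card_ord.
rewrite big_split /= sumr_const card_ord sumrMnl -mulrnDl.
by rewrite -mulr_suml -splitr mulr_natl.
Qed.

Variable n : nat.
Variable A : R.
Hypothesis A0 : 0 < A.
Variable h : n.-tuple R -> R.
Hypotheses (ih : (mu n).-integrable setT (EFin \o h)).

Let mh : measurable_fun setT h.
Proof. by case/integrableP: ih => /measurable_EFinP. Qed.

Variables (eta e : n.-tuple R) (Rad tau : R).

Let q xi := @qbox R n A (tsub xi eta).
Let q0 xi : 0 <= q xi. Proof. exact: qbox_ge0. Qed.
Let iq : (mu n).-integrable setT (EFin \o q). Proof. exact: integrable_qbox_shift. Qed.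
Let mq : measurable_fun setT q. Proof. by apply: measurable_qbox; exact: measurable_tsub. Qed.

(* [sample p th j] reads the frequency-localized function at the [j]-th node, demodulated at
   frequency [Rad] along [e]: at [xi] its phase advances only by [mism xi] per step, which is
   small where [dotp e xi] is close to [Rad]. *)
Definition mism xi : R := 2 * pi * (tau * (dotp e xi - Rad)).
Definition sigm xi : R := 2 * sin (mism xi / 2).
Definition node (p : n.-tuple R) (j : nat) : n.-tuple R := tadd p (tscale (j%:R * tau) e).

Definition sample p (th : R) j : R :=
  Hf (window A h (node p j)) eta (2 * pi * dotp (node p j) eta + (th - j%:R * (2 * pi * (tau * Rad)))).

(** For fixed [xi] the integrand is a sinusoid in [j] of angular frequency [mism xi], so Newton
    extrapolation can be carried out under the integral. *)
Lemma sampleE p th j : sample p th j =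
  \int[mu n]_xi (q xi * Hf h xi (2 * pi * dotp p xi + th + j%:R * mism xi)).
Proof.
rewrite /sample window_localization//; apply: eq_Rintegral => xi _; congr (_ * Hf h _ _).
by rewrite /node dotp_addl dotp_tscale /mism; ring.
Qed.

Lemma measurable_mism : measurable_fun setT mism.
Proof.
apply: measurable_funM => //; apply: measurable_funM => //; apply: measurable_funB => //.
exact: measurable_dotp.
Qed.

Lemma measurable_sigm : measurable_fun setT sigm.
Proof.
apply: measurable_funM => //; apply: measurable_sinf; apply: measurable_funM => //.
exact: measurable_mism.
Qed.

Section remainder.
Variables k m : nat.

Definition ncoef : nat -> R := projT1 (cid (newton_extrapolation R k m)).

Lemma ncoefP (g : nat -> R) : g m = \sum_(j < k) ncoef j * g j +
  \sum_(i < m.+1 | (k <= i)%N) 'C(m, i)%:R * iter i (@nd R) g 0%N.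
Proof. exact: (projT2 (cid (newton_extrapolation R k m))). Qed.

(** Newton remainder on the frequency side, with its differences evaluated by [iter_nd_trig]. The
    values [t = 0] and [t = pi / 2] are its two quadratures; their cosine and sine integrals at [p]
    give the remainder at [p]. *)
Definition remf (t : R) xi : R := q xi *
  \sum_(i < m.+1 | (k <= i)%N) 'C(m, i)%:R * (sigm xi ^+ i * Hf h xi (i%:R * (mism xi / 2 + pi / 2) + t)).

Lemma measurable_remf t : measurable_fun setT (remf t).
Proof.
apply: measurable_funM => //.
under eq_fun do rewrite big_mkcond /=.
apply: measurable_sum => i; case: (k <= i)%N => //.
apply: measurable_funM => //; apply: measurable_funM.
  by apply: measurable_funX; exact: measurable_sigm.
apply: (measurable_Hf ih) => //; apply: measurable_funD => //; apply: measurable_funM => //.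
by apply: measurable_funD => //; apply: measurable_funM => //; exact: measurable_mism.
Qed.

Lemma remf_sqr_le t xi :
  remf t xi ^+ 2 <= q xi * newton_rem k m `|sigm xi| ^+ 2 * En h xi.
Proof.
have qq : q xi ^+ 2 = q xi by exact: qbox_sqr.
rewrite /remf exprMn qq -[leRHS]mulrA ler_wpM2l//.
rewrite -(sqr_sqrtr (En_ge0 h xi)) -exprMn -[leLHS]real_normK ?num_real//.
rewrite lerXn2r ?nnegrE ?mulr_ge0 ?newton_rem_ge0 ?sqrtr_ge0//.
rewrite (le_trans (ler_norm_sum _ _ _))// /newton_rem mulr_suml; apply: ler_sum => i _.
rewrite normrM normr_nat -[leRHS]mulrA ler_wpM2l//.
rewrite [`|sigm xi ^+ i * _|]normrM normrX ler_wpM2l ?exprn_ge0//.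
by rewrite -sqrtr_sqr ler_wsqrtr// Hf_sqr_le.
Qed.

Lemma remf_bounded t : exists B, forall xi, `|remf t xi| <= q xi * B.
Proof.
pose M := \int[mu n]_x `|h x|.
exists (\sum_(i < m.+1 | (k <= i)%N) 'C(m, i)%:R * (2 ^+ i * M)) => xi.
rewrite normrM ger0_norm// ler_wpM2l// (le_trans (ler_norm_sum _ _ _))//; apply: ler_sum => i _.
rewrite normrM normr_nat ler_wpM2l//.
rewrite [`|sigm xi ^+ i * _|]normrM normrX ler_pM ?exprn_ge0//; last exact: Hf_le.
by rewrite lerXn2r ?nnegrE// sigma_le2.
Qed.

Lemma remf_integrable t : (mu n).-integrable setT (EFin \o remf t).
Proof.
have [B HB] := remf_bounded t.
apply: (integrable_dom (g := fun xi => q xi * B)) => //.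
- exact: measurable_remf.
- exact: (integrable_mulr B iq).
Qed.

Lemma measurable_newton_rem : measurable_fun setT (fun xi => newton_rem k m `|sigm xi|).
Proof.
rewrite /newton_rem; under eq_fun do rewrite big_mkcond /=.
apply: measurable_sum => i; case: (k <= i)%N => //.
apply: measurable_funM => //; apply: measurable_funX.
by apply: measurableT_comp => //; exact: measurable_sigm.
Qed.

(** Plancherel with the roles exchanged: [remf t] is a function of frequency, and its energy is
    integrated over the base point [p]. *)
Lemma integral_En_remf t : (\int[mu n]_p (En (remf t) p)%:E <=
  \int[mu n]_xi (q xi * newton_rem k m `|sigm xi| ^+ 2 * En h xi)%:E)%E.
Proof.
have mr := measurable_remf t.
rewrite plancherel; last 2 first.
- exact: remf_integrable.
- have [B HB] := remf_bounded t.
  have iqB : (mu n).-integrable setT (EFin \o (fun xi => q xi * B ^+ 2)).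
    exact: (integrable_mulr (B ^+ 2) iq).
  have : (mu n).-integrable setT (EFin \o (fun xi => remf t xi ^+ 2)).
    apply: (integrable_dom _ iqB) => [|xi]; first exact: measurable_funX.
    have qq : q xi ^+ 2 = q xi by exact: qbox_sqr.
    rewrite normrX -[in leRHS]qq -exprMn lerXn2r ?nnegrE//.
    by rewrite (le_trans _ (HB xi)).
  by move=> /EFin_Rintegral H; rewrite /L2e -H ltry.
apply: ge0_le_integral_EFin => [||xi|xi]; [exact: measurable_funX| |exact: sqr_ge0|exact: remf_sqr_le].
apply: measurable_funM; last exact: measurable_En.
by apply: measurable_funM => //; apply: measurable_funX; exact: measurable_newton_rem.
Qed.

Lemma integrable_qHf (th : n.-tuple R -> R) : measurable_fun setT th ->
  (mu n).-integrable setT (EFin \o (fun xi => q xi * Hf h xi (th xi))).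
Proof.
move=> mth; pose M := \int[mu n]_x `|h x|.
apply: (integrable_dom (g := fun xi => q xi * M)) => [||xi].
- by apply: measurable_funM => //; exact: (measurable_Hf ih).
- exact: (integrable_mulr M iq).
by rewrite normrM ger0_norm// ler_wpM2l// Hf_le.
Qed.

Lemma sample_extrapolation p th :
  sample p th m = \sum_(j < k) ncoef j * sample p th j +
  \int[mu n]_xi (remf 0 xi * cos (2 * pi * dotp p xi + th) +
                 remf (pi / 2) xi * sin (2 * pi * dotp p xi + th)).
Proof.
have mph : measurable_fun setT (fun xi => 2 * pi * dotp p xi + th) by exact: measurable_phase.
have If j : (mu n).-integrable setT (EFin \o (fun xi => q xi * Hf h xi (2 * pi * dotp p xi + th + j%:R * mism xi))).
  apply: integrable_qHf; apply: measurable_funD => //; apply: measurable_funM => //.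
  exact: measurable_mism.
have [S1 S2] := @Rintegral_sumZ _ _ (mu n) k ncoef _ If.
under eq_bigr do rewrite sampleE.
rewrite -S2 -RintegralD//; last first.
  have := integrableD measurableT (integrable_cosM (remf_integrable 0) mph) (integrable_sinM (remf_integrable (pi / 2)) mph).
  by apply: eq_integrable => // x _ /=; rewrite EFinD.
rewrite sampleE; apply: eq_Rintegral => xi _.
set psi := 2 * pi * dotp p xi + th.
have N := ncoefP (fun j => Hf h xi (psi + j%:R * mism xi)).
rewrite /= N mulrDr; congr (_ + _).
  by rewrite mulr_sumr; apply: eq_bigr => j _; rewrite mulrCA.
rewrite /remf -!mulrA -mulrDr; congr (_ * _); rewrite !mulr_suml -big_split /=.
apply: eq_bigr => i _; rewrite -!mulrA -mulrDr; congr (_ * _).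
rewrite (iter_nd_trig (FC h xi) (FS h xi) psi (mism xi) i 0) mul0r addr0 -mulrDr; congr (_ * _).
by rewrite -/(Hf h xi _) Hf_shift addr0 [in RHS]mulrC [X in _ = _ + X]mulrC /mism -!mulrA.
Qed.

(** Squaring the extrapolation costs a factor 2 for separating the remainder and [k] for the sum
    over the nodes. The 4 is that same 2 times the 2 from splitting the remainder into its two
    quadratures. *)
Lemma sample_bound p :
  En (window A h (node p m)) eta <=
  \sum_(j < k) (2 * k%:R * ncoef j ^+ 2) * En (window A h (node p j)) eta +
  4 * (En (remf 0) p + En (remf (pi / 2)) p).
Proof.
(* Demodulation changes only the phase, and by [Hf_sqrD] the energy is the same from any phase. *)
have G j : En (window A h (node p j)) eta = sample p 0 j ^+ 2 + sample p (pi / 2) j ^+ 2.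
  rewrite -(Hf_sqrD _ _ (2 * pi * dotp (node p j) eta + (0 - j%:R * (2 * pi * (tau * Rad))))).
  rewrite /sample; congr (_ + Hf _ _ _ ^+ 2); ring.
pose rem th := \int[mu n]_xi (remf 0 xi * cos (2 * pi * dotp p xi + th) +
                 remf (pi / 2) xi * sin (2 * pi * dotp p xi + th)).
have mph th : measurable_fun setT (fun xi => 2 * pi * dotp p xi + th) by exact: measurable_phase.
have FCE phi : FC phi p = \int[mu n]_xi (phi xi * cos (2 * pi * dotp p xi + 0)).
  by apply: eq_Rintegral => xi _; rewrite addr0 dotpC.
have FSE phi : FS phi p = \int[mu n]_xi (phi xi * sin (2 * pi * dotp p xi + 0)).
  by apply: eq_Rintegral => xi _; rewrite addr0 dotpC.
(* The sum [r0] and the difference [r1] play the parts of the real and imaginary part of the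
   remainder. *)
have r0 : rem 0 = FC (remf 0) p + FS (remf (pi / 2)) p.
  rewrite FCE FSE -RintegralD//; [exact: (integrable_cosM (remf_integrable _))|exact: (integrable_sinM (remf_integrable _))].
have r1 : rem (pi / 2) = FC (remf (pi / 2)) p - FS (remf 0) p.
  rewrite FCE FSE -RintegralB//; [|exact: (integrable_cosM (remf_integrable _))|exact: (integrable_sinM (remf_integrable _))].
  by apply: eq_Rintegral => xi _; rewrite cosDpihalf sinDpihalf addr0; ring.
have key th : sample p th m ^+ 2 <= \sum_(j < k) (2 * k%:R * ncoef j ^+ 2) * sample p th j ^+ 2 + 2 * rem th ^+ 2.
  rewrite sample_extrapolation -/(rem th) (le_trans (sqrD_le2 _ _))// lerD2r.
  rewrite (le_trans (ler_wpM2l _ (sqr_sum_le _)))// mulrA mulr_sumr.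
  by apply: ler_sum => j _; rewrite exprMn mulrA.
rewrite G (le_trans (lerD (key 0) (key (pi / 2))))//.
under [in leRHS]eq_bigr do rewrite G mulrDr.
rewrite big_split /= addrACA lerD2l r0 r1 /En.
have := sqrD_le2 (FC (remf 0) p) (FS (remf (pi / 2)) p).
have := sqrB_le2 (FC (remf (pi / 2)) p) (FS (remf 0) p); lra.
Qed.

End remainder.
Section recovery.
Variables (k M : nat) (U : set (n.-tuple R)).
Hypothesis mU : measurable U.

Let G x := En (window A h x) eta.
Let F x := \1_U x * G x.
Let base x m : n.-tuple R := tadd x (tscale (- (m%:R * tau)) e).

Hypothesis HU : forall x, exists2 m, (m <= M)%N & forall j, (j < k)%N -> U (node (base x m) j).

Definition stab m : R := \sum_(j < k) 2 * k%:R * ncoef k m j ^+ 2.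
Definition stability : R := \sum_(m < M.+1) stab m.

Lemma stab_ge0 m : 0 <= stab m.
Proof. by apply: sumr_ge0 => j _; rewrite mulr_ge0 ?sqr_ge0// mulr_ge0. Qed.

Let mG : measurable_fun setT G.
Proof. exact: (measurableT_comp (measurable_window_En A0 ih) (pair2_measurable eta)). Qed.

Let G0 x : 0 <= G x. Proof. exact: En_ge0. Qed.

Let mF : measurable_fun setT F.
Proof. by apply: measurable_funM => //; exact: measurable_indic. Qed.

Let F0 x : 0 <= F x. Proof. by rewrite mulr_ge0. Qed.

Let node_base x m : node (base x m) m = x.
Proof. by apply: eq_from_tnth => i; rewrite !tnth_mktuple mulNr subrK. Qed.

Let mbase m : measurable_fun setT (fun x => base x m).
Proof. exact: measurable_tadd. Qed.

Let mEn m t : measurable_fun setT (fun x => En (remf k m t) (base x m)).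
Proof. by apply: (measurableT_comp _ (mbase m)); apply: measurable_En; exact: remf_integrable. Qed.

Let T m x := \sum_(j < k) (2 * k%:R * ncoef k m j ^+ 2) * F (node (base x m) j) +
  4 * (En (remf k m 0) (base x m) + En (remf k m (pi / 2)) (base x m)).

Let mFn m (j : nat) : measurable_fun setT (fun x => F (node (base x m) j)).
Proof. by apply: (measurableT_comp mF); apply: measurable_tadd => //; exact: mbase. Qed.

Let mT m : measurable_fun setT (T m).
Proof.
apply: measurable_funD.
  by apply: measurable_sum => j; apply: measurable_funM => //; exact: mFn.
by apply: measurable_funM => //; apply: measurable_funD; exact: mEn.
Qed.

Let T0 m x : 0 <= T m x.
Proof.
rewrite addr_ge0//; last by rewrite mulr_ge0// addr_ge0// En_ge0.
by apply: sumr_ge0 => j _; rewrite mulr_ge0// mulr_ge0 ?sqr_ge0// mulr_ge0.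
Qed.

Let newton_energy m : \bar R :=
  (\int[mu n]_xi (q xi * newton_rem k m `|sigm xi| ^+ 2 * En h xi)%:E)%E.

(** Every node is a fixed translate of [x], so translation invariance makes all node terms equal to
    the integral of [F]. The 8 is the 4 of [sample_bound] for each of the two quadratures. *)
Let integral_T m : (\int[mu n]_x (T m x)%:E <=
  (stab m)%:E * \int[mu n]_x (F x)%:E + 8%:E * newton_energy m)%E.
Proof.
have c0 j : 0 <= 2 * k%:R * ncoef k m j ^+ 2 by rewrite mulr_ge0 ?sqr_ge0// mulr_ge0.
have IF j : (\int[mu n]_x (F (node (base x m) j))%:E = \int[mu n]_x (F x)%:E)%E.
  have mFE : measurable_fun setT (fun y => (F y)%:E) by exact/measurable_EFinP.
  have FE0 y : (0 <= (F y)%:E)%E by rewrite lee_fin.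
  have mFN : measurable_fun setT (fun y => (F (node y j))%:E).
    by apply: (measurableT_comp mFE); exact: measurable_tadd.
  rewrite -(ge0_integral_mu_shift (tscale (j%:R * tau) e) mFE FE0).
  by rewrite -(ge0_integral_mu_shift (tscale (- (m%:R * tau)) e) mFN (fun y => FE0 _)).
have IE t : (\int[mu n]_x (En (remf k m t) (base x m))%:E <= newton_energy m)%E.
  have mE : measurable_fun setT (fun y => (En (remf k m t) y)%:E).
    by apply/measurable_EFinP; apply: measurable_En; exact: remf_integrable.
  have E0 y : (0 <= (En (remf k m t) y)%:E)%E by rewrite lee_fin En_ge0.
  rewrite (ge0_integral_mu_shift (tscale (- (m%:R * tau)) e) mE E0).
  exact: integral_En_remf.
have mE t := mEn m t.
have E0 t x : 0 <= En (remf k m t) (base x m) by exact: En_ge0.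
have mc j : measurable_fun setT (fun x => (2 * k%:R * ncoef k m j ^+ 2) * F (node (base x m) j)).
  by apply: measurable_funM; [exact: measurable_cst|exact: mFn].
have cF0 j x : 0 <= (2 * k%:R * ncoef k m j ^+ 2) * F (node (base x m) j).
  by apply: mulr_ge0; [exact: c0|exact: F0].
have I1 : (\int[mu n]_x (\sum_(j < k) (2 * k%:R * ncoef k m j ^+ 2) * F (node (base x m) j))%:E =
    (stab m)%:E * \int[mu n]_x (F x)%:E)%E.
  rewrite (ge0_integral_EFin_sum (mu n) k mc cF0) /stab -sumEFin ge0_sume_distrl; last first.
    by move=> j _; rewrite lee_fin c0.
  apply: eq_bigr => j _; rewrite -(IF j).
  exact: (ge0_integral_EFinZ (mu n) (mFn m j) (fun x => F0 _) (c0 j)).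
have I2 : (\int[mu n]_x (4 * (En (remf k m 0) (base x m) + En (remf k m (pi / 2)) (base x m)))%:E =
    4%:E * (\int[mu n]_x (En (remf k m 0) (base x m))%:E + \int[mu n]_x (En (remf k m (pi / 2)) (base x m))%:E))%E.
  rewrite -(ge0_integral_EFinD (mu n) (mE _) (mE _) (E0 _) (E0 _)).
  apply: (ge0_integral_EFinZ (mu n) (measurable_funD (mE 0) (mE (pi / 2))) _ _) => [x|]; last by [].
  by apply: addr_ge0; exact: E0.
rewrite (ge0_integral_EFinD (mu n)); last 4 first.
- exact: measurable_sum.
- by apply: measurable_funM; [exact: measurable_cst|apply: measurable_funD; exact: mE].
- by move=> x; apply: sumr_ge0 => j _; exact: cF0.
- by move=> x; apply: mulr_ge0; [by []|apply: addr_ge0; exact: E0].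
rewrite I1 I2; apply: leeD2l.
have N0 : (0 <= newton_energy m)%E.
  by apply: integral_ge0 => xi _; rewrite lee_fin mulr_ge0 ?En_ge0// mulr_ge0// sqr_ge0.
have H8 (N : \bar R) : (0 <= N)%E -> (8%:E * N = 4%:E * (N + N))%E.
  move=> Nge0; rewrite ge0_muleDr// -[LHS]/((8%:E * N)%E) (_ : 8%:E = 4%:E + 4%:E)%E ?ge0_muleDl ?lee_fin//.
  by rewrite -EFinD; congr (_%:E); lra.
rewrite H8//.
by rewrite lee_wpmul2l// leeD.
Qed.

(** The step count [m] provided by [HU] depends on [x] with no measurability in [x]. Bounding by the
    sum over all [m <= M] of the nonnegative [T m] removes this dependence before integration. *)
Lemma extrapolation_energy : (\int[mu n]_x (G x)%:E <= stability%:E * \int[mu n]_x (F x)%:E +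
  8%:E * \sum_(m < M.+1) newton_energy m)%E.
Proof.
apply: (@le_trans _ _ (\int[mu n]_x (\sum_(m < M.+1) T m x)%:E)%E).
  apply: (ge0_le_integral_EFin (mu n) mG _ G0); first by apply: measurable_sum => m; exact: mT.
  move=> x; have [m mM Um] := HU x.
  have mM' : (m < M.+1)%N by [].
  rewrite (bigD1 (Ordinal mM'))//= (@le_trans _ _ (T m x))//; last first.
    by rewrite lerDl sumr_ge0// => i _; exact: T0.
  rewrite /G -[in leLHS](node_base x m) (le_trans (sample_bound k m (base x m)))//.
  rewrite /T lerD2r; apply: ler_sum => j _; rewrite /F indicE mem_set ?mul1r//.
  exact: Um.
rewrite (ge0_integral_EFin_sum (mu n) M.+1 mT T0).
apply: (@le_trans _ _ (\sum_(m < M.+1) ((stab m)%:E * \int[mu n]_x (F x)%:E + 8%:E * newton_energy m))%E).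
  by apply: lee_sum => m _; exact: integral_T.
have N0 m : (0 <= newton_energy m)%E.
  by apply: integral_ge0 => xi _; rewrite lee_fin mulr_ge0 ?En_ge0// mulr_ge0// sqr_ge0.
rewrite big_split /= (ge0_sume_distrr _ _ (fun (m : 'I_M.+1) _ => N0 m)) /stability -sumEFin ge0_sume_distrl//.
by move=> m _; rewrite lee_fin; exact: stab_ge0.
Qed.

Variables (b ell : R) (S : set (n.-tuple R)).
Hypotheses (mS : measurable S) (tau0 : 0 < tau) (b0 : 0 <= b) (Mell : M%:R * tau <= ell).
Hypothesis HS : forall xi, q xi != 0 -> S xi -> `|dotp e xi - Rad| <= b.

Let eps : R := (2^-1 ^+ k * expR (4 * pi * (ell * b))) ^+ 2.

(** On [S] the mismatch per step is at most [2 * pi * tau * b] and the [m] steps span at most [ell],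
    so the remainder is geometrically small in [k]. Off [S] the constant is crude but multiplies
    only the energy there. *)
Lemma newton_rem_split m xi : (m <= M)%N ->
  q xi * newton_rem k m `|sigm xi| ^+ 2 * En h xi <=
  eps * (q xi * En h xi) + (5 ^+ M) ^+ 2 * (\1_(~` S) xi * (q xi * En h xi)).
Proof.
move=> mM; have [q00|qn0] := eqVneq (q xi) 0; first by rewrite q00 !mul0r !mulr0 addr0.
have qE : 0 <= q xi * En h xi by rewrite mulr_ge0// En_ge0.
rewrite (_ : _ * _ * _ = newton_rem k m `|sigm xi| ^+ 2 * (q xi * En h xi)); last by ring.
have [Sxi|nS] := pselect (S xi).
  rewrite indicE memNset; last by move=> /(_ Sxi).
  rewrite mul0r mulr0 addr0 ler_wpM2r//.
  have r0 : 0 <= newton_rem k m `|sigm xi| by exact: newton_rem_ge0.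
  have e0 : 0 <= 2^-1 ^+ k * expR (4 * pi * (ell * b)) by rewrite mulr_ge0 ?expR_ge0.
  rewrite /eps lerXn2r ?nnegrE//.
  rewrite (le_trans (newton_rem_exp _ _ _))//; rewrite ler_wpM2l ?exprn_ge0 ?invr_ge0//.
  rewrite ler_expR; have sb : `|sigm xi| <= 2 * pi * (tau * b).
    rewrite (le_trans (sigma_le _))// /mism normrM ger0_norm ?mulr_ge0 ?pi_ge0//.
    rewrite ler_wpM2l ?mulr_ge0 ?pi_ge0// normrM (gtr0_norm tau0) ler_wpM2l ?(ltW tau0)//.
    exact: HS.
  have h1 : m%:R * `|sigm xi| <= m%:R * (2 * pi * (tau * b)) by rewrite ler_wpM2l.
  have h2 : m%:R * (2 * pi * (tau * b)) <= 2 * pi * (ell * b).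
    rewrite (_ : _ * _ = 2 * pi * (m%:R * tau * b)); last by ring.
    rewrite ler_wpM2l ?mulr_ge0 ?pi_ge0// ler_wpM2r// (le_trans _ Mell)// ler_wpM2r ?(ltW tau0)//.
    by rewrite ler_nat.
  rewrite (_ : 4 * pi * (ell * b) = 2 * (2 * pi * (ell * b))); last by ring.
  by rewrite ler_wpM2l// (le_trans h1).
rewrite indicE mem_set// mul1r (@le_trans _ _ ((5 ^+ M) ^+ 2 * (q xi * En h xi)))//.
  rewrite ler_wpM2r// lerXn2r ?nnegrE ?newton_rem_ge0 ?exprn_ge0//.
  rewrite (le_trans (newton_rem_le5 _ _ _ _))// ?sigma_le2// ler_weXn2l//.
  by rewrite ler1n.
by rewrite lerDr mulr_ge0// sqr_ge0.
Qed.

(** The [M + 1] remainder energies share the majorant of [newton_rem_split], hence the factor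
    [M.+1]. *)
Lemma recovery_eta : (\int[mu n]_x (G x)%:E <= stability%:E * \int[mu n]_x (F x)%:E +
  (8 * M.+1%:R)%:E * (eps%:E * \int[mu n]_xi (q xi * En h xi)%:E +
    ((5 ^+ M) ^+ 2)%:E * \int[mu n]_xi (\1_(~` S) xi * (q xi * En h xi))%:E))%E.
Proof.
have mqE : measurable_fun setT (fun xi => q xi * En h xi).
  by apply: measurable_funM => //; exact: measurable_En.
have qE xi : 0 <= q xi * En h xi by rewrite mulr_ge0// En_ge0.
have mSE : measurable_fun setT (fun xi => \1_(~` S) xi * (q xi * En h xi)).
  by apply: measurable_funM => //; apply: measurable_indic; exact: measurableC.
have SE xi : 0 <= \1_(~` S) xi * (q xi * En h xi) by rewrite mulr_ge0.
apply: (le_trans extrapolation_energy); rewrite leeD2l// EFinM -muleA lee_wpmul2l ?lee_fin//.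
set Z := (X in (_ <= _ * X)%E).
have -> : (M.+1%:R%:E * Z = \sum_(m < M.+1) Z)%E.
  by rewrite mule_natl sumr_const card_ord.
apply: lee_sum => m _; rewrite {}/Z.
have e0 : 0 <= eps by exact: sqr_ge0.
have f0 : 0 <= (5 ^+ M) ^+ 2 :> R by exact: sqr_ge0.
rewrite -(ge0_integral_EFinZ (mu n) mqE qE e0) -(ge0_integral_EFinZ (mu n) mSE SE f0).
rewrite -(ge0_integral_EFinD (mu n)); last 4 first.
- by apply: measurable_funM; [exact: measurable_cst|exact: mqE].
- by apply: measurable_funM; [exact: measurable_cst|exact: mSE].
- by move=> xi; apply: mulr_ge0.
- by move=> xi; apply: mulr_ge0.
apply: ge0_le_integral_EFin.
- apply: measurable_funM; last exact: measurable_En.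
  by apply: measurable_funM => //; apply: measurable_funX; exact: measurable_newton_rem.
- apply: measurable_funD; apply: measurable_funM; [exact: measurable_cst|exact: mqE|exact: measurable_cst|exact: mSE].
- by move=> xi; apply: mulr_ge0; [apply: mulr_ge0; [exact: q0|exact: sqr_ge0]|exact: En_ge0].
move=> xi; apply: newton_rem_split.
by rewrite -ltnS.
Qed.

End recovery.
End Extrapolation.

(** * Energy and tail of the sinc kernel *)

Section KernelEnergy.
Variable R : realType.
Variable A : R.
Hypothesis A0 : 0 < A.

Lemma integral_boxw : (\int[leb]_x (boxw A x)%:E = A%:E)%E.
Proof.
have b0 : \int[leb]_x (boxw A x * cos (0 * x + 0)) = A.
  by rewrite Rintegral_boxw_cos// cos0 mulr1 /boxk eqxx.
rewrite -[in RHS]b0 EFin_Rintegral.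
  by apply: eq_integral => x _; rewrite mul0r addr0 cos0 mulr1.
have := boxw_integrable A; apply: eq_integrable => // x _ /=.
by rewrite mul0r addr0 cos0 mulr1.
Qed.

Lemma integral_qbox n : (\int[mu n]_xi (qbox A xi)%:E = (A ^+ n)%:E)%E.
Proof. exact: (ge0_integral_tprod n (measurable_boxw A) (boxw_ge0 A) integral_boxw). Qed.

Lemma En_qbox n (z : n.-tuple R) : En (@qbox R n A) z = kbox A z ^+ 2.
Proof.
have E th := Rintegral_tprod_cos (boxw_ge0 A) (boxw_integrable A) (kbox1E A0) z th.
have Ec : FC (@qbox R n A) z = kbox A z.
  have := E 0; rewrite cos0 mulr1 -/(kbox A z) => <-.
  by apply: eq_Rintegral => xi _; rewrite (dotpC xi z) addr0.
have Es : FS (@qbox R n A) z = 0.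
  (* Phase [- pi / 2] turns the cosine formula into the sine integral, which is 0 since the cube is
     symmetric. *)
  have := E (- (pi / 2)); rewrite cosN cos_pihalf mulr0 => <-.
  apply: eq_Rintegral => xi _; rewrite (dotpC xi z); congr (_ * _).
  by rewrite cosB cos_pihalf sin_pihalf mulr0 add0r mulr1.
by rewrite /En Ec Es expr0n addr0.
Qed.

(** Plancherel for the indicator of the cube, in place of a direct integration of the squared sinc.
    Dimension 1 then yields the mass needed for the tail bound. *)
Lemma integral_kbox_sqr n : (\int[mu n]_z (kbox A z ^+ 2)%:E = (A ^+ n)%:E)%E.
Proof.
under eq_integral do rewrite -En_qbox.
have L2 : L2e (mu n) (@qbox R n A) = (A ^+ n)%:E.
  by rewrite -integral_qbox; apply: eq_integral => xi _; rewrite qbox_sqr.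
by rewrite plancherel//; [exact: integrable_qbox|rewrite L2 ltry].
Qed.

Lemma measurable_kbox1 : measurable_fun setT (kbox1 A).
Proof. exact: (measurable_kernel (boxw_integrable A) (kbox1E A0)). Qed.

Lemma kbox_sqrE n (z : n.-tuple R) : kbox A z ^+ 2 = tprod (fun t => kbox1 A t ^+ 2) z.
Proof. by rewrite /tprod prodrXl. Qed.

Lemma integral_kbox1_sqr : (\int[leb]_t (kbox1 A t ^+ 2)%:E = A%:E)%E.
Proof.
have := @integral_kbox_sqr 1; under eq_integral do rewrite kbox_sqrE /tprod.
rewrite (ge0_integral_tensor (w := fun _ t => kbox1 A t ^+ 2)).
- by rewrite big_ord1 expr1.
- by move=> i; apply: measurable_funX; exact: measurable_kbox1.
- by move=> i x; exact: sqr_ge0.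
Qed.

Lemma kbox1_sqr_le t : t != 0 -> kbox1 A t ^+ 2 <= pi ^- 2 * t ^- 2.
Proof.
move=> t0; have p0 : (pi : R) != 0 by rewrite gt_eqF// pi_gt0.
rewrite /kbox1 /boxk !mulf_eq0 (negbTE t0) (negbTE p0) (_ : 2 == 0 = false) ?pnatr_eq0//=.
have s1 : sin (2 * pi * t * (A / 2)) ^+ 2 <= 1 by have := cos2Dsin2 (2 * pi * t * (A / 2)); have := sqr_ge0 (cos (2 * pi * t * (A / 2))); lra.
rewrite (_ : _ ^+ 2 = sin (2 * pi * t * (A / 2)) ^+ 2 * (pi ^- 2 * t ^- 2)).
  by rewrite ler_piMl// mulr_ge0// invr_ge0 sqr_ge0.
move: (sin _) p0 => s; move: (pi : R) => p p0; by field; rewrite t0 p0.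
Qed.

Lemma integral_kbox_far_le n r : 0 < r ->
  (\int[mu n]_z (\1_(@far R n r) z * kbox A z ^+ 2)%:E <=
   (n%:R * (A ^+ n.-1 * (2 * (pi ^- 2 / r))))%:E)%E.
Proof.
move=> r0.
apply: le_trans (@integral_tprod_far_le _ n (fun t => kbox1 A t ^+ 2) A (pi ^- 2) r _ _ _ _ r0 _).
- by under eq_integral do rewrite kbox_sqrE EFinM.
- by apply: measurable_funX; exact: measurable_kbox1.
- by move=> x; exact: sqr_ge0.
- exact: integral_kbox1_sqr.
- by rewrite invr_ge0 sqr_ge0.
- by move=> x rx; apply: kbox1_sqr_le; rewrite -normr_gt0 (lt_le_trans r0).
Qed.

End KernelEnergy.

(** * Integration over positions and cube centres *)

Section WindowEnergy.
Variable R : realType.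
Variables (n : nat) (A : R).
Hypothesis A0 : 0 < A.
Variable h : n.-tuple R -> R.
Hypothesis ih : (mu n).-integrable setT (EFin \o h).
Hypothesis h2 : (L2e (mu n) h < +oo)%E.

Let mh : measurable_fun setT h.
Proof. by case/integrableP: ih => /measurable_EFinP. Qed.

(** For each [x], Plancherel is applied to the window as a function of [y], and Tonelli collects the
    kernel mass seen from [y]. *)
Lemma window_energy (U : set (n.-tuple R)) : measurable U ->
  (\int[mu n]_eta \int[mu n]_x (\1_U x * En (window A h x) eta)%:E =
   \int[mu n]_y ((h y ^+ 2)%:E * \int[mu n]_x (\1_U x * kbox A (tsub x y) ^+ 2)%:E))%E.
Proof.
move=> mU.
have mk (z : n.-tuple R) : measurable_fun setT (fun y => kbox A (tsub z y) ^+ 2).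
  by apply: measurable_funX; apply: (measurable_kbox A0); exact: measurable_tsub.
have mk2 (z : n.-tuple R) : measurable_fun setT (fun x => \1_U x * kbox A (tsub x z) ^+ 2).
  apply: measurable_funM; first exact: measurable_indic.
  by apply: measurable_funX; apply: (measurable_kbox A0); exact: measurable_tsub.
rewrite -(fubini_tonelli (m1 := mu n) (m2 := mu n) (fun p => (\1_U p.1 * En (window A h p.1) p.2)%:E)); last 2 first.
- apply/measurable_EFinP; apply: measurable_funM; last exact: measurable_window_En.
  by apply: (measurableT_comp _ measurable_fst); exact: measurable_indic.
- by move=> x; rewrite lee_fin mulr_ge0// En_ge0.
transitivity (\int[mu n]_x \int[mu n]_y (h y ^+ 2 * (\1_U x * kbox A (tsub x y) ^+ 2))%:E)%E.
  apply: eq_integral => x _ /=.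
  have mE : measurable_fun setT (fun eta => En (window A h x) eta).
    by apply: measurable_En; exact: integrable_window.
  rewrite (ge0_integral_EFinZ (mu n) mE (En_ge0 _))//.
  have mw : measurable_fun setT (fun y => window A h x y ^+ 2).
    by apply: measurable_funX; exact: measurable_window.
  rewrite plancherel; last 2 first.
  - exact: integrable_window.
  - have [B B0 kB] := kbox_bounded n A0.
    apply: (@le_lt_trans _ _ (\int[mu n]_y (B ^+ 2 * h y ^+ 2)%:E)%E).
      apply: (ge0_le_integral_EFin (mu n) mw) => [|y|y].
      - by apply: measurable_funM => //; exact: measurable_funX.
      - exact: sqr_ge0.
      rewrite exprMn mulrC ler_wpM2r ?sqr_ge0// -[leLHS]real_normK ?num_real//.
      by rewrite lerXn2r ?nnegrE.
    rewrite ge0_integral_EFinZ ?sqr_ge0//; last 2 first.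
    - exact: measurable_funX.
    - by move=> y; exact: sqr_ge0.
    by rewrite lte_mul_pinfty ?lee_fin ?sqr_ge0.
  rewrite /L2e -(ge0_integral_EFinZ (mu n) mw (fun=> sqr_ge0 _))//.
  by apply: eq_integral => y _; rewrite /window exprMn mulrCA mulrA.
rewrite (fubini_tonelli (m1 := mu n) (m2 := mu n) (fun p => (h p.2 ^+ 2 * (\1_U p.1 * kbox A (tsub p.1 p.2) ^+ 2))%:E)); last 2 first.
- apply/measurable_EFinP; apply: measurable_funM.
    by apply: measurable_funX; exact: (measurableT_comp mh).
  apply: measurable_funM; first by apply: (measurableT_comp _ measurable_fst); exact: measurable_indic.
  by apply: measurable_funX; apply: (measurable_kbox A0); exact: measurable_tsub.
- by move=> x; rewrite lee_fin mulr_ge0 ?sqr_ge0// mulr_ge0// sqr_ge0.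
apply: eq_integral => y _ /=; rewrite ge0_integral_EFinZ ?sqr_ge0//.
by move=> x; rewrite mulr_ge0 ?sqr_ge0.
Qed.

Let integral_kbox_sqr_subl (y : n.-tuple R) : (\int[mu n]_x (kbox A (tsub x y) ^+ 2)%:E = (A ^+ n)%:E)%E.
Proof.
rewrite -(integral_kbox_sqr A0 n) (ge0_integral_mu_subl y (f := fun z => (kbox A z ^+ 2)%:E))//.
- apply/measurable_EFinP; apply: measurable_funX; exact: (measurable_kbox (f := id) A0).
- by move=> z; rewrite lee_fin sqr_ge0.
Qed.

Lemma window_energyT :
  (\int[mu n]_eta \int[mu n]_x (En (window A h x) eta)%:E = (A ^+ n)%:E * L2e (mu n) h)%E.
Proof.
have := window_energy measurableT; under eq_integral do under eq_integral do rewrite indicT mul1r.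
move=> ->; under eq_integral => y _.
  rewrite (_ : integral _ _ _ = (A ^+ n)%:E); last first.
    by rewrite -(integral_kbox_sqr_subl y); apply: eq_integral => x _; rewrite indicT mul1r.
  rewrite -EFinM mulrC; over.
rewrite ge0_integral_EFinZ ?exprn_ge0 ?(ltW A0)//; first exact: measurable_funX.
by move=> y; exact: sqr_ge0.
Qed.

(** A point [y] of [V] receives at most the full kernel mass [A ^+ n]. From any other [y] all of [U]
    is far, so only the tail of the kernel counts. *)
Lemma window_energy_le (U V : set (n.-tuple R)) r : measurable U -> measurable V -> 0 < r ->
  (forall x y, U x -> ~ V y -> far r (tsub x y)) ->
  (\int[mu n]_eta \int[mu n]_x (\1_U x * En (window A h x) eta)%:E <=
   (A ^+ n)%:E * \int[mu n]_y (\1_V y * h y ^+ 2)%:E +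
   (n%:R * (A ^+ n.-1 * (2 * (pi ^- 2 / r))))%:E * L2e (mu n) h)%E.
Proof.
move=> mU mV r0 UV; rewrite window_energy//.
set c := n%:R * _.
have c0 : 0 <= c.
  by rewrite mulr_ge0// mulr_ge0 ?exprn_ge0 ?(ltW A0)// mulr_ge0// divr_ge0 ?(ltW r0)// invr_ge0 sqr_ge0.
have An0 : 0 <= A ^+ n by rewrite exprn_ge0// ltW.
have mh2 : measurable_fun setT (fun y => h y ^+ 2) by exact: measurable_funX.
have mVh : measurable_fun setT (fun y => \1_V y * h y ^+ 2).
  by apply: measurable_funM => //; exact: measurable_indic.
have mk (y : n.-tuple R) : measurable_fun setT (fun x => kbox A (tsub x y) ^+ 2).
  by apply: measurable_funX; apply: (measurable_kbox A0); exact: measurable_tsub.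
rewrite /L2e -!ge0_integral_EFinZ//; last 2 first.
- by move=> y; exact: sqr_ge0.
- by move=> y; rewrite mulr_ge0 ?sqr_ge0.
rewrite -ge0_integral_EFinD; last 4 first.
- exact: measurable_funM.
- exact: measurable_funM.
- by move=> y; rewrite mulr_ge0// mulr_ge0 ?sqr_ge0.
- by move=> y; rewrite mulr_ge0 ?sqr_ge0.
apply: ge0_le_integral => //.
- move=> y _; apply: mule_ge0; first by rewrite lee_fin sqr_ge0.
  by apply: integral_ge0 => x _; rewrite lee_fin mulr_ge0 ?sqr_ge0.
- apply: emeasurable_funM; first exact/measurable_EFinP.
  apply: (measurable_integral_EFin (mu n) (k := fun p => \1_U p.1 * kbox A (tsub p.1 p.2) ^+ 2)).
    apply: measurable_funM; first by apply: (measurableT_comp _ measurable_fst); exact: measurable_indic.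
    by apply: measurable_funX; apply: (measurable_kbox A0); exact: measurable_tsub.
  by move=> x; rewrite mulr_ge0 ?sqr_ge0.
- by apply/measurable_EFinP; apply: measurable_funD; apply: measurable_funM.
move=> y _; rewrite (_ : _ + _ = h y ^+ 2 * (A ^+ n * \1_V y + c)); last by ring.
rewrite [in leRHS]EFinM; apply: lee_wpmul2l; first by rewrite lee_fin sqr_ge0.
have [Vy|nVy] := pselect (V y).
  rewrite indicE mem_set// mulr1 (@le_trans _ _ (A ^+ n)%:E)//; last by rewrite lee_fin lerDl.
  rewrite -(integral_kbox_sqr_subl y).
  apply: (ge0_le_integral_EFin (mu n) _ (mk y)) => [|x|x].
  - by apply: measurable_funM; [exact: measurable_indic|exact: mk].
  - by rewrite mulr_ge0 ?sqr_ge0.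
  - by rewrite indicM_le ?sqr_ge0.
rewrite indicE memNset// mulr0 add0r.
apply: le_trans (integral_kbox_far_le A0 n r0).
have mf : measurable_fun setT (fun z : n.-tuple R => \1_(@far R n r) z * kbox A z ^+ 2).
  apply: measurable_funM; first exact: measurable_indic (measurable_far _).
  by apply: measurable_funX; exact: (measurable_kbox (f := id) A0).
rewrite -(ge0_integral_mu_subl y (f := fun z => (\1_(@far R n r) z * kbox A z ^+ 2)%:E)); last 2 first.
- exact/measurable_EFinP.
- by move=> z; rewrite lee_fin mulr_ge0 ?sqr_ge0.
apply: (ge0_le_integral_EFin (mu n)) => [||x|x].
- by apply: measurable_funM; [exact: measurable_indic|exact: mk].
- by apply: (measurableT_comp mf); exact: measurable_tsub.
- by rewrite mulr_ge0 ?sqr_ge0.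
rewrite ler_wpM2r ?sqr_ge0// !indicE ler_nat.
case: (boolP (x \in U)) => //; rewrite inE => Ux.
by rewrite mem_set//; exact: UV.
Qed.

(** Each frequency belongs to the cubes whose centre ranges over a set of volume [A ^+ n]. *)
Lemma integral_box_average (g : n.-tuple R -> R) : measurable_fun setT g -> (forall xi, 0 <= g xi) ->
  (\int[mu n]_eta \int[mu n]_xi (qbox A (tsub xi eta) * g xi)%:E = (A ^+ n)%:E * \int[mu n]_xi (g xi)%:E)%E.
Proof.
move=> mg g0.
have mq : measurable_fun setT (fun p : n.-tuple R * n.-tuple R => qbox A (tsub p.2 p.1)).
  by apply: measurable_qbox; exact: measurable_tsub.
rewrite (fubini_tonelli (m1 := mu n) (m2 := mu n) (fun p => (qbox A (tsub p.2 p.1) * g p.2)%:E)); last 2 first.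
- by apply/measurable_EFinP; apply: measurable_funM => //; exact: (measurableT_comp mg).
- by move=> x; rewrite lee_fin mulr_ge0// qbox_ge0.
rewrite -ge0_integral_EFinZ ?exprn_ge0 ?(ltW A0)//; apply: eq_integral => xi _ /=.
under eq_integral do rewrite mulrC.
rewrite ge0_integral_EFinZ//; last 2 first.
- by apply: measurable_qbox; exact: measurable_tsub.
- by move=> eta; exact: qbox_ge0.
rewrite (ge0_integral_mu_subr xi (f := fun z => (qbox A z)%:E)); last 2 first.
- by apply/measurable_EFinP; exact: (measurable_qbox (f := id) A).
- by move=> z; rewrite lee_fin qbox_ge0.
by rewrite integral_qbox// -EFinM mulrC.
Qed.

End WindowEnergy.

Lemma ge0_integral_le_lincomb d (T : measurableType d) (R : realType) (m : {measure set T -> \bar R})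
    (g J P Q : T -> \bar R) (s c e f : R) :
  measurable_fun setT g -> measurable_fun setT J -> measurable_fun setT P -> measurable_fun setT Q ->
  (forall x, 0 <= g x)%E -> (forall x, 0 <= J x)%E -> (forall x, 0 <= P x)%E -> (forall x, 0 <= Q x)%E ->
  0 <= s -> 0 <= c -> 0 <= e -> 0 <= f ->
  (forall x, g x <= s%:E * J x + c%:E * (e%:E * P x + f%:E * Q x))%E ->
  (\int[m]_x g x <= s%:E * \int[m]_x J x + c%:E * (e%:E * \int[m]_x P x + f%:E * \int[m]_x Q x))%E.
Proof.
move=> mg mJ mP mQ g0 J0 P0 Q0 s0 c0 e0 f0 H.
have mZ (a : R) (F : T -> \bar R) : measurable_fun setT F -> measurable_fun setT (fun x => a%:E * F x)%E.
  by move=> mF; exact: emeasurable_funM.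
have Z0 (a : R) (F : T -> \bar R) : 0 <= a -> (forall x, 0 <= F x)%E -> (forall x : T, 0 <= a%:E * F x)%E.
  by move=> a0 F0 x; rewrite mule_ge0// lee_fin.
have IZ (a : R) (F : T -> \bar R) : measurable_fun setT F -> 0 <= a -> (forall x, 0 <= F x)%E ->
    (\int[m]_x (a%:E * F x) = a%:E * \int[m]_x F x)%E.
  by move=> mF a0 F0; rewrite ge0_integralZl.
have mD (F G : T -> \bar R) : measurable_fun setT F -> measurable_fun setT G -> measurable_fun setT (fun x => F x + G x)%E.
  by move=> mF mG; exact: emeasurable_funD.
have ID (F G : T -> \bar R) : measurable_fun setT F -> measurable_fun setT G -> (forall x, 0 <= F x)%E -> (forall x, 0 <= G x)%E ->
    (\int[m]_x (F x + G x) = \int[m]_x F x + \int[m]_x G x)%E.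
  by move=> mF mG F0 G0; rewrite ge0_integralD.
have mPQ := mD _ _ (mZ e P mP) (mZ f Q mQ).
have PQ0 x : (0 <= e%:E * P x + f%:E * Q x)%E by rewrite adde_ge0//; exact: Z0.
rewrite -(IZ _ _ mP e0 P0) -(IZ _ _ mQ f0 Q0) -(ID _ _ (mZ _ _ mP) (mZ _ _ mQ) (Z0 _ _ e0 P0) (Z0 _ _ f0 Q0)).
rewrite -(IZ _ _ mJ s0 J0) -(IZ _ _ mPQ c0 PQ0) -(ID _ _ (mZ _ _ mJ) (mZ _ _ mPQ) (Z0 _ _ s0 J0) (Z0 _ _ c0 PQ0)).
apply: ge0_le_integral => //; exact: mD (mZ _ _ mJ) (mZ _ _ mPQ).
Qed.

(** The extrapolation error and the kernel tail each consume a quarter of [a * i]; the half that is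
    left accounts for the factors 2 in the conclusion. *)
Lemma absorb_error (R : realType) (a s t c e f i v o : R) (J P Q : \bar R) :
  0 < a -> 0 <= s -> 0 <= i ->
  (a%:E * i%:E <= s%:E * J + c%:E * (e%:E * P + f%:E * Q))%E ->
  (J <= a%:E * v%:E + t%:E * i%:E)%E -> P = (a%:E * i%:E)%E -> Q = (a%:E * o%:E)%E ->
  c * e <= 1 / 4 -> s * t <= a / 4 -> i <= 2 * s * v + 2 * c * f * o.
Proof.
move=> a0 s0 i0 H1 HJ P1 Q1 ce st; rewrite {P}P1 {Q}Q1 in H1.
have : (a%:E * i%:E <= s%:E * (a%:E * v%:E + t%:E * i%:E) + c%:E * (e%:E * (a%:E * i%:E) + f%:E * (a%:E * o%:E)))%E.
  by apply: (le_trans H1); rewrite leeD2r// lee_wpmul2l ?lee_fin.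
rewrite -?(EFinM, EFinD) lee_fin => H.
have t1 : s * t * i <= a / 4 * i by rewrite ler_wpM2r.
have t2 : c * e * (a * i) <= 1 / 4 * (a * i) by rewrite ler_wpM2r// mulr_ge0// ltW.
by rewrite -(ler_pM2l a0); lra.
Qed.

(** * Absorption of the errors and uniform constants *)

Section Recovery.
Variable R : realType.
Variables (n : nat).

Lemma recovery (A tau b ell Rad r : R) (k M : nat) (S U V : set (n.-tuple R)) (h : n.-tuple R -> R) :
  0 < A -> 0 < tau -> 0 <= b -> 0 < r -> M%:R * tau <= ell ->
  measurable S -> measurable U -> measurable V ->
  (forall x y, U x -> ~ V y -> far r (tsub x y)) ->
  (forall eta, exists2 e, enorm e = 1 &
    forall xi, (forall i, `|tnth xi i - tnth eta i| <= A / 2) -> S xi -> `|dotp e xi - Rad| <= b) ->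
  (forall e x, enorm e = 1 -> exists2 m, (m <= M)%N &
    forall j, (j < k)%N -> U (node e tau (tadd x (tscale (- (m%:R * tau)) e)) j)) ->
  8 * M.+1%:R * (2^-1 ^+ k * expR (4 * pi * (ell * b))) ^+ 2 <= 1 / 4 ->
  stability R k M * (n%:R * (A ^+ n.-1 * (2 * (pi ^- 2 / r)))) <= A ^+ n / 4 ->
  (mu n).-integrable setT (EFin \o h) -> (L2e (mu n) h < +oo)%E ->
  (L2e (mu n) h <= (2 * stability R k M)%:E * \int[mu n]_y (\1_V y * h y ^+ 2)%:E +
    (16 * M.+1%:R * (5 ^+ M) ^+ 2)%:E * \int[mu n]_xi (\1_(~` S) xi * En h xi)%:E)%E.
Proof.
move=> A0 tau0 b0 r0 Mell mS mU mV UV dir nodes eps_small tail_small ih h2.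
set eps := _ ^+ 2 in eps_small; set tail := n%:R * _ in tail_small.
have mh : measurable_fun setT h by case/integrableP: ih => /measurable_EFinP.
have mE := measurable_En ih.
have mSE : measurable_fun setT (fun xi => \1_(~` S) xi * En h xi).
  by apply: measurable_funM => //; apply: measurable_indic; exact: measurableC.
have SE0 xi : 0 <= \1_(~` S) xi * En h xi by rewrite mulr_ge0// En_ge0.
have st0 : 0 <= stability R k M by apply: sumr_ge0 => m _; exact: stab_ge0.
have eps0 : 0 <= eps by exact: sqr_ge0.
pose J eta := (\int[mu n]_x (\1_U x * En (window A h x) eta)%:E)%E.
pose P eta := (\int[mu n]_xi (qbox A (tsub xi eta) * En h xi)%:E)%E.
pose Q eta := (\int[mu n]_xi (qbox A (tsub xi eta) * (\1_(~` S) xi * En h xi))%:E)%E.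
have mq : measurable_fun setT (fun p : n.-tuple R * n.-tuple R => qbox A (tsub p.1 p.2)).
  by apply: measurable_qbox; exact: measurable_tsub.
have mw := measurable_window_En A0 ih.
have mJ : measurable_fun setT J.
  apply: (measurable_integral_EFin (mu n) (k := fun p => \1_U p.1 * En (window A h p.1) p.2)) => [|p].
    by apply: measurable_funM => //; apply: (measurableT_comp _ measurable_fst); exact: measurable_indic.
  by rewrite mulr_ge0// En_ge0.
have mP : measurable_fun setT P.
  apply: (measurable_integral_EFin (mu n) (k := fun p => qbox A (tsub p.1 p.2) * En h p.1)) => [|p].
    by apply: measurable_funM => //; exact: (measurableT_comp mE).
  by rewrite mulr_ge0 ?En_ge0// qbox_ge0.
have mQ : measurable_fun setT Q.
  apply: (measurable_integral_EFin (mu n) (k := fun p => qbox A (tsub p.1 p.2) * (\1_(~` S) p.1 * En h p.1))) => [|p].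
    by apply: measurable_funM => //; exact: (measurableT_comp mSE).
  by rewrite mulr_ge0 ?qbox_ge0.
have J0 eta : (0 <= J eta)%E.
  by apply: integral_ge0 => x _; rewrite lee_fin mulr_ge0// En_ge0.
have P0 eta : (0 <= P eta)%E.
  by apply: integral_ge0 => x _; rewrite lee_fin mulr_ge0 ?En_ge0// qbox_ge0.
have Q0 eta : (0 <= Q eta)%E.
  by apply: integral_ge0 => x _; rewrite lee_fin mulr_ge0 ?qbox_ge0.
have f0 : 0 <= (5 ^+ M) ^+ 2 :> R by exact: sqr_ge0.
have pointwise eta : (\int[mu n]_x (En (window A h x) eta)%:E <=
    (stability R k M)%:E * J eta + (8 * M.+1%:R)%:E * (eps%:E * P eta + ((5 ^+ M) ^+ 2)%:E * Q eta))%E.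
  have [e e1 He] := dir eta.
  have HS xi : qbox A (tsub xi eta) != 0 -> S xi -> `|dotp e xi - Rad| <= b.
    by move=> qxi; apply: He => i; have := qbox_neq0 i qxi; rewrite tnth_mktuple.
  apply: le_trans (recovery_eta A0 ih mU (fun x => nodes e x e1) mS tau0 b0 Mell HS) _.
  rewrite leeD2l// lee_wpmul2l ?lee_fin// leeD2l// lee_wpmul2l ?lee_fin//.
  by rewrite le_eqVlt; apply/orP; left; apply/eqP/eq_integral => xi _; rewrite mulrCA.
have I1 : ((A ^+ n)%:E * L2e (mu n) h <= (stability R k M)%:E * \int[mu n]_eta J eta +
    (8 * M.+1%:R)%:E * (eps%:E * \int[mu n]_eta P eta + ((5 ^+ M) ^+ 2)%:E * \int[mu n]_eta Q eta))%E.
  have mg : measurable_fun setT (fun eta => \int[mu n]_x (En (window A h x) eta)%:E)%E.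
    by apply: (measurable_integral_EFin (mu n) (k := fun p => En (window A h p.1) p.2)) => // p; exact: En_ge0.
  have g0 eta : (0 <= \int[mu n]_x (En (window A h x) eta)%:E)%E.
    by apply: integral_ge0 => x _; rewrite lee_fin En_ge0.
  have M0 : 0 <= 8 * M.+1%:R :> R by rewrite mulr_ge0.
  rewrite -(window_energyT A0 ih h2).
  exact: (ge0_integral_le_lincomb (mu n) mg mJ mP mQ g0 J0 P0 Q0 st0 M0 eps0 f0 pointwise).
have IJ : (\int[mu n]_eta J eta <= (A ^+ n)%:E * \int[mu n]_y (\1_V y * h y ^+ 2)%:E + tail%:E * L2e (mu n) h)%E.
  exact: window_energy_le.
have IP : (\int[mu n]_eta P eta = (A ^+ n)%:E * L2e (mu n) h)%E.
  by rewrite /P integral_box_average// ?plancherel// => xi; exact: En_ge0.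
have IQ : (\int[mu n]_eta Q eta = (A ^+ n)%:E * \int[mu n]_xi (\1_(~` S) xi * En h xi)%:E)%E.
  by rewrite /Q integral_box_average.
set v := (\int[mu n]_y (\1_V y * h y ^+ 2)%:E)%E in IJ *.
set o := (\int[mu n]_xi (\1_(~` S) xi * En h xi)%:E)%E in IQ *.
have vle : (v <= L2e (mu n) h)%E.
  apply: ge0_le_integral_EFin.
  - by apply: measurable_funM; [exact: measurable_indic|exact: measurable_funX].
  - exact: measurable_funX.
  - by move=> y; rewrite mulr_ge0 ?sqr_ge0.
  - by move=> y; rewrite indicM_le ?sqr_ge0.
have ole : (o <= L2e (mu n) h)%E.
  rewrite -plancherel//; apply: ge0_le_integral_EFin => // xi.
  by rewrite indicM_le ?En_ge0.
have v0 : (0 <= v)%E by apply: integral_ge0 => y _; rewrite lee_fin mulr_ge0 ?sqr_ge0.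
have o0 : (0 <= o)%E by apply: integral_ge0 => xi _; rewrite lee_fin.
(* Absorption subtracts multiples of the energy, so everything is first seen to be finite and turned
   into real numbers. *)
move: (le_lt_trans vle h2) (le_lt_trans ole h2) (h2) v0 o0 (L2e_ge0 (mu n) h) I1 IJ IP IQ.
case: v vle => [v||] // _; case: o ole => [ o||] // _; case: (L2e (mu n) h) => [i||] // _ _ _.
rewrite !lee_fin => v0 o0 i0 I1 IJ IP IQ.
have An0 : 0 < A ^+ n by rewrite exprn_gt0.
rewrite (_ : 16 * M.+1%:R = 2 * (8 * M.+1%:R)); last by ring.
exact: (absorb_error An0 st0 i0 I1 IJ IP IQ eps_small tail_small).
Qed.

End Recovery.

Section UniformEstimate.
Variables (R : realType) (n : nat).

Let rem_small (M q s X : R) : 0 <= q -> M * q <= s -> s * X ^+ 2 * q <= 1 / 32 ->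
  8 * M * (q * X) ^+ 2 <= 1 / 4.
Proof.
move=> q0 t1 t2; have : M * q * (q * X ^+ 2) <= s * (q * X ^+ 2).
  by rewrite ler_wpM2r// mulr_ge0// sqr_ge0.
lra.
Qed.

(** Finer nodes mean more steps: the step count grows linearly with [k], the squared remainder
    decays like [4 ^ (- k)]. One factor [2 ^ (- k)] pays for the steps and the other makes the
    product small. *)
Lemma exists_nodes (ell r b : R) : 0 < ell -> 0 < r ->
  exists2 k : nat, (0 < k)%N &
    8 * (Num.truncn (ell / (r / k%:R))).+1%:R * (2^-1 ^+ k * expR (4 * pi * (ell * b))) ^+ 2 <= 1 / 4.
Proof.
move=> l0 r0; set X := expR _; have X0 : 0 < X by exact: expR_gt0.
have lr : 0 < ell / r by rewrite divr_gt0.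
(* The 32 is 8 times 4, from the prefactor and the target 1/4; [k <= 2 ^+ k] turns [Y <= k] into the
   required bound. *)
pose Y := 32 * (ell / r + 1) * X ^+ 2.
have Y0 : 0 <= Y by rewrite mulr_ge0 ?sqr_ge0// mulr_ge0// addr_ge0// ltW.
pose k := (Num.truncn Y).+1; exists k => //.
have k0 : 0 < k%:R :> R by rewrite ltr0n.
have Yk : Y <= k%:R by have /andP[_ /ltW] := truncn_itv Y0.
have p0 : 0 < 2 ^+ k :> R by rewrite exprn_gt0.
have kp : k%:R <= 2 ^+ k :> R by rewrite -natrX ler_nat ltnW// ltn_expl.
have p1 : 1 <= 2 ^+ k :> R by rewrite exprn_ege1// ler1n.
have e0 : 0 <= ell / (r / k%:R) by rewrite divr_ge0 ?divr_ge0 ?(ltW l0) ?(ltW r0).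
have M1 : (Num.truncn (ell / (r / k%:R))).+1%:R <= (ell / r + 1) * 2 ^+ k.
  have /andP[H _] := truncn_itv e0; rewrite -natr1 mulrDl mul1r lerD// (le_trans H)//.
  by rewrite invf_div mulrA -mulrAC ler_wpM2l// ltW.
rewrite exprVn; apply: (rem_small (s := ell / r + 1)).
- by rewrite invr_ge0 ltW.
- by rewrite ler_pdivrMr.
- rewrite ler_pdivrMr//; move: (le_trans Yk kp); rewrite /Y => H.
  by rewrite div1r ler_pdivlMl// mulrA.
Qed.

Lemma measurable_enorm d (T : measurableType d) (f : T -> n.-tuple R) :
  measurable_fun setT f -> measurable_fun setT (fun t => enorm (f t)).
Proof.
move=> mf; apply: (measurableT_comp (f := @Num.sqrt R)); last exact: measurable_dotp.
by apply: continuous_measurable_fun => x; exact: sqrt_continuous.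
Qed.

Definition annulus (Rad beta : R) : set (n.-tuple R) :=
  [set xi | Rad - beta <= enorm xi <= Rad + beta].

Lemma measurable_annulus Rad beta : measurable (annulus Rad beta).
Proof.
rewrite (_ : annulus _ _ = (fun xi => enorm xi) @^-1` `[Rad - beta, Rad + beta]); last first.
  by apply/seteqP; split => x /=; rewrite in_itv.
by rewrite -[X in measurable X]setTI; apply: (@measurable_enorm _ _ id).
Qed.

Hypothesis n0 : (0 < n)%N.

Definition estimate (V : set (n.-tuple R)) (beta C D Rad : R) := forall h : n.-tuple R -> R,
  (mu n).-integrable setT (EFin \o h) -> (L2e (mu n) h < +oo)%E ->
  (L2e (mu n) h <= C%:E * \int[mu n]_y (\1_V y * h y ^+ 2)%:E +
    D%:E * \int[mu n]_xi (\1_(~` annulus Rad beta) xi * En h xi)%:E)%E.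

(** [k], [tau] and [M] depend only on [ell], [r] and [b], and [A] is chosen after them. The
    direction hypothesis appears for each [Rad] only after [A], [C] and [D], which makes the
    constants uniform in [Rad]. *)
Lemma estimate_of_direction (E : set (n.-tuple R)) (ell gamma r b beta : R) :
  0 < ell -> 0 < gamma -> GCC1 ell gamma E -> 0 < r -> 0 <= b ->
  exists A C D : R, [/\ 0 < A, 0 <= C, 0 <= D & forall Rad,
    (forall eta : n.-tuple R, exists2 e, enorm e = 1 &
      forall xi, (forall i, `|tnth xi i - tnth eta i| <= A / 2) -> annulus Rad beta xi ->
        `|dotp e xi - Rad| <= b) ->
    estimate (cellhull r (supnbhd E (3 * r))) beta C D Rad].
Proof.
move=> l0 g0 gcc r0 b0; have [k k0 Hk] := exists_nodes b l0 r0.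
set tau := r / k%:R in Hk; set M := Num.truncn _ in Hk.
have tau0 : 0 < tau by rewrite divr_gt0// ltr0n.
have Mell : M%:R * tau <= ell.
  have /andP[H _] := truncn_itv (divr_ge0 (ltW l0) (ltW tau0)).
  by rewrite -ler_pdivlMr.
have st0 : 0 <= stability R k M by apply: sumr_ge0 => m _; exact: stab_ge0.
pose B := 4 * (stability R k M * (n%:R * (2 * (pi ^- 2 / r)))).
have B0 : 0 <= B.
  rewrite mulr_ge0// mulr_ge0// mulr_ge0// mulr_ge0// divr_ge0 ?(ltW r0)//.
  by rewrite invr_ge0 sqr_ge0.
have A0 : 0 < B + 1 by rewrite ltr_wpDl.
exists (B + 1), (2 * stability R k M), (16 * M.+1%:R * (5 ^+ M) ^+ 2); split => //.
  exact: mulr_ge0.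
move=> Rad dir h ih h2.
apply: (recovery (U := cellhull r (supnbhd E r)) A0 tau0 b0 r0 Mell) => //.
- exact: measurable_annulus.
- exact: measurable_cellhull.
- exact: measurable_cellhull.
- by move=> x y; exact: far_cellhull.
- move=> e x e1; have [m mM Um] := GCC1_nodes x l0 g0 gcc e1 r0 k0.
  by exists m => // j jk; apply: sub_cellhull; exact: Um.
(* With [A = B + 1] the tail condition becomes [A ^ (n - 1) * B <= A ^ n]. *)
rewrite (_ : stability R k M * _ = (B + 1) ^+ n.-1 * (B / 4)); last by rewrite /B; lra.
have -> : (B + 1) ^+ n = (B + 1) ^+ n.-1 * (B + 1) by rewrite -exprSr prednK.
rewrite -mulrA ler_wpM2l ?exprn_ge0 ?(ltW A0)//; lra.
Qed.

Lemma uniform_estimate (E : set (n.-tuple R)) (beta delta : R) :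
  satisfies_GCC1 E -> 0 < beta -> 0 < delta ->
  exists (V : set (n.-tuple R)) (C D : R), [/\ measurable V, V `<=` Unbhd delta E, 0 <= C, 0 <= D &
    forall Rad, 0 < Rad -> estimate V beta C D Rad].
Proof.
move=> [ell [gamma [l0 g0 gcc]]] b0 d0.
(* The hull of the [3 * r]-neighbourhood reaches up to [4 * r], the radius at which [supnbhd_Unbhd]
   applies. *)
pose r := delta / (2 * n.+1%:R) / 4.
have r0 : 0 < r by rewrite divr_gt0// divr_gt0// mulr_gt0// ltr0n.
have [|A1 [C1 [D1 [A10 C10 D10 H1]]]] := @estimate_of_direction E ell gamma r (beta + 1) beta l0 g0 gcc r0.
  by rewrite addr_ge0// ltW.
(* The threshold of [cap_direction] for the side [A1] just obtained; it could not be fixed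
   earlier. *)
pose a := n%:R * (A1 / 2); pose R0 := beta + a + a ^+ 2 + 1.
have a0 : 0 <= a by rewrite mulr_ge0// divr_ge0// ltW.
have R00 : 0 < R0 by rewrite ltr_wpDl// addr_ge0 ?sqr_ge0// addr_ge0// ltW.
(* Below [R0] the bound of [any_direction] is at most [2 * R0 + beta], so a second application with
   this larger [b] covers the bounded range. *)
have [|A2 [C2 [D2 [A20 C20 D20 H2]]]] := @estimate_of_direction E ell gamma r (2 * R0 + beta) beta l0 g0 gcc r0.
  by rewrite addr_ge0 ?(ltW b0)// mulr_ge0// ltW.
exists (cellhull r (supnbhd E (3 * r))), (C1 + C2), (D1 + D2); split.
- exact: measurable_cellhull.
- move=> x /(cellhull_supnbhd r0); apply: supnbhd_Unbhd => //.
  by rewrite /r; set q := delta / (2 * _); lra.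
- exact: addr_ge0.
- exact: addr_ge0.
move=> Rad Rad0 h ih h2.
have I0 (S : set (n.-tuple R)) : (0 <= \int[mu n]_y (\1_S y * h y ^+ 2)%:E)%E.
  by apply: integral_ge0 => y _; rewrite lee_fin mulr_ge0 ?sqr_ge0.
have E0 (S : set (n.-tuple R)) : (0 <= \int[mu n]_y (\1_S y * En h y)%:E)%E.
  by apply: integral_ge0 => y _; rewrite lee_fin mulr_ge0 ?En_ge0.
have [RR|RR] := leP R0 Rad.
  apply: (le_trans (H1 Rad _ h ih h2)).
    by move=> eta; apply: (cap_direction n0 A10 b0 RR).
  by apply: leeD; rewrite lee_wpmul2r// lee_fin lerDl.
apply: (le_trans (H2 Rad _ h ih h2)).
  move=> eta; have [e e1 He] := any_direction n0 beta Rad.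
  exists e => // xi _ /He H; apply: (le_trans H); rewrite gtr0_norm//; lra.
by apply: leeD; rewrite lee_wpmul2r// lee_fin lerDr.
Qed.

End UniformEstimate.

(** * From the iterated integrals of the statement to energies of truncations *)

Section Energies.
Variables (R : realType) (n : nat).
Implicit Types (f h : n.-tuple R -> R).

(* Free of measurability hypotheses, so that [Unbhd delta E] need not be shown to be Borel. *)
Lemma le_iint k (f g : k.-tuple R -> \bar R) :
  (forall x, 0 <= f x)%E -> (forall x, f x <= g x)%E -> (0 <= iint f <= iint g)%E.
Proof.
elim: k f g => [|k IH] f g f0 fg /=; first by rewrite f0 fg.
have H x := IH _ _ (fun t => f0 (cons_tuple x t)) (fun t => fg (cons_tuple x t)).
have F0 x : (0 <= iint (fun t : k.-tuple R => f (cons_tuple x t)))%E by have /andP[] := H x.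
have FG x : (iint (fun t : k.-tuple R => f (cons_tuple x t)) <= iint (fun t : k.-tuple R => g (cons_tuple x t)))%E.
  by have /andP[] := H x.
apply/andP; split; first exact: integral_ge0.
rewrite !ge0_integralTE//; last by move=> x; exact: le_trans (F0 x) (FG x).
apply: ereal_sup_le => _ [s /= sf <-]; exists s => // x.
exact: le_trans (sf x) (FG x).
Qed.

Lemma rintE f : (mu n).-integrable setT (EFin \o f) -> rint f = \int[mu n]_x f x.
Proof.
move=> If; have mf : measurable_fun setT f by case/integrableP: If => /measurable_EFinP.
have mp : measurable_fun setT (fun x => (Num.max (f x) 0)%:E).
  by apply/measurable_EFinP; exact: measurable_maxr.
have mm : measurable_fun setT (fun x => (Num.max (- f x) 0)%:E).
  by apply/measurable_EFinP; apply: measurable_maxr => //; exact: measurableT_comp.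
rewrite /rint !iintE//; try by move=> x; rewrite lee_fin le_max lexx orbT.
have Fp := integrable_pos_fin_num measurableT If.
have Fm := integrable_neg_fin_num measurableT If.
rewrite /Rintegral [in RHS]integralE (fineB Fp Fm).
by congr (fine _ - fine _); apply: eq_integral => x _; rewrite ?funeposE ?funenegE /= EFin_max.
Qed.

Definition sqnorm (A : set (n.-tuple R)) f1 f2 : \bar R :=
  (\int[mu n]_x (\1_A x * (f1 x ^+ 2 + f2 x ^+ 2))%:E)%E.

Lemma L2sqE (A : set (n.-tuple R)) f1 f2 : measurable A ->
  measurable_fun setT f1 -> measurable_fun setT f2 -> L2sq A f1 f2 = sqnorm A f1 f2.
Proof.
move=> mA m1 m2; rewrite /L2sq iintE//.
- apply/measurable_EFinP; apply: measurable_funM; first exact: measurable_indic.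
  by apply: measurable_funD; exact: measurable_funX.
- by move=> x; rewrite lee_fin mulr_ge0// addr_ge0 ?sqr_ge0.
Qed.

Definition cball (k : nat) : set (n.-tuple R) := [set y | enorm y <= k%:R].

Lemma measurable_cball k : measurable (cball k).
Proof.
rewrite (_ : cball k = (fun xi => enorm xi) @^-1` `]-oo, k%:R]); last first.
  by apply/seteqP; split => x /=; rewrite in_itv.
by rewrite -[X in measurable X]setTI; apply: (@measurable_enorm _ _ _ _ id).
Qed.

Definition trunc k f x : R := \1_(cball k) x * f x.

Lemma measurable_trunc k f : measurable_fun setT f -> measurable_fun setT (trunc k f).
Proof. by move=> mf; apply: measurable_funM => //; exact: measurable_indic (measurable_cball k). Qed.

Lemma trunc_sqr k f x : trunc k f x ^+ 2 = \1_(cball k) x * f x ^+ 2.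
Proof. by rewrite /trunc exprMn !indicE -natrX; case: (_ \in _). Qed.

Lemma L2e_trunc_le k f : measurable_fun setT f -> (L2e (mu n) (trunc k f) <= L2e (mu n) f)%E.
Proof.
move=> mf; apply: ge0_le_integral_EFin.
- by apply: measurable_funX; exact: measurable_trunc.
- exact: measurable_funX.
- by move=> x; exact: sqr_ge0.
- by move=> x; rewrite trunc_sqr ler_piMl ?sqr_ge0// indicE lern1 leq_b1.
Qed.

(** Inside the ball [|f| <= 1 + f ^+ 2], and the ball lies in the cube of side [2 k], whose
    indicator [qbox] is integrable. *)
Lemma trunc_integrable k f : measurable_fun setT f -> (L2e (mu n) f < +oo)%E ->
  (mu n).-integrable setT (EFin \o trunc k f).
Proof.
move=> mf f2; have If2 : (mu n).-integrable setT (EFin \o (fun x => f x ^+ 2)).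
  by apply: ge0_integrable => // [|x]; [exact: measurable_funX|exact: sqr_ge0].
apply: (integrable_dom (g := fun x => qbox (2 * k%:R) x + f x ^+ 2)).
- exact: measurable_trunc.
- have := integrableD measurableT (integrable_qbox n (2 * k%:R)) If2.
  by apply: eq_integrable => // x _ /=; rewrite EFinD.
move=> x; rewrite /trunc indicE; case: (boolP (x \in cball k)) => [|_]; last first.
  by rewrite mul0r normr0 addr_ge0 ?sqr_ge0// qbox_ge0.
rewrite inE mul1r => xk.
have -> : qbox (2 * k%:R) x = 1.
  rewrite /qbox /tprod big1// => i _; rewrite /boxw ifT//.
  by rewrite mulrAC mulfV// mul1r (le_trans (tnth_le_enorm x i)).
rewrite -[f x ^+ 2]real_normK ?num_real//.
by have := sqr_ge0 (`|f x| - 1); have := normr_ge0 (f x); move: `|f x| => y; nra.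
Qed.

Section truncated.
Variables (f1 f2 : n.-tuple R -> R) (k : nat).
Hypotheses (m1 : measurable_fun setT f1) (m2 : measurable_fun setT f2).
Hypotheses (e1 : (L2e (mu n) f1 < +oo)%E) (e2 : (L2e (mu n) f2 < +oo)%E).

Let i1 := trunc_integrable k m1 e1.
Let i2 := trunc_integrable k m2 e2.

Let mphase xi : measurable_fun setT (fun x : n.-tuple R => 2 * pi * dotp x xi).
Proof. exact: measurable_phase0. Qed.

Lemma trunc_FT_reE xi : trunc_FT_re f1 f2 k xi = FC (trunc k f1) xi + FS (trunc k f2) xi.
Proof.
rewrite /FC /FS -RintegralD//; [|exact: (integrable_cosM i1)|exact: (integrable_sinM i2)].
rewrite /trunc_FT_re rintE; last first.
  have := integrableD measurableT (integrable_cosM i1 (mphase xi)) (integrable_sinM i2 (mphase xi)).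
  by apply: eq_integrable => // x _ /=; rewrite -EFinD /trunc -/(cball k); congr EFin; ring.
by apply: eq_Rintegral => x _; rewrite /trunc -/(cball k); ring.
Qed.

Lemma trunc_FT_imE xi : trunc_FT_im f1 f2 k xi = FC (trunc k f2) xi - FS (trunc k f1) xi.
Proof.
rewrite /FC /FS -RintegralB//; [|exact: (integrable_cosM i2)|exact: (integrable_sinM i1)].
rewrite /trunc_FT_im rintE; last first.
  have := integrableB measurableT (integrable_cosM i2 (mphase xi)) (integrable_sinM i1 (mphase xi)).
  by apply: eq_integrable => // x _ /=; rewrite -EFinB /trunc -/(cball k); congr EFin; ring.
by apply: eq_Rintegral => x _; rewrite /trunc -/(cball k); ring.
Qed.

Lemma FC_topp h xi : FC h (topp xi) = FC h xi.
Proof. by apply: eq_Rintegral => x _; rewrite dotpC dotpN dotpC mulrN cosN. Qed.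

Lemma FS_topp h xi : (mu n).-integrable setT (EFin \o h) -> FS h (topp xi) = - FS h xi.
Proof.
move=> ih; rewrite -mulN1r /FS -RintegralZl//; last exact: (integrable_sinM ih (mphase xi)).
by apply: eq_Rintegral => x _; rewrite dotpC dotpN dotpC mulrN sinN mulN1r mulrN.
Qed.

Let FTsq xi := trunc_FT_re f1 f2 k xi ^+ 2 + trunc_FT_im f1 f2 k xi ^+ 2.

(** The cross terms pair a cosine integral of one part with a sine integral of the other. They are
    odd in [xi], so averaging over [xi] and its opposite removes them. *)
Lemma En_trunc xi : En (trunc k f1) xi + En (trunc k f2) xi = (FTsq xi + FTsq (topp xi)) / 2.
Proof.
rewrite /FTsq !trunc_FT_reE !trunc_FT_imE !FC_topp (FS_topp _ i1) (FS_topp _ i2) /En; lra.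
Qed.

Lemma measurable_trunc_FT_re : measurable_fun setT (trunc_FT_re f1 f2 k).
Proof.
rewrite (_ : trunc_FT_re _ _ _ = fun xi => FC (trunc k f1) xi + FS (trunc k f2) xi); last first.
  by apply/funext => xi; rewrite trunc_FT_reE.
by apply: measurable_funD; [exact: measurable_FC|exact: measurable_FS].
Qed.

Lemma measurable_trunc_FT_im : measurable_fun setT (trunc_FT_im f1 f2 k).
Proof.
rewrite (_ : trunc_FT_im _ _ _ = fun xi => FC (trunc k f2) xi - FS (trunc k f1) xi); last first.
  by apply/funext => xi; rewrite trunc_FT_imE.
by apply: measurable_funB; [exact: measurable_FC|exact: measurable_FS].
Qed.

(* [En] is even in [xi] while the transform of a complex function need not be:
   the two energies agree only after integration over a symmetric set. *)
Lemma integral_En_trunc (S : set (n.-tuple R)) : measurable S -> (forall xi, S (topp xi) <-> S xi) ->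
  (\int[mu n]_xi (\1_S xi * En (trunc k f1) xi)%:E + \int[mu n]_xi (\1_S xi * En (trunc k f2) xi)%:E =
   \int[mu n]_xi (\1_S xi * FTsq xi)%:E)%E.
Proof.
move=> mS symS.
have mSi : measurable_fun setT (\1_S : n.-tuple R -> R) by exact: measurable_indic.
have S1 xi : (\1_S (topp xi) : R) = \1_S xi.
  by rewrite !indicE; congr (nat_of_bool _)%:R; apply/idP/idP; rewrite !inE; move/symS.
have mE1 : measurable_fun setT (fun xi => \1_S xi * En (trunc k f1) xi).
  by apply: measurable_funM => //; exact: measurable_En.
have mE2 : measurable_fun setT (fun xi => \1_S xi * En (trunc k f2) xi).
  by apply: measurable_funM => //; exact: measurable_En.
have E0 f xi : 0 <= \1_S xi * En (trunc k f) xi by rewrite mulr_ge0 ?En_ge0.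
have mFT : measurable_fun setT (fun xi => \1_S xi * FTsq xi).
  apply: measurable_funM => //; apply: measurable_funD; apply: measurable_funX.
  - exact: measurable_trunc_FT_re.
  - exact: measurable_trunc_FT_im.
have FT0 xi : 0 <= \1_S xi * FTsq xi by rewrite mulr_ge0// addr_ge0 ?sqr_ge0.
have mFTN : measurable_fun setT (fun xi => \1_S (topp xi) * FTsq (topp xi)).
  by apply: (measurableT_comp mFT); exact: measurable_topp.
rewrite -(ge0_integral_EFinD (mu n) mE1 mE2 (E0 _) (E0 _)).
have -> : (\int[mu n]_xi (\1_S xi * En (trunc k f1) xi + \1_S xi * En (trunc k f2) xi)%:E =
    \int[mu n]_xi (2^-1 * (\1_S xi * FTsq xi + \1_S (topp xi) * FTsq (topp xi)))%:E)%E.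
  by apply: eq_integral => xi _; rewrite -mulrDr En_trunc S1; congr EFin; lra.
rewrite (ge0_integral_EFinZ (mu n) (measurable_funD mFT mFTN)) ?invr_ge0//; last first.
  by move=> xi; rewrite addr_ge0.
rewrite (ge0_integral_EFinD (mu n) mFT mFTN FT0 (fun xi => FT0 (topp xi))).
rewrite (ge0_integral_mu_opp (f := fun xi => (\1_S xi * FTsq xi)%:E)); last 2 first.
- exact/measurable_EFinP.
- by move=> xi; rewrite lee_fin.
set I := integral _ _ _.
have I0 : (0 <= I)%E by apply: integral_ge0 => xi _; rewrite lee_fin.
rewrite ge0_muleDr// -ge0_muleDl ?lee_fin ?invr_ge0// -EFinD.
by rewrite (_ : 2^-1 + 2^-1 = 1 :> R) ?mul1e//; lra.
Qed.

End truncated.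
End Energies.

(** * Passage to the limit in the truncations *)

Section Conclusion.
Variables (R : realType) (n : nat).
Variables (V : set (n.-tuple R)) (beta C D Rad : R).
Hypotheses (mV : measurable V) (C0 : 0 <= C) (D0 : 0 <= D).
Hypothesis estV : estimate V beta C D Rad.
Variables f1 f2 g1 g2 : n.-tuple R -> R.
Hypotheses (m1 : measurable_fun setT f1) (m2 : measurable_fun setT f2).
Hypothesis f12 : (L2sq setT f1 f2 < +oo)%E.
Hypotheses (mg1 : measurable_fun setT g1) (mg2 : measurable_fun setT g2).
Hypothesis ft : is_L2_FT f1 f2 g1 g2.
Hypothesis spec : forall xi : n.-tuple R, ~ (Rad - beta <= enorm xi <= Rad + beta) ->
  g1 xi = 0 /\ g2 xi = 0.

Let F x : R := f1 x ^+ 2 + f2 x ^+ 2.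
Let F0 x : 0 <= F x. Proof. by rewrite addr_ge0 ?sqr_ge0. Qed.
Let mF : measurable_fun setT F.
Proof. by apply: measurable_funD; exact: measurable_funX. Qed.

Let mZ (S : set (n.-tuple R)) (f : n.-tuple R -> R) : measurable S -> measurable_fun setT f ->
  measurable_fun setT (fun x => \1_S x * f x).
Proof. by move=> mS mf; apply: measurable_funM => //; exact: measurable_indic. Qed.

Let Z0 (S : set (n.-tuple R)) (f : n.-tuple R -> R) : (forall x, 0 <= f x) ->
  forall x, 0 <= \1_S x * f x.
Proof. by move=> f0 x; rewrite mulr_ge0. Qed.

Let sqnormT : sqnorm setT f1 f2 = (\int[mu n]_x (F x)%:E)%E.
Proof. by apply: eq_integral => x _; rewrite indicT mul1r. Qed.

Let Foo : (\int[mu n]_x (F x)%:E < +oo)%E.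
Proof. by rewrite -sqnormT -L2sqE. Qed.

Let L2e_fin (f : n.-tuple R -> R) : measurable_fun setT f -> (forall x, f x ^+ 2 <= F x) ->
  (L2e (mu n) f < +oo)%E.
Proof.
move=> mf fF; apply: le_lt_trans Foo; apply: ge0_le_integral_EFin => // [|x].
- exact: measurable_funX.
- exact: sqr_ge0.
Qed.
Let e1 : (L2e (mu n) f1 < +oo)%E.
Proof. by apply: L2e_fin => // x; rewrite lerDl sqr_ge0. Qed.
Let e2 : (L2e (mu n) f2 < +oo)%E.
Proof. by apply: L2e_fin => // x; rewrite lerDr sqr_ge0. Qed.

Let err k := L2sq setT (fun xi => trunc_FT_re f1 f2 k xi - g1 xi) (fun xi => trunc_FT_im f1 f2 k xi - g2 xi).

Let integral_trunc (S : set (n.-tuple R)) k : measurable S ->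
  (\int[mu n]_x (\1_S x * trunc k f1 x ^+ 2)%:E + \int[mu n]_x (\1_S x * trunc k f2 x ^+ 2)%:E =
   \int[mu n]_x (\1_S x * (\1_(@cball R n k) x * F x))%:E)%E.
Proof.
move=> mS; have mt f : measurable_fun setT f -> measurable_fun setT (fun x => \1_S x * trunc k f x ^+ 2).
  by move=> mf; apply: mZ => //; apply: measurable_funX; exact: measurable_trunc.
have t0 f x : 0 <= \1_S x * trunc k f x ^+ 2 by rewrite mulr_ge0 ?sqr_ge0.
rewrite -(ge0_integral_EFinD (mu n) (mt f1 m1) (mt f2 m2) (t0 f1) (t0 f2)).
by apply: eq_integral => x _; rewrite !trunc_sqr /F -!mulrDr.
Qed.

(** Off the annulus [g1] and [g2] vanish, so there the transform of the truncation is itself the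
    approximation error. *)
Let off_energy_le k :
  (\int[mu n]_xi (\1_(~` @annulus R n Rad beta) xi * En (trunc k f1) xi)%:E +
   \int[mu n]_xi (\1_(~` @annulus R n Rad beta) xi * En (trunc k f2) xi)%:E <= err k)%E.
Proof.
have mre := measurable_trunc_FT_re k m1 m2 e1 e2.
have mim := measurable_trunc_FT_im k m1 m2 e1 e2.
have mS : measurable (~` @annulus R n Rad beta) by apply: measurableC; exact: measurable_annulus.
rewrite integral_En_trunc//; last by move=> xi; rewrite /annulus /= enorm_topp.
rewrite /err L2sqE//; [|exact: measurable_funB|exact: measurable_funB].
apply: ge0_le_integral_EFin => [|||xi].
- by apply: mZ => //; apply: measurable_funD; exact: measurable_funX.
- by apply: mZ => //; apply: measurable_funD; apply: measurable_funX; exact: measurable_funB.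
- by apply: Z0 => xi; rewrite addr_ge0 ?sqr_ge0.
rewrite indicT mul1r indicE; case: (boolP (xi \in _)) => [|_].
  by rewrite inE mul1r => /spec[-> ->]; rewrite !subr0.
by rewrite mul0r addr_ge0 ?sqr_ge0.
Qed.

Let trunc_le k : (\int[mu n]_x (\1_(@cball R n k) x * F x)%:E <= C%:E * sqnorm V f1 f2 + D%:E * err k)%E.
Proof.
have mB := @measurable_cball R n k.
have E1 := estV (trunc_integrable k m1 e1) (le_lt_trans (L2e_trunc_le k m1) e1).
have E2 := estV (trunc_integrable k m2 e2) (le_lt_trans (L2e_trunc_le k m2) e2).
have I0 (f : n.-tuple R -> R) (S : set (n.-tuple R)) : (0 <= \int[mu n]_y (\1_S y * trunc k f y ^+ 2)%:E)%E.
  by apply: integral_ge0 => y _; rewrite lee_fin mulr_ge0 ?sqr_ge0.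
have O0 (f : n.-tuple R -> R) (S : set (n.-tuple R)) : (0 <= \int[mu n]_y (\1_S y * En (trunc k f) y)%:E)%E.
  by apply: integral_ge0 => y _; rewrite lee_fin mulr_ge0 ?En_ge0.
have L (f : n.-tuple R -> R) : L2e (mu n) (trunc k f) = (\int[mu n]_x (\1_setT x * trunc k f x ^+ 2)%:E)%E.
  by apply: eq_integral => x _; rewrite indicT mul1r.
have -> : (\int[mu n]_x (\1_(@cball R n k) x * F x)%:E = L2e (mu n) (trunc k f1) + L2e (mu n) (trunc k f2))%E.
  rewrite !L integral_trunc//; apply: eq_integral => x _.
  by rewrite indicT mul1r.
apply: (le_trans (leeD E1 E2)); rewrite addeACA -!ge0_muleDr//.
apply: leeD; apply: lee_wpmul2l; rewrite ?lee_fin//.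
rewrite integral_trunc//; apply: ge0_le_integral_EFin => [|||x].
- by apply: mZ => //; exact: mZ.
- exact: mZ.
- by apply: Z0; exact: Z0.
- by rewrite ler_wpM2l// indicM_le.
Qed.

(** The energy inside the ball is controlled by [trunc_le]; the energy outside and the transform
    error both tend to 0. *)
Lemma sqnorm_le : (sqnorm setT f1 f2 <= C%:E * sqnorm V f1 f2)%E.
Proof.
pose rest k := (\int[mu n]_x (\1_(~` @cball R n k) x * F x)%:E)%E.
have mB := @measurable_cball R n.
have rest0 : tends0 rest.
  apply: (integral_tends0 (H := fun x => (F x)%:E)) => //.
  - by move=> k; apply/measurable_EFinP; apply: mZ => //; exact: measurableC.
  - exact/measurable_EFinP.
  - by move=> k x; rewrite lee_fin Z0.
  - by move=> k x; rewrite lee_fin indicM_le.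
  move=> x _ e e0; exists (Num.truncn (enorm x)).+1 => k xk; rewrite indicE memNset ?mul0r ?lee_fin ?ltW//.
  move=> /(_ _); apply; rewrite /cball /=.
  have /andP[_ /ltW] := truncn_itv (enorm_ge0 x); move=> /le_trans; apply.
  by rewrite ler_nat.
have err_ge0 k : (0 <= err k)%E.
  rewrite /err L2sqE//.
  - by apply: integral_ge0 => x _; rewrite lee_fin mulr_ge0// addr_ge0 ?sqr_ge0.
  - by apply: measurable_funB => //; exact: measurable_trunc_FT_re.
  - by apply: measurable_funB => //; exact: measurable_trunc_FT_im.
have err0 : tends0 err by apply/(tends0P err_ge0); exact: ft.
apply/lee_addgt0Pr => e e0.
have [N /(_ N (leqnn N)) H] := tends0D (tends0Z D0 err0) rest0 e0.
have -> : sqnorm setT f1 f2 = (\int[mu n]_x (\1_(@cball R n N) x * F x)%:E + rest N)%E.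
  have mC : measurable (~` @cball R n N) by exact: measurableC.
  rewrite sqnormT -(ge0_integral_EFinD (mu n) (mZ (mB N) mF) (mZ mC mF) (Z0 _ F0) (Z0 _ F0)).
  apply: eq_integral => x _; rewrite -mulrDl !indicE in_setC.
  by case: (x \in _); rewrite ?addr0 ?add0r mul1r.
apply: le_trans (leeD2r _ (trunc_le N)) _.
by rewrite -addeA leeD2l.
Qed.

End Conclusion.

(** The constant is [C + 1] so that its root is positive: when the right-hand energy is infinite,
    the product must be [+oo] and not 0. *)
Lemma L2norm_le (R : realType) (n : nat) (A B : set (n.-tuple R)) (f1 f2 : n.-tuple R -> R) (C : R) :
  0 <= C -> (0 <= L2sq A f1 f2)%E -> (L2sq A f1 f2 < +oo)%E -> (0 <= L2sq B f1 f2)%E ->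
  (L2sq A f1 f2 <= C%:E * L2sq B f1 f2)%E ->
  (L2norm A f1 f2 <= (Num.sqrt (C + 1))%:E * L2norm B f1 f2)%E.
Proof.
rewrite /L2norm => C0; have S0 : 0 < Num.sqrt (C + 1) by rewrite sqrtr_gt0 ltr_wpDl.
case: (L2sq A f1 f2) => [a||] // a0 _; case: (L2sq B f1 f2) => [b||] // b0 ab; last first.
  by rewrite gt0_muley ?lte_fin// leey.
rewrite !lee_fin in a0 b0 ab *.
rewrite -sqrtrM ?addr_ge0// ler_wsqrtr// (le_trans ab)//.
by rewrite mulrDl mul1r lerDl.
Qed.

Theorem theorem1p1 (R : realType) (d : nat) (E : set (d.-tuple R)) :
  (0 < d)%N -> leb_measurable E -> satisfies_GCC1 E ->
  forall beta delta : R, 0 < beta -> 0 < delta ->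
  exists C : R, 0 < C /\
    forall (Rad : R), 0 < Rad ->
    forall f1 f2 g1 g2 : d.-tuple R -> R,
      measurable_fun setT f1 -> measurable_fun setT f2 ->
      (L2sq setT f1 f2 < +oo)%E ->
      measurable_fun setT g1 -> measurable_fun setT g2 ->
      is_L2_FT f1 f2 g1 g2 ->
      (forall xi : d.-tuple R, ~ (Rad - beta <= enorm xi <= Rad + beta) ->
         g1 xi = 0 /\ g2 xi = 0) ->
      (L2norm setT f1 f2 <= C%:E * L2norm (Unbhd delta E) f1 f2)%E.
Proof.
move=> d0 _ gcc beta delta b0 dl0.
have [V [C [D [mV VU C0 D0 est]]]] := uniform_estimate d0 gcc b0 dl0.
exists (Num.sqrt (C + 1)); split; first by rewrite sqrtr_gt0 ltr_wpDl.
move=> Rad Rad0 f1 f2 g1 g2 m1 m2 f12 mg1 mg2 ft spec.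
have sq0 (A : set (d.-tuple R)) x : (0 <= (\1_A x * (f1 x ^+ 2 + f2 x ^+ 2))%:E)%E.
  by rewrite lee_fin mulr_ge0// addr_ge0 ?sqr_ge0.
(* The estimate is proved on the Borel set [V]; monotonicity of [iint] carries it to the
   neighbourhood that contains it. *)
have /andP[V0 VE] : (0 <= L2sq V f1 f2 <= L2sq (Unbhd delta E) f1 f2)%E.
  apply: le_iint => // x; rewrite lee_fin ler_wpM2r ?addr_ge0 ?sqr_ge0// !indicE ler_nat.
  by case: (boolP (x \in V)) => //; rewrite inE => /VU; move=> H; rewrite mem_set.
apply: L2norm_le => //.
- by have /andP[] := le_iint (sq0 setT) (fun x => lexx _).
- exact: le_trans VE.
apply: (le_trans _ (lee_wpmul2l _ VE)); last by rewrite lee_fin.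
by rewrite !L2sqE//; exact: (sqnorm_le mV C0 D0 (est Rad Rad0) m1 m2 f12 mg1 mg2 ft spec).
Qed.
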